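(* Let $\mathcal{C}$ be a species with $\mathcal{C}_1\neq\emptyset$ and $\lvert\mathcal{C}_n\rvert\sim b\,n^{-(1+\alpha)}\rho^{-n}n!$ as $n\to\infty$, for constants $b,\rho>0$ and $1<\alpha<2$. Let $\mathcal{G}=\textsc{SET}\circ\mathcal{C}$ and, for $\lambda\in(0,1)$, let $N:=\lfloor\lambda n\rfloor$. Then, as $n\to\infty$, $$\frac{N!}{n!}\lvert\mathcal{G}_{n,N}\rvert\sim \begin{cases} c_{-}(\lambda)\,n^{-\alpha}\rho^{-n}C(\rho)^N, & \lambda\in(0,\lambda^{*}),\\ c\, n^{-1/\alpha}\rho^{-n}C(\rho)^N, & \lambda=\lambda^{*},\\ c_{+}(\lambda)\,n^{-1/2}x_\lambda^{-n}C(x_\lambda)^N, & \lambda\in(\lambda^{*},1), \end{cases}$$ where $\lambda^{*}=\frac{C(\rho)}{\rho C'(\rho)}$, $c_{-}(\lambda)=\frac{b\lambda}{C(\rho)(1-\lambda/\lambda^{*})^{\alpha+1}}$, $c=\left(\frac{\alpha C(\rho)}{\lambda^{*}b\lvert\Gamma(1-\alpha)\rvert}\right)^{1/\alpha}\frac{1}{\lvert\Gamma(-1/\alpha)\rvert}$, for $\lambda\in(\lambda^*,1)$ the number $x_\lambda\in(0,\rho)$ is the unique solution of $x_\lambda C'(x_\lambda)/C(x_\lambda)=1/\lambda$, and $c_{+}(\lambda)=(2\pi\sigma_\lambda^2\lambda)^{-1/2}$ with $\sigma_\lambda^2=\frac{x_\lambda^2C''(x_\lambda)}{C(x_\lamb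da)}+\frac1\lambda-\frac1{\lambda^2}$.
   Context: A species $\mathcal{F}$ assigns to each finite set $U$ a finite set $\mathcal{F}[U]$ of objects (e.g. graphs with vertex set $U$) and to each bijection $U\to V$ a compatible bijection $\mathcal{F}[U]\to\mathcal{F}[V]$; $\mathcal{F}_n:=\mathcal{F}[\{1,\dots,n\}]$, and the exponential generating function is $F(x)=\sum_n\lvert\mathcal{F}_n\rvert x^n/n!$. Here $\mathcal{C}$ has no objects of size $0$ and $C(x)$ is its exponential generating function (radius of convergence $\rho$). $\mathcal{G}=\textsc{SET}\circ\mathcal{C}$ is the species whose objects on a label set $U$ are sets of $\mathcal{C}$-objects whose label sets form a partition of $U$ (e.g. graphs all of whose components lie in a class $\mathcal{C}$ of connected graphs). $\mathcal{G}_{n,k}$ is the set of $\mathcal{G}$-objects on $\{1,\dots,n\}$ with exactly $k$ components (i.e., partition blocks), so $\frac{k!}{n!}\lvert\mathcal{G}_{n,k}\rvert=[x^n]C(x)^k$. $\Gamma$ denotes the Gamma function. *)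

(* Defs.v *)
From HB Require Import structures.
From mathcomp Require Import all_boot all_order all_algebra.

Set Implicit Arguments.
Unset Strict Implicit.
Unset Printing Implicit Defensive.

Import Order.TTheory GRing.Theory Num.Theory.

(* A species is a functor from finite sets and bijections to finite sets.
   [sp_map_ext] makes the transport depend only on the bijection, not on the
   proof of bijectivity; that each transport is a bijection follows from
   [sp_map_id] and [sp_map_comp]. *)
Record species := Species {
  sp_obj :> finType -> finType;
  sp_map : forall (U V : finType) (f : U -> V), bijective f ->
    sp_obj U -> sp_obj V;
  sp_map_ext : forall (U V : finType) (f g : U -> V)
    (hf : bijective f) (hg : bijective g),
    f =1 g -> sp_map hf =1 sp_map hg;
  sp_map_id : forall (U : finType) (h : bijective (@id U)), sp_map h =1 id;
  sp_map_comp : forall (U V W : finType) (f : U -> V) (g : V -> W)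
    (hf : bijective f) (hg : bijective g) (hgf : bijective (g \o f)),
    sp_map hgf =1 sp_map hg \o sp_map hf
}.

Definition block (U : finType) (B : {set U}) : finType := {x : U | x \in B}.

Definition set_partition (U : finType) : finType :=
  {P : {set {set U}} | partition P [set: U]}.

(* Since distinct components have distinct label sets, a set of C-objects whose
   label sets form a partition P is a choice of one object of C[B] for each
   block B of P. *)
Definition set_comp_obj (C : species) (U : finType) : finType :=
  {P : set_partition U & {dffun forall B : block (val P), C (block (val B))}}.

Section Transport.
Variable C : species.

Lemma set_comp_obj_eq (U : finType) (g h : set_comp_obj C U) :
  val (tag g) = val (tag h) ->
  (forall B hB hB', tagged g (exist _ B hB) = tagged h (exist _ B hB')) ->
  g = h.
Proof.
case: g h => [[p hp] g] [[q hq] h] /= epq; case: _ / epq hq h => hq.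
rewrite (bool_irrelevance hq hp) => h gh; congr existT.
by apply/ffunP => -[B hB]; exact: gh.
Qed.

Lemma restr_subproof (U V : finType) (f : U -> V) (B : {set V})
  (x : block (f @^-1: B)) : f (val x) \in B.
Proof. by have := valP x; rewrite inE. Qed.

Definition restr (U V : finType) (f : U -> V) (B : {set V})
    (x : block (f @^-1: B)) : block B :=
  exist _ (f (val x)) (restr_subproof x).

Lemma restr_bij (U V : finType) (f : U -> V) (B : {set V}) :
  bijective f -> bijective (@restr U V f B).
Proof.
case=> g fK gK.
have gP (y : block B) : g (val y) \in f @^-1: B by rewrite inE gK (valP y).
exists (fun y => exist _ (g (val y)) (gP y)) => x; apply: val_inj => /=.
  by rewrite fK.
by rewrite gK.
Qed.

Definition push_blocks (U V : finType) (f : U -> V) (P : {set {set U}}) :=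
  [set B : {set V} | f @^-1: B \in P].

Lemma push_blocks_preim (U V : finType) (f : U -> V) (P : {set {set U}})
  (B : block (push_blocks f P)) : f @^-1: val B \in P.
Proof. by have := valP B; rewrite inE. Qed.

Lemma push_blocksP (U V : finType) (f : U -> V) (P : set_partition U) :
  bijective f -> partition (push_blocks f (val P)) [set: V].
Proof.
case=> g fK gK; case: P => P /= /and3P[/eqP cov triv nz].
have imK (A : {set U}) : f @^-1: (g @^-1: A) = A.
  by apply/setP => x; rewrite !inE fK.
have preK (B : {set V}) : g @^-1: (f @^-1: B) = B.
  by apply/setP => x; rewrite !inE gK.
apply/and3P; split.
- rewrite eqEsubset subsetT /=; apply/subsetP => y _.
  have : g y \in cover P by rewrite cov inE.
  case/bigcupP => A Api gyA; apply/bigcupP; exists (g @^-1: A).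
    by rewrite inE imK.
  by rewrite inE.
- apply/trivIsetP => A B; rewrite !inE => hA hB AB.
  have /(trivIsetP triv _ _ hA hB) : f @^-1: A != f @^-1: B.
    by apply: contra_neq AB => e; rewrite -[A]preK e preK.
  rewrite -!setI_eq0 -preimsetI => /eqP e.
  by rewrite -[A :&: B]preK e preimset0.
- by rewrite inE preimset0.
Qed.

Definition set_comp_map (U V : finType) (f : U -> V) (hf : bijective f)
    (g : set_comp_obj C U) : set_comp_obj C V :=
  existT
    (fun P : set_partition V =>
       {dffun forall B : block (val P), C (block (val B))})
    (exist _ (push_blocks f (val (tag g))) (push_blocksP (tag g) hf))
    [ffun B : block (push_blocks f (val (tag g))) =>
       sp_map (@restr_bij U V f (val B) hf)
         (tagged g (exist _ (f @^-1: val B) (push_blocks_preim B)))].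

Lemma set_comp_map_ext (U V : finType) (f g : U -> V)
    (hf : bijective f) (hg : bijective g) :
  f =1 g -> set_comp_map hf =1 set_comp_map hg.
Proof.
move=> fg o; have efg (B : {set V}) : f @^-1: B = g @^-1: B.
  by apply/setP => x; rewrite !inE fg.
apply: set_comp_obj_eq => /=; first by apply/setP => B; rewrite !inE efg.
move=> B hB hB'; rewrite !ffunE /=.
move: (push_blocks_preim _) (push_blocks_preim _) => /=.
move: (restr_bij B hf) (restr_bij B hg).
have : forall x y, val x = val y -> restr (f := f) (B := B) x = restr (f := g) y.
  by move=> x y xy; apply: val_inj => /=; rewrite xy fg.
move: (@restr U V f B) (@restr U V g B); rewrite efg => r r' rr' hr hr' h h'.
rewrite (bool_irrelevance h h'); apply: sp_map_ext => x; exact: rr'.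
Qed.

Lemma set_comp_map_id (U : finType) (h : bijective (@id U)) :
  set_comp_map h =1 id.
Proof.
move=> o; have eid (B : {set U}) : id @^-1: B = B.
  by apply/setP => x; rewrite !inE.
apply: set_comp_obj_eq => /=; first by apply/setP => B; rewrite !inE eid.
move=> B hB hB'; rewrite !ffunE /=.
move: (push_blocks_preim _) => /=.
move: (restr_bij B h).
have : forall x, val (restr (f := id) (B := B) x) = val x by [].
move: (@restr U U id B); rewrite eid => r rE hr k.
rewrite (bool_irrelevance k hB').
have r1 : r =1 id by move=> x; apply: val_inj; exact: rE.
have id_bij : bijective (@id (block B)) by exists id.
by rewrite (sp_map_ext hr id_bij r1) sp_map_id.
Qed.

Lemma set_comp_map_comp (U V W : finType) (f : U -> V) (g : V -> W)
    (hf : bijective f) (hg : bijective g) (hgf : bijective (g \o f)) :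
  set_comp_map hgf =1 set_comp_map hg \o set_comp_map hf.
Proof.
move=> o; have egf (B : {set W}) : (g \o f) @^-1: B = f @^-1: (g @^-1: B).
  by apply/setP => x; rewrite !inE.
apply: set_comp_obj_eq => /=; first by apply/setP => B; rewrite !inE egf.
move=> B hB hB'; rewrite !ffunE /=.
move: (push_blocks_preim (exist _ B hB)).
move: (push_blocks_preim (exist _ (g @^-1: B) _)) => /=.
move: (restr_bij B hgf) (restr_bij B hg) (restr_bij (g @^-1: B) hf).
have : forall x y, val x = val y ->
    restr (f := g \o f) (B := B) x = restr (f := g) (restr (f := f) y).
  by move=> x y xy; apply: val_inj => /=; rewrite xy.
move: (@restr U W (g \o f) B); rewrite egf => r rE hr hrg hrf h' h.
rewrite (bool_irrelevance h h').
have hc := bij_comp hrg hrf.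
rewrite -[RHS](sp_map_comp hrf hrg hc); apply: sp_map_ext => x; exact: rE.
Qed.

Definition set_comp : species :=
  Species set_comp_map_ext set_comp_map_id set_comp_map_comp.

Definition components (U : finType) (g : set_comp U) : {set {set U}} :=
  val (tag g).

(* The label set {1, .., n} is represented by 'I_n. *)
Definition set_comp_nk (n k : nat) : {set set_comp 'I_n} :=
  [set g | #|components g| == k].

End Transport.

From mathcomp Require Import all_classical all_reals all_analysis.
Import numFieldNormedType.Exports.
Local Open Scope classical_set_scope.
Local Open Scope ring_scope.

Section GeneratingFunction.
Variables (R : realType) (C : species).

Definition egf_coef (n : nat) : R := #|C 'I_n|%:R / n`!%:R.

Definition egf (x : R) : R := limn (pseries egf_coef x).

(* The derivatives of C(x) are those of the power series, so that they also
   make sense at the radius of convergence, where C is only defined on the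
   left. *)
Definition egf' (x : R) : R := limn (pseries (pseries_diffs egf_coef) x).

Definition egf'' (x : R) : R :=
  limn (pseries (pseries_diffs (pseries_diffs egf_coef)) x).

End GeneratingFunction.

Section Gamma.
Variable R : realType.

Definition euler_integral (x : R) : R :=
  \int[lebesgue_measure]_(t in `]0, +oo[) (t `^ (x - 1) * expR (- t)).

(* For x <= 0 not an integer, Gamma(x) is the value obtained from
   Gamma(x + 1) = x Gamma(x), after shifting x by the least m with x + m > 0. *)
Definition Gamma (x : R) : R :=
  let m := if 0 < x then 0%N else (Num.truncn (- x)).+1 in
  euler_integral (x + m%:R) / \prod_(i < m) (x + i%:R).

End Gamma.

(* Main.v *)
(** Write C(x) = sum c_m x^m and p_m = c_m x^m / C(x) for 0 < x <= rho, with mean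
    mu(x) = x C'(x) / C(x).  Marking one block at a time gives
    N!/n! |G_{n,N}| = [x^n] C(x)^N = x^{-n} C(x)^N P(S_N = n), where S_N is a sum of N
    independent variables of law p; it remains to estimate P(S_N = n).
    - lambda < lambda*: take x = rho; then n exceeds N mu by a multiple of n, and this
      excess is produced by one big jump.  Cutting the law at n^{1-eps}, Chernoff bounds
      dispose of no jump, a crude bound of two jumps, and exactly one jump gives
      N P(X = n - N mu).
    - lambda = lambda*: x = rho and n = N mu + O(1); Fourier inversion and dominated
      convergence give a local limit theorem whose constant depends on alpha only.  It is
      computed for a mean-one law: the generating function of P(S_N = N) is explicit in
      terms of the generating function of p, and its singular behaviour is compared with
      that of the power law n^{-1/alpha} by Abelian arguments, avoiding contour integrals.
    - lambda > lambda*: choose x with mu(x) = 1/lambda; the law then has all moments and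
      the Gaussian local limit theorem applies. *)

Require Import Defs.
From mathcomp Require Import all_boot all_order all_algebra.
From mathcomp Require Import ring lra.
Import Order.TTheory GRing.Theory Num.Theory.
Local Open Scope ring_scope.
Set Implicit Arguments.
Unset Strict Implicit.
Unset Printing Implicit Defensive.

(** * Counting objects by components *)

Section ConvolutionPower.
Variables (R : comNzRingType) (p : nat -> R).

Fixpoint cpow (N n : nat) : R :=
  if N is N'.+1 then \sum_(m < n.+1) p m * cpow N' (n - m) else (n == 0%N)%:R.

Lemma cpow_poly (N n M : nat) :
  (n <= M)%N -> cpow N n = ((\poly_(i < M.+1) p i) ^+ N)`_n.
Proof.
elim: N n => [|N IHN] n leM; first by rewrite expr0 coef1.
rewrite exprS coefM /=; apply: eq_bigr => m _.
rewrite coef_poly ltnS (leq_trans _ leM) ?IHN //; first exact/(leq_trans (leq_subr _ _)).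
by rewrite -ltnS ltn_ord.
Qed.

End ConvolutionPower.

Lemma cpow_tilt (R : comNzRingType) (c : nat -> R) (x K : R) (N n : nat) :
  cpow (fun m => c m * x ^+ m * K) N n = cpow c N n * x ^+ n * K ^+ N.
Proof.
elim: N n => [|N IHN] n /=.
  by rewrite expr0 mulr1; case: n => [|n]; rewrite ?mul1r ?mul0r.
rewrite !mulr_suml; apply: eq_bigr => -[m /=]; rewrite ltnS => mn _.
have -> : x ^+ n = x ^+ m * x ^+ (n - m) by rewrite -exprD subnKC.
by rewrite IHN exprS; ring.
Qed.

Section PartitionSum.
Variables (R : numFieldType) (w : nat -> R).

Definition partition_sum (T : finType) (k : nat) (A : {set T}) : R :=
  \sum_(P : {set {set T}} | partition P A && (#|P| == k)) \prod_(B in P) w #|B|.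

(* Double counting of the pairs (partition, distinguished block). *)
Lemma partition_sumS (T : finType) (k : nat) (A : {set T}) :
  k.+1%:R * partition_sum k.+1 A =
  \sum_(S : {set T} | (S \subset A) && (S != set0))
     w #|S| * partition_sum k (A :\: S).
Proof.
rewrite /partition_sum mulr_sumr.
rewrite (eq_bigr (fun P : {set {set T}} => \sum_(B in P) (w #|B| * \prod_(B' in P :\ B) w #|B'|))); last first.
  move=> P /andP[_ /eqP cP]; rewrite -cP mulr_natl -sumr_const.
  by apply: eq_bigr => B BP; rewrite (big_setD1 B).
rewrite (exchange_big_dep (fun S : {set T} => (S \subset A) && (S != set0))) /=; last first.
  move=> P B /andP[pP _] BP.
  by rewrite (partitionS pP BP) (partition_neq0 pP BP).
apply: eq_bigr => S /andP[SA S0].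
rewrite mulr_sumr.
rewrite (reindex_onto (fun P : {set {set T}} => S |: P) (fun P => P :\ S)) /=; last first.
  by move=> P /andP[_ SP]; rewrite setD1K.
apply: eq_big => [P|P /andP[_ /eqP->]//].
rewrite setU11 andbT.
have [SP|SP] := boolP (S \in P).
  have -> : ((S |: P) :\ S == P) = false.
    by apply/negbTE; apply: contraTneq SP => <-; rewrite !inE eqxx.
  rewrite andbF; apply/esym/negbTE; rewrite negb_and; apply/orP; left.
  apply/negP => /partitionS/(_ SP) /subsetP sub.
  by case/set0Pn: S0 => x xS; have := sub x xS; rewrite inE xS.
rewrite setU1K // eqxx andbT cardsU1 SP add1n eqSS; congr (_ && _).
apply/idP/idP => [pP|pP].
  by have := partitionD1 pP (setU11 S P); rewrite setU1K.
rewrite -(setID A S) (setIidPr SA); apply: partitionU1 => //.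
by rewrite -setI_eq0 setIDA setIC setDIl setDv setI0.
Qed.

Lemma partition_sum_cpow (T : finType) (k : nat) (A : {set T}) : w 0%N = 0 ->
  k`!%:R * partition_sum k A = #|A|`!%:R * cpow (fun m => w m / m`!%:R) k #|A|.
Proof.
move=> w0; elim: k A => [|k IHk] A.
  rewrite fact0 mul1r /= /partition_sum.
  have [->|A0] := eqVneq A set0.
    rewrite cards0 eqxx fact0 mulr1 (big_pred1 set0) ?big_set0 // => P.
    by rewrite partition_set0 cards_eq0 andbb.
  rewrite cards_eq0 (negbTE A0) mulr0 big_pred0 // => P.
  apply/negbTE; rewrite negb_and; have [P0|] := eqVneq P set0; last first.
    by rewrite cards_eq0 => ->; rewrite orbT.
  apply/orP; left; apply/negP => /cover_partition; rewrite P0 /cover big_set0.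
  by move/eqP; rewrite eq_sym (negbTE A0).
rewrite factS mulnC natrM -mulrA partition_sumS mulr_sumr.
under eq_bigr => S /andP[SA _] do
  rewrite mulrCA IHk cardsDS //.
pose F (m : nat) := w m * ((#|A| - m)`!%:R * cpow (fun m => w m / m`!%:R) k (#|A| - m)).
transitivity (\sum_(S : {set T} | S \subset A) F #|S|).
  rewrite [RHS](bigID (fun S : {set T} => S == set0)) /=.
  rewrite [in RHS](big_pred1 set0); last first.
    by move=> S /=; case: eqVneq => [->|]; rewrite ?sub0set ?andbF.
  by rewrite cards0 [in RHS]/F w0 mul0r add0r.
rewrite (partition_big (fun S : {set T} => inord #|S| : 'I_(#|A|.+1)) xpredT) //=.
rewrite mulr_sumr; apply: eq_bigr => m _.
have mA : (m <= #|A|)%N by rewrite -ltnS.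
rewrite (eq_bigl (fun S => S \in [set S : {set T} | S \subset A & #|S| == m])); last first.
  move=> S; rewrite inE; have [SA|//] := boolP (S \subset A).
  by rewrite -val_eqE /= inordK // ltnS subset_leq_card.
rewrite (eq_bigr (fun=> F m)); last by move=> S; rewrite inE => /andP[_ /eqP ->].
rewrite sumr_const cards_draws /F -[in RHS](bin_fact mA) !natrM.
have mf0 : m`!%:R != 0 :> R by rewrite pnatr_eq0 -lt0n fact_gt0.
by rewrite -[LHS]mulr_natl; field.
Qed.

End PartitionSum.

Section CountComponents.
Variable C : species.

Lemma card_species_eq (U V : finType) : #|U| = #|V| -> #|C U| = #|C V|.
Proof.
move=> UV; have hf : bijective (fun x : U => enum_val (cast_ord UV (enum_rank x))).
  exists (fun y : V => enum_val (cast_ord (esym UV) (enum_rank y))) => x.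
    by rewrite enum_valK cast_ordK enum_rankK.
  by rewrite enum_valK cast_ordKV enum_rankK.
case: (hf) => g fK gK.
have hg : bijective g by exists (fun x : U => enum_val (cast_ord UV (enum_rank x))).
apply: (@bij_eq_card _ _ (sp_map hf)); exists (sp_map hg) => x.
  have h := bij_comp hg hf.
  rewrite -[LHS](sp_map_comp hf hg h).
  have hid : bijective (@id U) by exists id.
  by rewrite (sp_map_ext h hid fK) sp_map_id.
have h := bij_comp hf hg.
rewrite -[LHS](sp_map_comp hg hf h).
have hid : bijective (@id V) by exists id.
by rewrite (sp_map_ext h hid gK) sp_map_id.
Qed.

Lemma card_set_comp_nk (n k : nat) :
  #|set_comp_nk C n k| =
  (\sum_(P : {set {set 'I_n}} | partition P [set: 'I_n] && (#|P| == k))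
     \prod_(B in P) #|C 'I_(#|B|)|)%N.
Proof.
rewrite /set_comp_nk cardsE -sum1_card.
rewrite [LHS](eq_bigl (fun g : set_comp C 'I_n => (#|val (tag g)| == k) && xpredT (tagged g))); last first.
  by move=> g; rewrite andbT.
rewrite -(@sig_big_dep _ _ _ _ (fun P : set_partition 'I_n => {dffun forall B : block (val P), C (block (val B))}) (fun P : set_partition 'I_n => #|val P| == k) (fun=> xpredT) (fun _ _ => 1%N)) /=.
rewrite [RHS](eq_bigl (fun P => (P \in [pred P : {set {set 'I_n}} | partition P [set: 'I_n]]) && (#|P| == k))) //.
rewrite [RHS]big_sub_cond; apply: eq_big => //= P _.
rewrite sum1_card card_dep_ffun.
rewrite [RHS](big_sub (mem (val P)) (fun B : {set 'I_n} => #|C 'I_(#|B|)|)).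
rewrite foldrE big_map /= big_enum /=; apply: eq_bigr => B _.
by apply: card_species_eq; rewrite card_sig card_ord; apply: eq_card.
Qed.

Lemma count_cpow (R : numFieldType) (n k : nat) : #|C 'I_0| = 0%N ->
  k`!%:R / n`!%:R * #|set_comp_nk C n k|%:R = cpow (fun m => #|C 'I_m|%:R / m`!%:R) k n :> R.
Proof.
move=> C0; have n0 : n`!%:R != 0 :> R by rewrite pnatr_eq0 -lt0n fact_gt0.
have := @partition_sum_cpow R (fun m => #|C 'I_m|%:R) 'I_n k [set: 'I_n].
rewrite C0 cardsT card_ord => /(_ erefl) E.
apply: (mulfI n0); rewrite -E card_set_comp_nk natr_sum /partition_sum.
rewrite [RHS](_ : _ = k`!%:R * \sum_(P : {set {set 'I_n}} | partition P [set: 'I_n] && (#|P| == k)) (\prod_(B in P) #|C 'I_(#|B|)|)%:R).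
  by field.
by congr (_ * _); apply: eq_bigr => P _; rewrite natr_prod.
Qed.


End CountComponents.

From mathcomp Require Import all_classical all_reals all_analysis.
From mathcomp Require Import measurable_realfun ring lra.
Import Order.TTheory GRing.Theory Num.Theory numFieldNormedType.Exports.
Local Open Scope classical_set_scope.
Local Open Scope ring_scope.
From mathcomp.real_closed Require Import complex.
Import ComplexField.Normc.

(** * Trigonometric and complex estimates *)

Section TrigonometricBounds.
Variable R : realType.
Implicit Types x : R.

Lemma ge0_of_derive (f df : R -> R) :
  (forall x, is_derive x 1 f (df x)) -> f 0 = 0 ->
  (forall x, 0 <= x -> 0 <= df x) -> forall x, 0 <= x -> 0 <= f x.
Proof.
move=> fdf f0 df_ge0 x x_ge0.
have cf : {within `[0, x], continuous f}.
  apply: continuous_subspaceT => z.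
  exact/differentiable_continuous/derivable1_diffP.
have [c] := MVT_segment x_ge0 (fun z _ => fdf z) cf.
rewrite in_itv /= => /andP[c0 _]; rewrite f0 !subr0 => ->.
by rewrite mulr_ge0 ?df_ge0.
Qed.

Lemma ge_sin x : 0 <= x -> sin x <= x.
Proof.
move=> x0; rewrite -subr_ge0.
have D (z : R) : is_derive z (1 : R) (fun x => x - sin x) ((fun x => 1 - cos x) z).
  by apply: is_deriveB.
by apply: (ge0_of_derive D _ _ x0) => [|z z0]; [rewrite sin0 subrr|rewrite subr_ge0 cos_le1].
Qed.

Lemma le_1Bcos x : 0 <= x -> 1 - cos x <= x.
Proof.
move=> x0; rewrite -subr_ge0.
have D (z : R) : is_derive z (1 : R) (fun x => x - (1 - cos x)) ((fun x => 1 - sin x) z).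
  by apply: is_derive_eq; rewrite /GRing.scale /=; lra.
by apply: (ge0_of_derive D _ _ x0) => [|z z0]; [rewrite cos0; lra|rewrite subr_ge0 sin_le1].
Qed.

Lemma le_1Bcos_sqr x : 0 <= x -> 1 - cos x <= x ^+ 2 / 2.
Proof.
move=> x0; rewrite -subr_ge0.
have D (z : R) : is_derive z (1 : R) (fun x => x ^+ 2 / 2 - (1 - cos x)) ((fun x => x - sin x) z).
  by apply: is_derive_eq; rewrite /GRing.scale /=; lra.
by apply: (ge0_of_derive D _ _ x0) => [|z z0]; [rewrite cos0; lra|rewrite subr_ge0 ge_sin].
Qed.

Lemma le_sin_cube x : 0 <= x -> x - sin x <= x ^+ 3 / 6.
Proof.
move=> x0; rewrite -subr_ge0.
have D (z : R) : is_derive z (1 : R) (fun x => x ^+ 3 / 6 - (x - sin x)) ((fun x => x ^+ 2 / 2 - (1 - cos x)) z).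
  by apply: is_derive_eq; rewrite /GRing.scale /=; lra.
by apply: (ge0_of_derive D _ _ x0) => [|z z0]; [rewrite sin0; lra|rewrite subr_ge0 le_1Bcos_sqr].
Qed.

Lemma le_Bsin_sqr x : 0 <= x -> x - sin x <= x ^+ 2 / 2.
Proof.
move=> x0; rewrite -subr_ge0.
have D (z : R) : is_derive z (1 : R) (fun x => x ^+ 2 / 2 - (x - sin x)) ((fun x => x - (1 - cos x)) z).
  by apply: is_derive_eq; rewrite /GRing.scale /=; lra.
by apply: (ge0_of_derive D _ _ x0) => [|z z0]; [rewrite sin0; lra|rewrite subr_ge0 le_1Bcos].
Qed.

Lemma le_cos_cube x : 0 <= x -> cos x - 1 + x ^+ 2 / 2 <= x ^+ 3 / 6.
Proof.
move=> x0; rewrite -subr_ge0.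
have D (z : R) : is_derive z (1 : R) (fun x => x ^+ 3 / 6 - (cos x - 1 + x ^+ 2 / 2)) ((fun x => x ^+ 2 / 2 - (x - sin x)) z).
  by apply: is_derive_eq; rewrite /GRing.scale /=; lra.
by apply: (ge0_of_derive D _ _ x0) => [|z z0]; [rewrite cos0; lra|rewrite subr_ge0 le_Bsin_sqr].
Qed.

Lemma ge_1Bcos_sqr x : 0 <= x <= pi -> x ^+ 2 / 32 <= 1 - cos x.
Proof.
move=> /andP[x0 xpi]; have pi0 := pi_ge0 R.
have cosE (y : R) : 1 - cos y = 2 * sin (y / 2) ^+ 2.
  by rewrite {1}(_ : y = (y / 2) *+ 2) ?cos_mulr2n ?cos2sin2 //; lra.
have sinE : sin (x / 2) = 2 * cos (x / 4) * sin (x / 4).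
  by rewrite {1}(_ : x / 2 = (x / 4) *+ 2) ?sin_mulr2n //; lra.
have c4 (y : R) : 0 <= y <= pi / 4 -> 1 / 2 <= cos y.
  move=> /andP[y0 y4].
  have E := cosE y; have y20 : 0 <= y / 2 by lra.
  have s1 := ge_sin y20.
  have s0 : 0 <= sin (y / 2) by apply: sin_ge0_pi; lra.
  have p4 : pi / 2 < 2 :> R := pihalf_lt2 R.
  have : sin (y / 2) <= 1 / 2 by lra.
  by move=> s2; have : sin (y / 2) ^+ 2 <= 1 / 4 by [nra]; lra.
have s4 : (x / 4) / 2 <= sin (x / 4).
  have x40 : 0 <= x / 4 by lra.
  have cs : {within `[0, x / 4], continuous (@sin R)}.
    by apply: continuous_subspaceT => z; exact: continuous_sin.
  have [c] := MVT_segment x40 (fun z _ => is_derive_sin z) cs.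
  rewrite in_itv /= => /andP[cx0 cx1]; rewrite sin0 !subr0 => ->.
  by have : 1 / 2 <= cos c by [apply: c4; lra]; nra.
have := c4 (x / 4); rewrite cosE sinE => c4'.
have c4'' : 1 / 2 <= cos (x / 4) by apply: c4'; lra.
have q : x / 8 <= 2 * cos (x / 4) * sin (x / 4) by nra.
by nra.
Qed.

End TrigonometricBounds.

Section UnitCircle.
Variable R : realType.
Local Notation toC := (real_complex R).

Definition expi (t : R) : R[i] := Complex (cos t) (sin t).

Lemma expiD s t : expi (s + t) = expi s * expi t.
Proof. by apply/eqP; rewrite eq_complex /= cosD sinD addrC eqxx [X in _ == X]addrC [X in _ + X]mulrC mulrC addrC eqxx. Qed.

Lemma expi0 : expi 0 = 1.
Proof. by rewrite /expi cos0 sin0. Qed.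

Lemma expiX t n : expi t ^+ n = expi (n%:R * t).
Proof.
elim: n => [|n IHn]; first by rewrite expr0 mul0r expi0.
by rewrite exprS IHn -expiD -[in RHS]add1n natrD mulrDl mul1r.
Qed.

Lemma normc_expi t : normc (expi t) = 1.
Proof. by rewrite /= cos2Dsin2 sqrtr1. Qed.

Lemma normcX (z : R[i]) n : normc (z ^+ n) = normc z ^+ n.
Proof. by elim: n => [|n IHn]; rewrite ?normc1 // !exprS normcM IHn. Qed.

Lemma normcD (z w : R[i]) : normc (z + w) <= normc z + normc w.
Proof. exact: le_normcD. Qed.

Lemma normc_ge0 (z : R[i]) : 0 <= normc z.
Proof. by case: z => a b; exact: sqrtr_ge0. Qed.

Lemma Re_le_normc (z : R[i]) : `|complex.Re z| <= normc z.
Proof.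
by case: z => a b /=; rewrite -sqrtr_sqr ler_wsqrtr // lerDl sqr_ge0.
Qed.

Lemma normc_le_ReIm (z : R[i]) : normc z <= `|complex.Re z| + `|complex.Im z|.
Proof.
have : z = toC (complex.Re z) + 'i%C * toC (complex.Im z) by rewrite -complexE.
by move=> {1}->; apply: le_trans (normcD _ _) _; rewrite normcM /= !expr0n /= !addr0 add0r expr1n sqrtr1 mul1r !sqrtr_sqr.
Qed.

End UnitCircle.

(** * Fourier inversion and the local limit theorem *)

Section FourierCoefficient.
Variable R : realType.
Local Notation toC := (real_complex R).
Local Notation mu := (@lebesgue_measure R).
Implicit Types (P : {poly R}) (m : nat) (t a : R).

Definition fourier_integrand P m t : R :=
  complex.Re ((map_poly toC P).[expi t] * expi (- (m%:R * t))).

Lemma Re_add (z w : R[i]) : complex.Re (z + w) = complex.Re z + complex.Re w.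
Proof. by case: z w => [? ?] [? ?]. Qed.

Lemma Im_add (z w : R[i]) : complex.Im (z + w) = complex.Im z + complex.Im w.
Proof. by case: z w => [? ?] [? ?]. Qed.

Lemma Re_toC (x : R) (z : R[i]) : complex.Re (toC x * z) = x * complex.Re z.
Proof. by case: z => u v /=; rewrite mul0r subr0. Qed.

Lemma Im_toC (x : R) (z : R[i]) : complex.Im (toC x * z) = x * complex.Im z.
Proof. by case: z => u v /=; rewrite mul0r addr0. Qed.

Lemma fourier_integrandE P m t :
  fourier_integrand P m t =
  \sum_(k < size P) P`_k * cos ((k%:R - m%:R) * t).
Proof.
rewrite /fourier_integrand horner_coef size_map_poly mulr_suml.
rewrite (big_morph _ Re_add (erefl : complex.Re 0 = 0)).
apply: eq_bigr => k _; rewrite coef_map expiX -mulrA -expiD Re_toC /=.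
by congr (_ * cos _); ring.
Qed.

Lemma continuous_cos_scale (c a : R) : continuous (fun u : R => cos (c * (u / a))).
Proof.
move=> u; apply/differentiable_continuous/derivable1_diffP.
apply: (@ex_derive _ _ _ _ _ _ (- (c / a) * sin (c * (u / a)))).
by apply: is_derive_eq; rewrite /GRing.scale /=; ring.
Qed.

Lemma continuous_fourier_integrand P m a :
  continuous (fun u : R => fourier_integrand P m (u / a)).
Proof.
under eq_fun do rewrite fourier_integrandE.
move=> u; apply: cvg_big; [exact: add_continuous|].
by move=> k _; apply: cvgMl_tmp; exact: continuous_cos_scale.
Qed.

Lemma sin_natpi (k : nat) : sin (k%:R * pi) = 0 :> R.
Proof.
elim: k => [|k IHk]; first by rewrite mul0r sin0.
by rewrite -natr1 mulrDl mul1r sinDpi IHk oppr0.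
Qed.

Lemma integral_cos (k m : nat) a : 0 < a ->
  \int[mu]_(u in `[0, pi * a]) cos ((k%:R - m%:R) * (u / a)) =
  (k == m)%:R * (pi * a) :> R.
Proof.
move=> a0; have pa0 : 0 < pi * a by rewrite mulr_gt0 ?pi_gt0.
have [->|km] := eqVneq k m.
  under eq_Rintegral do rewrite subrr mul0r cos0.
  rewrite Rintegral_cst //= lebesgue_measure_itv /= lte_fin pa0 oppr0 adde0 /=.
  by rewrite !mul1r.
pose c : R := (k%:R - m%:R) / a.
have c0 : c != 0.
  by rewrite mulf_neq0 ?invr_eq0 ?(gt_eqF a0) // subr_eq0 eqr_nat.
pose F (u : R) := c^-1 * sin (c * u).
have dF (x : R) : is_derive x (1 : R) F (cos (c * x)).
  by apply: is_derive_eq; rewrite /GRing.scale /=; field.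
rewrite /Rintegral; under eq_integral do rewrite [_ / a]mulrC mulrA -/c.
rewrite (@continuous_FTC2 _ _ F) //.
- rewrite /F mulr0 sin0 mulr0.
  suff -> : sin (c * (pi * a)) = 0 by rewrite mulr0 sube0 mul0r.
  have -> : c * (pi * a) = k%:R * pi - m%:R * pi.
    by rewrite /c; field; rewrite gt_eqF.
  by rewrite sinB !sin_natpi mul0r mulr0 subr0.
- apply: continuous_subspaceT => u.
  by apply: continuous_comp; [exact: mulrl_continuous|exact: continuous_cos].
- split.
  + by move=> x _; apply: ex_derive.
  + apply: cvg_at_right_filter; apply/differentiable_continuous/derivable1_diffP; exact: ex_derive.
  + apply: cvg_at_left_filter; apply/differentiable_continuous/derivable1_diffP; exact: ex_derive.
- by move=> x _; rewrite derive1E derive_val.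
Qed.

Lemma Rintegral_sum (D : set R) (I : Type) (r : seq I) (f : I -> R -> R) :
  measurable D -> (forall i, mu.-integrable D (EFin \o f i)) ->
  \int[mu]_(x in D) (\sum_(i <- r) f i x) =
  \sum_(i <- r) \int[mu]_(x in D) f i x.
Proof.
move=> mD ifi; elim: r => [|i r IHr].
  under eq_Rintegral do rewrite big_nil.
  by rewrite Rintegral_cst // mul0r big_nil.
under eq_Rintegral do rewrite big_cons.
rewrite RintegralD //; first by rewrite IHr big_cons.
have := @integrable_sum _ _ _ mu D mD I r xpredT (fun i => EFin \o f i) (fun i _ => ifi i).
by apply: eq_integrable => //= x _; rewrite sumEFin.
Qed.

Lemma continuous_integrable (f : R -> R) (a b : R) :
  continuous f -> mu.-integrable `[a, b] (EFin \o f).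
Proof.
move=> cf; apply: continuous_compact_integrable; first exact: segment_compact.
exact: continuous_subspaceT.
Qed.

Lemma fourier_coef P m a : 0 < a ->
  \int[mu]_(u in `[0, pi * a]) fourier_integrand P m (u / a) = pi * a * P`_m.
Proof.
move=> a0; under eq_Rintegral do rewrite fourier_integrandE.
rewrite Rintegral_sum //; last first.
  move=> k; apply: continuous_integrable => u.
  by apply: cvgMl_tmp; exact: continuous_cos_scale.
have ic (k : 'I_(size P)) : \int[mu]_(u in `[0, pi * a]) (P`_k * cos ((k%:R - m%:R) * (u / a)))
    = P`_k * ((k == m :> nat)%:R * (pi * a)).
  rewrite RintegralZl ?integral_cos //.
  exact/continuous_integrable/continuous_cos_scale.
under eq_bigr do rewrite ic.
have [mP|Pm] := ltnP m (size P).
  rewrite (bigD1 (Ordinal mP)) //= eqxx mul1r big1 ?addr0 1?mulrC // => k km.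
  rewrite (_ : (k == m :> nat) = false) ?mul0r ?mulr0 //.
  by apply/negbTE; apply: contraNneq km => e; apply/eqP/val_inj.
rewrite [P`_m]nth_default // mulr0 big1 // => k _.
by rewrite ltn_eqF ?mul0r ?mulr0 // (leq_trans (ltn_ord k)).
Qed.

End FourierCoefficient.

Section RealDominatedConvergence.
Variable R : realType.
Local Notation mu := (@lebesgue_measure R).

Lemma Rdominated_cvg (D : set R) (f : nat -> R -> R) (g h : R -> R) :
  measurable D -> (forall n, measurable_fun D (f n)) ->
  (\forall n \near \oo, forall x, D x -> `|f n x| <= h x) ->
  mu.-integrable D (EFin \o h) ->
  (forall x, D x -> f n x @[n --> \oo] --> g x) ->
  mu.-integrable D (EFin \o g) /\
  \int[mu]_(x in D) f n x @[n --> \oo] --> \int[mu]_(x in D) g x.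
Proof.
move=> mD mf [n0 _ fh] ih fg.
have fg' x : D x -> f (n + n0)%N x @[n --> \oo] --> g x.
  by move=> Dx; rewrite (cvg_shiftn n0 (f ^~ x)); exact: fg.
have mg : measurable_fun D g.
  by apply: (@measurable_fun_cvg _ _ _ _ (fun n => f (n + n0)%N)).
have [] := @dominated_convergence _ _ _ mu D mD
  (fun n => EFin \o f (n + n0)%N) (EFin \o g) (EFin \o h).
- by move=> n; apply/measurable_EFinP; exact: mf.
- exact/measurable_EFinP.
- by apply: aeW => x Dx; apply: cvg_EFin; [exact: nearW|exact: fg'].
- exact: ih.
- apply: aeW => x n Dx /=; rewrite lee_fin; apply: fh => //=.
  by rewrite leq_addl.
move=> ig _ cvgI; split; first exact: ig.
rewrite -(cvg_shiftn n0); apply: fine_cvg.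
by rewrite fineK //; exact: integrable_fin_num.
Qed.

Lemma integrable_expR (c D : R) : 0 < c ->
  mu.-integrable `]0, +oo[ (EFin \o (fun x => D * expR (- (c * x)))).
Proof.
move=> c0; have ie := @integrable_exponential_pdf R c c0.
have := @integrableS _ _ _ mu setT `]0, +oo[%classic _ measurableT (measurable_itv _) (@subsetT _ _) ie.
move=> ie'; have := @integrableZl _ _ _ mu `]0, +oo[%classic (measurable_itv _) (D / c) _ ie'.
apply: eq_integrable => //= x; rewrite inE /= in_itv /= andbT => x0.
rewrite -EFinM; congr (_ %:E).
rewrite exponential_pdfE ?ltW // mulNr; field.
by rewrite gt_eqF.
Qed.

Lemma fourier_limit (P : nat -> {poly R}) (m : nat -> nat) (a : nat -> R)
    (G : R -> R) (D c : R) :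
  a @ \oo --> +oo -> 0 < c ->
  (\forall n \near \oo, forall u, 0 <= u <= pi * a n ->
     `|fourier_integrand (P n) (m n) (u / a n)| <= D * expR (- (c * u))) ->
  (forall u, 0 < u ->
     fourier_integrand (P n) (m n) (u / a n) @[n --> \oo] --> G u) ->
  a n * (P n)`_(m n) @[n --> \oo] --> pi^-1 * \int[mu]_(u in `]0, +oo[) G u.
Proof.
move=> aoo c0 bnd lim.
have a_gt0 : \forall n \near \oo, 0 < a n by exact: (cvgry_gt aoo).
pose F n u := fourier_integrand (P n) (m n) (u / a n).
pose f n := F n \_ `]-oo, pi * a n].
have mF n (E : set R) : measurable E -> measurable_fun E (F n).
  move=> mE; apply: measurable_funTS.
  by apply: continuous_measurable_fun; exact: continuous_fourier_integrand.
have [|||||_] := @Rdominated_cvg `]0, +oo[ f G (fun u => D * expR (- (c * u))).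
- exact: measurable_itv.
- move=> n; rewrite /f; apply/measurable_restrict => //.
  by apply: mF; exact: measurableI.
- move: bnd; apply: filterS2 a_gt0 => n an bn u; rewrite /= in_itv /= andbT => u0.
  rewrite /f patchE; case: ifPn => [|_].
    by rewrite inE /= in_itv /= => ua; apply: bn; rewrite ltW.
  have h0 : 0 <= (0 : R) <= pi * a n by rewrite lexx mulr_ge0 ?pi_ge0 ?ltW.
  have := bn 0 h0; rewrite normr0 mulr0 oppr0 expR0 mulr1 => /(le_trans (normr_ge0 _)) D0.
  by rewrite mulr_ge0 ?expR_ge0.
- exact: integrable_expR.
- move=> u; rewrite /= in_itv /= andbT => u0.
  apply: cvg_trans (lim u u0); apply: near_eq_cvg.
  have : \forall n \near \oo, u / pi < a n by exact: (cvgry_gt aoo).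
  apply: filterS => n; rewrite ltr_pdivrMr ?pi_gt0 // mulrC => ua.
  by rewrite /f patchE ifT // inE /= in_itv /= ltW.
move=> cvgI.
apply: cvg_trans (cvgMl_tmp (a := pi^-1) cvgI); apply: near_eq_cvg.
apply: filterS a_gt0 => n an.
rewrite /f -Rintegral_mkcondr -set_itvI.
have -> : [set` Order.meet `]0, +oo[ `]-oo, pi * a n]] = `]0, pi * a n]%classic :> set R.
  by congr [set` _]; rewrite /Order.meet /= /Order.meet /Order.join /=.
rewrite Rintegral_itv_obnd_cbnd; last first.
  apply: (@integrableS _ _ _ mu `[0, pi * a n]%classic) => //.
    by apply: subset_itvr; rewrite bnd_simp.
  apply: continuous_compact_integrable; first exact: segment_compact.
  by apply: continuous_subspaceT; exact: continuous_fourier_integrand.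
by rewrite /F fourier_coef // !mulrA mulVf ?mul1r // gt_eqF ?pi_gt0.
Qed.

End RealDominatedConvergence.

Section RealSequences.
Variable R : realType.
Implicit Types u v : nat -> R.

Lemma cvgn_ext u v (l l' : R) :
  u @ \oo --> l -> (forall n, u n = v n) -> l = l' -> v @ \oo --> l'.
Proof. by move=> ul uv <-; rewrite (_ : v = u) //; apply/funext => n; rewrite uv. Qed.

Lemma cvgn_near u v (l : R) :
  u @ \oo --> l -> (\forall n \near \oo, u n = v n) -> v @ \oo --> l.
Proof. by move=> ul uv; apply: cvg_trans ul; exact: near_eq_cvg. Qed.

Lemma cvgnMl (c : R) u (l : R) : u @ \oo --> l -> c * u n @[n --> \oo] --> c * l.
Proof. exact: cvgMl_tmp. Qed.

Lemma cvgnMr (c : R) u (l : R) : u @ \oo --> l -> u n * c @[n --> \oo] --> l * c.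
Proof. exact: cvgMr_tmp. Qed.

Lemma cvgnM u v (l k : R) :
  u @ \oo --> l -> v @ \oo --> k -> u n * v n @[n --> \oo] --> l * k.
Proof. exact: cvgM. Qed.

Lemma cvgnD u v (l k : R) :
  u @ \oo --> l -> v @ \oo --> k -> u n + v n @[n --> \oo] --> l + k.
Proof. exact: cvgD. Qed.

Lemma cvgnB u v (l k : R) :
  u @ \oo --> l -> v @ \oo --> k -> u n - v n @[n --> \oo] --> l - k.
Proof. exact: cvgB. Qed.

Lemma cvgnMl0 (c : R) u : u @ \oo --> (0 : R) -> c * u n @[n --> \oo] --> (0 : R).
Proof. by move=> /(cvgnMl (c := c)); rewrite mulr0. Qed.

Lemma cvgnMr0 (c : R) u : u @ \oo --> (0 : R) -> u n * c @[n --> \oo] --> (0 : R).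
Proof. by move=> /(cvgnMr (c := c)); rewrite mul0r. Qed.

Lemma cvgn0_le u v :
  (\forall n \near \oo, `|u n| <= v n) -> v @ \oo --> (0 : R) -> u @ \oo --> (0 : R).
Proof.
move=> uv v0; apply: norm_cvg0.
apply: (@squeeze_cvgr _ _ _ _ (fun=> 0) v) => //; last exact: cvg_cst.
by apply: filterS uv => n ->; rewrite normr_ge0.
Qed.

Lemma cvgn_derive (g : R -> R) (d : R) u : is_derive (0 : R) (1 : R) g d ->
  u @ \oo --> (0 : R) -> (\forall n \near \oo, u n != 0) ->
  (g (u n) - g 0) / u n @[n --> \oo] --> d.
Proof.
move=> [dg gd] u0 un0.
have h : h^-1 *: (g (h *: 1 + 0) - g 0) @[h --> (0 : R)^'] --> d.
  by rewrite -gd; exact: dg.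
have un : u @ \oo --> (0 : R)^'.
  move=> A [e /= e0 eA].
  move/cvgrPdist_lt : u0 => /(_ e e0); apply: filterS2 un0 => n un0 un.
  exact: (eA (u n)).
have := cvg_comp _ _ un h; apply: cvg_trans; apply: near_eq_cvg.
by apply: nearW => n /=; rewrite /GRing.scale /= mulr1 addr0 mulrC.
Qed.

End RealSequences.
Arguments cvgnMl {R} c {u l}.
Arguments cvgnMr {R} c {u l}.
Arguments cvgnMl0 {R} c {u}.
Arguments cvgnMr0 {R} c {u}.


Section PowerLimit.
Variable R : realType.
Local Notation toC := (real_complex R).

Lemma normc_subX (z w : R[i]) n : normc z <= 1 -> normc w <= 1 ->
  normc (z ^+ n - w ^+ n) <= n%:R * normc (z - w).
Proof.
move=> z1 w1; elim: n => [|n IHn]; first by rewrite subrr normc0 mul0r.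
rewrite !exprS.
have -> : z * z ^+ n - w * w ^+ n = z * (z ^+ n - w ^+ n) + (z - w) * w ^+ n by ring.
apply: le_trans (normcD _ _) _; rewrite !normcM -natr1 mulrDl mul1r lerD //.
  by rewrite -[leRHS]mul1r ler_pM ?normc_ge0.
rewrite -[leRHS]mulr1 ler_pM ?normc_ge0 // normcX.
by rewrite -(expr1n _ n) lerXn2r // ?nnegrE ?normc_ge0.
Qed.

Lemma cvg_power_expi (z : nat -> R[i]) (N : nat -> nat) (d : nat -> R) (r1 r2 : R) :
  ((N n)%:R : R) @[n --> \oo] --> +oo ->
  (\forall n \near \oo, normc (z n) <= 1) ->
  (N n)%:R * (complex.Re (z n) - 1) @[n --> \oo] --> r1 ->
  (N n)%:R * complex.Im (z n) @[n --> \oo] --> r2 ->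
  d @ \oo --> (0 : R) ->
  complex.Re (z n ^+ N n * expi (d n)) @[n --> \oo] --> expR r1 * cos r2.
Proof.
move=> Noo z1 zr zi d0.
have N0 : \forall n \near \oo, (0 : R) < (N n)%:R by exact: (cvgry_gt Noo).
have r1_le0 : r1 <= 0.
  apply: (cvgr_to_le zr); apply: filterS z1 => n zn1.
  rewrite mulr_ge0_le0 // subr_le0; apply: le_trans (ler_norm _) _.
  exact: le_trans (Re_le_normc _) _.
pose h n : R := (N n)%:R^-1.
have h0 : h @ \oo --> (0 : R) by apply/gtr0_cvgV0.
have hn0 : \forall n \near \oo, h n != 0.
  by apply: filterS N0 => n Nn; rewrite invr_eq0 gt_eqF.
pose w n : R[i] := toC (expR (r1 * h n)) * expi (r2 * h n).
have wN : \forall n \near \oo, w n ^+ N n = toC (expR r1) * expi r2.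
  apply: filterS N0 => n Nn.
  have E r : (N n)%:R * (r * h n) = r by rewrite /h mulrCA divff ?mulr1 ?gt_eqF.
  by rewrite /w exprMn expiX -rmorphXn /= -expRM_natl !E.
have wR n : complex.Re (w n) = expR (r1 * h n) * cos (r2 * h n).
  by rewrite /w Re_toC.
have wI n : complex.Im (w n) = expR (r1 * h n) * sin (r2 * h n).
  by rewrite /w Im_toC.
have w1 : \forall n \near \oo, normc (w n) <= 1.
  apply: filterS N0 => n Nn; rewrite normcM normc_expi mulr1 /= expr0n /= addr0 sqrtr_sqr.
  rewrite ger0_norm ?expR_ge0 // -expR0 ler_expR.
  by rewrite mulr_le0_ge0 // invr_ge0 ltW.
have cR : (N n)%:R * (complex.Re (w n) - 1) @[n --> \oo] --> r1.
  have D : is_derive (0 : R) (1 : R) (fun x => expR (r1 * x) * cos (r2 * x)) r1.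
    by apply: is_derive_eq; rewrite /GRing.scale /= !mulr0 expR0 cos0 sin0; ring.
  apply: (cvgn_ext (cvgn_derive D h0 hn0)) => // n.
  by rewrite !mulr0 expR0 cos0 wR invrK mulr1 mulrC.
have cI : (N n)%:R * complex.Im (w n) @[n --> \oo] --> r2.
  have D : is_derive (0 : R) (1 : R) (fun x => expR (r1 * x) * sin (r2 * x)) r2.
    by apply: is_derive_eq; rewrite /GRing.scale /= !mulr0 expR0 cos0 sin0; ring.
  apply: (cvgn_ext (cvgn_derive D h0 hn0)) => // n.
  by rewrite !mulr0 expR0 sin0 wI invrK mulr0 subr0 mulrC.
pose err n : R := (N n)%:R * `|complex.Re (z n) - complex.Re (w n)|
   + (N n)%:R * `|complex.Im (z n) - complex.Im (w n)|
   + (`|cos (d n) - 1| + `|sin (d n)|).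
have err0 : err @ \oo --> (0 : R).
  have e1 : (N n)%:R * `|complex.Re (z n) - complex.Re (w n)| @[n --> \oo] --> (0 : R).
    have := cvg_norm (cvgB zr cR); rewrite subrr normr0.
    move=> H; apply: cvgn_ext; [exact: H| |by []] => n /=; rewrite !fctE.
    by rewrite -mulrBr normrM ger0_norm ?ler0n //; congr (_ * `|_|); ring.
  have e2 : (N n)%:R * `|complex.Im (z n) - complex.Im (w n)| @[n --> \oo] --> (0 : R).
    have := cvg_norm (cvgB zi cI); rewrite subrr normr0.
    move=> H; apply: cvgn_ext; [exact: H| |by []] => n /=; rewrite !fctE.
    by rewrite -mulrBr normrM ger0_norm ?ler0n.
  have e3 : `|cos (d n) - 1| @[n --> \oo] --> (0 : R).
    have c1 : cos (d n) @[n --> \oo] --> cos (0 : R).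
      by apply: continuous_cvg => //; exact: continuous_cos.
    have := cvg_norm (cvgB c1 (cvg_cst (1 : R))); rewrite cos0 subrr normr0.
    exact.
  have e4 : `|sin (d n)| @[n --> \oo] --> (0 : R).
    have c1 : sin (d n) @[n --> \oo] --> sin (0 : R).
      by apply: continuous_cvg => //; exact: continuous_sin.
    have := cvg_norm c1; rewrite sin0 normr0.
    exact.
  have := cvgD (cvgD e1 e2) (cvgD e3 e4); rewrite !addr0.
  exact.
have -> : expR r1 * cos r2 = complex.Re (toC (expR r1) * expi r2) by rewrite Re_toC.
apply/subr_cvg0.
apply: (cvgn0_le _ err0).
near=> n.
have -> : complex.Re (z n ^+ N n * expi (d n)) - complex.Re (toC (expR r1) * expi r2)
  = complex.Re ((z n ^+ N n - w n ^+ N n) * expi (d n) + w n ^+ N n * (expi (d n) - 1)).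
  have -> : (z n ^+ N n - w n ^+ N n) * expi (d n) + w n ^+ N n * (expi (d n) - 1)
     = z n ^+ N n * expi (d n) - w n ^+ N n by ring.
  have -> : w n ^+ N n = toC (expR r1) * expi r2 by near: n.
  by rewrite Re_add; congr (_ + _); case: (toC _ * _).
apply: le_trans (Re_le_normc _) _; apply: le_trans (normcD _ _) _.
rewrite !normcM normc_expi mulr1 lerD //.
  have z1n : normc (z n) <= 1 by near: n.
  have w1n : normc (w n) <= 1 by near: n.
  apply: le_trans (normc_subX _ z1n w1n) _.
  rewrite -mulrDr ler_wpM2l //; apply: le_trans (normc_le_ReIm _) _.
  by case: (z n) (w n) => [? ?] [? ?].
have w1n : normc (w n) <= 1 by near: n.
rewrite -[leRHS]mul1r ler_pM ?normc_ge0 //.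
  by rewrite normcX -(expr1n _ (N n)) lerXn2r // ?nnegrE ?normc_ge0.
by apply: le_trans (normc_le_ReIm _) _; rewrite /= subr0.
Unshelve. all: by end_near. Qed.

End PowerLimit.

Section LocalLimit.
Variable R : realType.
Local Notation toC := (real_complex R).
Local Notation mu := (@lebesgue_measure R).

Definition charf (f : {poly R}) (t : R) : R[i] := (map_poly toC f).[expi t].

Lemma Re_charf (p : nat -> R) (M : nat) (t : R) :
  complex.Re (charf (\poly_(i < M) p i) t) = \sum_(i < M) p i * cos (i%:R * t).
Proof.
rewrite /charf (@horner_coef_wide _ M); last first.
  exact: leq_trans (size_poly _ _) (size_poly _ _).
rewrite (big_morph _ (@Re_add R) (erefl : complex.Re 0 = 0)).
by apply: eq_bigr => i _; rewrite coef_map coef_poly ltn_ord expiX Re_toC.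
Qed.

Lemma Im_charf (p : nat -> R) (M : nat) (t : R) :
  complex.Im (charf (\poly_(i < M) p i) t) = \sum_(i < M) p i * sin (i%:R * t).
Proof.
rewrite /charf (@horner_coef_wide _ M); last first.
  exact: leq_trans (size_poly _ _) (size_poly _ _).
rewrite (big_morph _ (@Im_add R) (erefl : complex.Im 0 = 0)).
by apply: eq_bigr => i _; rewrite coef_map coef_poly ltn_ord expiX Im_toC.
Qed.

Lemma cvg_local_limit (f : nat -> {poly R}) (N m : nat -> nat) (a : nat -> R)
    (mean K c D : R) (r1 r2 tau : R -> R) :
  0 <= mean ->
  a @ \oo --> +oo -> ((N n)%:R : R) @[n --> \oo] --> +oo ->
  (\forall n \near \oo, `|(m n)%:R - (N n)%:R * mean| <= K) ->
  (forall n t, normc (charf (f n) t) <= 1) -> 0 < c ->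
  (\forall n \near \oo, forall u, 0 <= u <= pi * a n ->
     normc (charf (f n) (u / a n)) ^+ N n <= D * expR (- (c * u))) ->
  (forall u, 0 < u ->
     (N n)%:R * (complex.Re (charf (f n) (u / a n)) - 1) @[n --> \oo] --> r1 u) ->
  (forall u, 0 < u ->
     (N n)%:R * (complex.Im (charf (f n) (u / a n)) - mean * (u / a n))
       @[n --> \oo] --> r2 u) ->
  (forall u, 0 < u -> (N n)%:R * (u / a n) ^+ 2 @[n --> \oo] --> tau u) ->
  a n * (f n ^+ N n)`_(m n) @[n --> \oo] -->
    pi^-1 * \int[mu]_(u in `]0, +oo[)
      (expR (r1 u + mean ^+ 2 * tau u / 2) * cos (r2 u)).
Proof.
move=> mean0 aoo Noo mN f1 c0 decay cR cI ctau.
have a_gt0 : \forall n \near \oo, 0 < a n by exact: (cvgry_gt aoo).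
have fE n k t : fourier_integrand (f n ^+ N n) k t =
    complex.Re ((charf (f n) t * expi (- (mean * t))) ^+ N n *
      expi (- ((k%:R - (N n)%:R * mean) * t))).
  rewrite /fourier_integrand rmorphXn horner_exp exprMn expiX -mulrA -expiD.
  by congr (complex.Re (_ * expi _)); ring.
apply: (@fourier_limit _ (fun n => f n ^+ N n) m a _ D c) => //.
  apply: filterS decay => n dec u /dec; apply: le_trans.
  apply: le_trans (Re_le_normc _) _; rewrite normcM normc_expi mulr1.
  by rewrite rmorphXn horner_exp normcX.
move=> u u0; pose t n := u / a n.
have t0 : t @ \oo --> (0 : R).
  have : (a n)^-1 @[n --> \oo] --> (0 : R) by apply/gtr0_cvgV0.
  exact: (cvgnMl0 _).
have t_gt0 : \forall n \near \oo, 0 < t n.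
  by apply: filterS a_gt0 => n an; rewrite divr_gt0.
under eq_fun do rewrite fE -/(t _).
have mt0 : mean * t n @[n --> \oo] --> (0 : R).
  exact: (cvgnMl0 _).
have cost : cos (mean * t n) @[n --> \oo] --> (1 : R).
  have c1 : cos (mean * t n) @[n --> \oo] --> cos (0 : R).
    by apply: continuous_cvg => //; exact: continuous_cos.
  by rewrite cos0 in c1.
have sint : sin (mean * t n) @[n --> \oo] --> (0 : R).
  have c1 : sin (mean * t n) @[n --> \oo] --> sin (0 : R).
    by apply: continuous_cvg => //; exact: continuous_sin.
  by rewrite sin0 in c1.
have Nt3 : (N n)%:R * t n ^+ 3 @[n --> \oo] --> (0 : R).
  have H := cvgnM (ctau u u0) t0; rewrite mulr0 in H.
  by apply: cvgn_ext; [exact: H| |by []] => n /=; rewrite /t; ring.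
have NC : (N n)%:R * (cos (mean * t n) - 1) @[n --> \oo] --> - (mean ^+ 2 * tau u / 2).
  have H1 : (N n)%:R * (cos (mean * t n) - 1 + (mean * t n) ^+ 2 / 2) @[n --> \oo] --> (0 : R).
    have H := cvgnMr0 (mean ^+ 3 / 6) Nt3.
    apply: (cvgn0_le _ H); apply: filterS t_gt0 => n tn.
    have mt : 0 <= mean * t n by rewrite mulr_ge0 // ltW.
    rewrite normrM (ger0_norm (ler0n _ _)) -[leRHS]mulrA ler_wpM2l ?ler0n // ger0_norm.
      by apply: le_trans (le_cos_cube mt) _; rewrite le_eqVlt; apply/orP; left; apply/eqP; ring.
    by have := le_1Bcos_sqr mt; lra.
  have H2 := cvgnMr (mean ^+ 2 / 2) (ctau u u0).
  have H := cvgnB H1 H2; apply: cvgn_ext; [exact: H| |].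
    by move=> n /=; rewrite /t; ring.
  by ring.
have NS : (N n)%:R * (mean * t n - sin (mean * t n)) @[n --> \oo] --> (0 : R).
  have H := cvgnMr0 (mean ^+ 3 / 6) Nt3.
  apply: (cvgn0_le _ H); apply: filterS t_gt0 => n tn.
  have mt : 0 <= mean * t n by rewrite mulr_ge0 // ltW.
  rewrite normrM (ger0_norm (ler0n _ _)) -[leRHS]mulrA ler_wpM2l ?ler0n // ger0_norm.
    by apply: le_trans (le_sin_cube mt) _; rewrite le_eqVlt; apply/orP; left; apply/eqP; ring.
  by have := ge_sin mt; lra.
have NTC : (N n)%:R * (cos (mean * t n) - 1) * (mean * t n) @[n --> \oo] --> (0 : R).
  have H := cvgnM NC mt0; rewrite mulr0 in H.
  exact: H.
have NTS : (N n)%:R * (sin (mean * t n)) * (mean * t n) @[n --> \oo] --> mean ^+ 2 * tau u.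
  have H1 := cvgnM NS mt0.
  have H2 := cvgnMr (mean ^+ 2) (ctau u u0).
  have H := cvgnB H2 H1; apply: cvgn_ext; [exact: H| |].
    by move=> n /=; rewrite /t; ring.
  by ring.
pose ReF n := complex.Re (charf (f n) (t n)).
pose ImF n := complex.Im (charf (f n) (t n)).
have cRt : (N n)%:R * (ReF n - 1) @[n --> \oo] --> r1 u by exact: cR.
have cIt : (N n)%:R * (ImF n - mean * t n) @[n --> \oo] --> r2 u by exact: cI.
apply: cvg_power_expi => //.
- by apply: nearW => n; rewrite normcM normc_expi mulr1.
- have H := cvgnD (cvgnD (cvgnM cRt cost) NC) (cvgnD (cvgnM cIt sint) NTS).
  apply: cvgn_ext; [exact: H| |].
    move=> n /=; rewrite /ReF /ImF.
    by case: (charf _ _) => x y /=; rewrite cosN sinN; ring.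
  by field.
- have H := cvgnD (cvgnD (cvgnM cIt cost) NTC) (cvgnB NS (cvgnM cRt sint)).
  apply: cvgn_ext; [exact: H| |].
    move=> n /=; rewrite /ReF /ImF.
    by case: (charf _ _) => x y /=; rewrite cosN sinN; ring.
  by ring.
- have H := cvgnMl0 (K) t0.
  apply: (cvgn0_le _ H); apply: filterS2 mN t_gt0 => n mNn tn.
  by rewrite normrN normrM (gtr0_norm tn) ler_wpM2r // ltW.
Qed.

End LocalLimit.

(** * Real powers, series and Abelian asymptotics *)

Section PowerFunctions.
Variable R : realType.
Implicit Types (u : nat -> R) (a : R).

Lemma continuous_powR_gt0 a (x : R) : 0 < x -> {for x, continuous (fun y : R => y `^ a)}.
Proof.
move=> x0; apply/differentiable_continuous/derivable1_diffP.
apply: ex_derive; exact: is_derive1_powR.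
Qed.

Lemma cvgn_powR a u (l : R) : 0 < l -> u @ \oo --> l ->
  (u n) `^ a @[n --> \oo] --> l `^ a.
Proof.
move=> l0 ul.
have c : y `^ a @[y --> l] --> l `^ a := @continuous_powR_gt0 a l l0.
exact: (cvg_comp u (fun y => y `^ a) ul c).
Qed.

Lemma cvgny_powR a u : 0 < a -> u @ \oo --> +oo -> (u n) `^ a @[n --> \oo] --> +oo.
Proof.
move=> a0 uoo; apply/cvgryPge => M.
have : \forall n \near \oo, Num.max 1 M `^ a^-1 <= u n by exact: (cvgry_ge uoo).
apply: filterS => n Mu; have M0 : 0 <= Num.max 1 M by rewrite le_max ler01.
apply: (@le_trans _ _ (Num.max 1 M)); first by rewrite le_max lexx orbT.
move: Mu M0; set X := Num.max 1 M => Mu M0.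
rewrite -[leLHS]powRr1 // -(mulVf (lt0r_neq0 a0)) powRrM.
apply: ge0_ler_powR => //; first exact: ltW.
  by rewrite nnegrE powR_ge0.
by rewrite nnegrE (le_trans (powR_ge0 _ _) Mu).
Qed.

Lemma cvgn0_powRy a u : a < 0 -> u @ \oo --> +oo -> (u n) `^ a @[n --> \oo] --> (0 : R).
Proof.
move=> a0 uoo; have Na0 : 0 < - a by rewrite oppr_gt0.
have H := cvgny_powR Na0 uoo.
have H' : ((u n) `^ (- a))^-1 @[n --> \oo] --> (0 : R).
  apply/gtr0_cvgV0; last exact: H.
  exact: (cvgry_gt H).
by apply: cvgn_ext; [exact: H'| |by []] => n /=; rewrite powRN invrK.
Qed.

Lemma cvgn0_powR a u : 0 < a -> (\forall n \near \oo, 0 < u n) -> u @ \oo --> (0 : R) ->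
  (u n) `^ a @[n --> \oo] --> (0 : R).
Proof.
move=> a0 u_gt0 u0.
have uoo : (u n)^-1 @[n --> \oo] --> +oo.
  apply/gtr0_cvgV0; first by apply: filterS u_gt0 => n; rewrite invr_gt0.
  by apply: cvgn_ext; [exact: u0| |by []] => n /=; rewrite invrK.
have a0' : - a < 0 by rewrite oppr_lt0.
apply: (cvgn_near (cvgn0_powRy a0' uoo)).
apply: filterS u_gt0 => n un.
by rewrite -powR_inv1 ?ltW // -powRrM mulN1r opprK.
Qed.

Lemma powRD_gt0 (x r s : R) : 0 < x -> x `^ (r + s) = x `^ r * x `^ s.
Proof. by move=> x0; apply: powRD; apply/implyP => _; rewrite gt_eqF. Qed.

Lemma powR_neq0 (x r : R) : 0 < x -> x `^ r != 0.
Proof. by move=> x0; rewrite gt_eqF // powR_gt0. Qed.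

End PowerFunctions.

Section PowerIntegrability.
Variable R : realType.
Local Notation mu := (@lebesgue_measure R).

Lemma setitv0y_bigcup :
  `]0, +oo[%classic = \bigcup_i `[i.+1%:R^-1, i.+1%:R : R]%classic.
Proof.
apply/seteqP; split => [x /=|x [i _] /=]; rewrite !in_itv /= ?andbT.
  move=> x0; exists (Num.truncn (x + x^-1)) => //=; rewrite in_itv /=.
  have := truncnS_gt (x + x^-1); set k := _.+1%:R => xk.
  have xV : 0 < x^-1 by rewrite invr_gt0.
  have k0 : 0 < k :> R by rewrite ltr0n.
  have h1 : x < k by apply: lt_trans xk; rewrite ltrDl.
  have h2 : x^-1 < k by apply: lt_trans xk; rewrite ltrDr.
  by rewrite (ltW h1) andbT -[x]invrK lef_pV2 ?posrE // ltW.
by move=> /andP[+ _]; apply: lt_le_trans; rewrite invr_gt0 ltr0n.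
Qed.

Lemma ge0_integrable_FTC (w F : R -> R) (B : R) :
  (forall x : R, 0 < x -> 0 <= w x) ->
  (forall x : R, 0 < x -> {for x, continuous w}) ->
  (forall x : R, 0 < x -> is_derive x 1 F (w x)) ->
  (forall x : R, 0 < x -> `|F x| <= B) ->
  mu.-integrable `]0, +oo[ (EFin \o w).
Proof.
move=> w0 cw dF FB.
have mw : measurable_fun (`]0, +oo[%classic : set R) w.
  apply: open_continuous_measurable_fun; first exact: interval_open.
  by move=> x; rewrite inE /= in_itv /= andbT => /cw.
apply/integrableP; split; first exact/measurable_EFinP.
under eq_integral.
  move=> x; rewrite inE /= in_itv /= andbT => x0; rewrite ger0_norm ?w0 //.
  over.
have cvgI := @ge0_nondecreasing_set_cvg_integral _ (measurableTypeR R) R (fun i => `[i.+1%:R^-1, i.+1%:R]%classic : set R) (fun x : R => (w x)%:E) mu.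
apply: (@le_lt_trans _ _ (2 * B)%:E); last exact: ltry.
rewrite setitv0y_bigcup.
have pos i (x : R) : x \in `[i.+1%:R^-1 : R, i.+1%:R] -> 0 < x.
  by rewrite in_itv /= => /andP[+ _]; apply: lt_le_trans; rewrite invr_gt0 ltr0n.
apply: (cvge_to_le (cvgI _ _ _ _)).
- apply/nondecreasing_seqP => n; apply/subsetPset; apply: subset_itv; rewrite bnd_simp.
    by rewrite lef_pV2 ?posrE ?ltr0n // ler_nat.
  by rewrite ler_nat.
- by move=> n; exact: measurable_itv.
- move=> n; apply/measurable_EFinP; apply: measurable_funS mw; first exact: measurable_itv.
  by move=> x /= /pos x0; rewrite in_itv /= andbT.
- by move=> n x /= /pos x0; rewrite lee_fin w0.
apply: nearW => i.
have [i0|i0] := eqVneq i 0%N.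
  by rewrite i0 invr1 set_itv1 integral_set1 lee_fin mulr_ge0 // (le_trans _ (FB 1 _)).
have lti : i.+1%:R^-1 < i.+1%:R :> R.
  have i1 : (1 : R) < i.+1%:R by rewrite ltr1n ltnS lt0n.
  by apply: (lt_trans _ i1); rewrite invf_lt1 ?ltr0n.
have dFc (x : R) : 0 < x -> {for x, continuous F}.
  move=> x0; apply/differentiable_continuous/derivable1_diffP.
  by have := dF x x0 => ?; exact: ex_derive.
rewrite (@continuous_FTC2 _ w F) //.
- rewrite -EFinB lee_fin; have i0' : (0 : R) < i.+1%:R by rewrite ltr0n.
  have iV0 : (0 : R) < i.+1%:R^-1 by rewrite invr_gt0.
  have := FB _ i0'; have := FB _ iV0; rewrite !ler_norml => /andP[? ?] /andP[? ?]; lra.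
- apply: continuous_in_subspaceT => x; rewrite inE /= => /pos; exact: cw.
- have iV0 : (0 : R) < i.+1%:R^-1 by rewrite invr_gt0.
  split.
  + move=> x /subset_itv_oo_cc /pos x0; have := dF x x0 => ?; exact: ex_derive.
  + apply: cvg_at_right_filter; exact: dFc.
  + by apply: cvg_at_left_filter; exact: dFc.
- move=> x /subset_itv_oo_cc /pos x0; have := dF x x0 => ?.
  by rewrite derive1E derive_val.
Qed.

Lemma integrable_powR_hyperbola (sg C : R) : 0 < sg -> sg < 1 ->
  mu.-integrable `]0, +oo[ (EFin \o (fun x => C * (x `^ (- sg) / (1 + x)))).
Proof.
move=> sg0 sg1; pose s := 1 - sg; have s0 : 0 < s by rewrite subr_gt0.
pose F (x : R) := - (1 + x `^ s) `^ (- (sg / s)).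
pose w (x : R) := sg * (x `^ (- sg) * (1 + x `^ s) `^ (- s^-1)).
have q0 (x : R) : 0 < 1 + x `^ s by rewrite ltr_pwDl // powR_ge0.
have iw : mu.-integrable `]0, +oo[ (EFin \o w).
  apply: (@ge0_integrable_FTC w F 1).
  - by move=> x x0; rewrite !mulr_ge0 ?powR_ge0 // ltW.
  - move=> x x0; apply: cvgMl_tmp; apply: cvgM; first exact: (@continuous_powR_gt0 R).
    have c1 : 1 + y `^ s @[y --> x] --> 1 + x `^ s.
      by apply: cvgD; [exact: cvg_cst|exact: (@continuous_powR_gt0 R)].
    have c2 : y `^ (- s^-1) @[y --> 1 + x `^ s] --> (1 + x `^ s) `^ (- s^-1).
      exact: (@continuous_powR_gt0 R).
    exact: (cvg_comp _ _ c1 c2).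
  - move=> x x0.
    have d1 := is_derive1_powR s x0.
    have d2 := is_derive1_powR (- (sg / s)) (q0 x).
    have d3 : is_derive x (1 : R) (fun y : R => 1 + y `^ s) (s * x `^ (s - 1)).
      by have := is_deriveD (is_derive_cst (1 : R) x (1 : R)) d1; rewrite add0r.
    have d4 := @is_derive1_comp R (fun y => y `^ (- (sg / s))) (fun y => 1 + y `^ s) x _ _ d2 d3.
    have d5 := is_deriveN d4.
    apply: (is_derive_eq d5).
    have -> : s - 1 = - sg by rewrite /s; ring.
    have -> : - (sg / s) - 1 = - s^-1.
      by rewrite /s; field; rewrite gt_eqF // subr_gt0.
    by rewrite /w; field; rewrite gt_eqF.
  - move=> x x0; rewrite normrN ger0_norm ?powR_ge0 // powRN invf_le1 ?powR_gt0 //.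
    rewrite -[leLHS](powRr0 (1 + x `^ s)) ler_powR ?lerDl ?powR_ge0 //.
    by rewrite divr_ge0 // ltW.
pose K := C * 2 `^ s^-1 / sg.
have iKw := @integrableZl _ _ _ mu `]0, +oo[%classic (measurable_itv _) K _ iw.
apply: le_integrable iKw; first exact: measurable_itv.
  apply/measurable_EFinP; apply: measurable_funM => //.
  apply: open_continuous_measurable_fun; first exact: interval_open.
  move=> x; rewrite inE /= in_itv /= andbT => x0.
  apply: cvgM; first exact: (@continuous_powR_gt0 R).
  apply: cvgV; first by rewrite gt_eqF // addr_gt0.
  by apply: cvgD; [exact: cvg_cst|exact: cvg_id].
move=> x /=; rewrite in_itv /= andbT => x0; rewrite lee_fin.
have x1 : 0 < 1 + x by rewrite addr_gt0.
have -> : K * w x = C * (x `^ (- sg) * (2 `^ s^-1 * (1 + x `^ s) `^ (- s^-1))).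
  by rewrite /K /w; field; rewrite gt_eqF.
rewrite !(normrM C) ler_wpM2l //.
rewrite !ger0_norm ?mulr_ge0 ?powR_ge0 ?invr_ge0 ?(ltW x1) //.
rewrite ler_wpM2l ?powR_ge0 // powRN ler_pdivlMr ?powR_gt0 // mulrC ler_pdivrMr //.
have -> : 2 `^ s^-1 * (1 + x) = (2 * (1 + x) `^ s) `^ s^-1.
  by rewrite powRM ?powR_ge0 // -powRrM divff ?gt_eqF // powRr1 // ltW.
apply: ge0_ler_powR; rewrite ?nnegrE ?mulr_ge0 ?invr_ge0 ?powR_ge0 ?(ltW (q0 x)) ?(ltW s0) //.
rewrite mulr_natl mulr2n lerD //.
  by rewrite -[leLHS](powRr0 (1 + x)) ler_powR ?lerDl ?ltW.
by apply: ge0_ler_powR; rewrite ?nnegrE ?lerDr ?(ltW s0) ?(ltW x0) ?(ltW x1).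
Qed.

End PowerIntegrability.

Section AbelianSum.
Variable R : realType.
Local Notation mu := (@lebesgue_measure R).

Definition step_sum (c : nat -> R) (M : nat) (t v : R) : R :=
  \sum_(1 <= m < M) c m * \1_(`[m%:R * t, m.+1%:R * t[) v.

Lemma step_sumE c M (t v : R) : 0 < t -> 0 < v ->
  step_sum c M t v =
  if (1 <= Num.truncn (v / t) < M)%N then c (Num.truncn (v / t)) else 0.
Proof.
move=> t0 v0; rewrite -(@big_nat1_eq R 0 +%R) [RHS]big_mkcond; apply: eq_bigr => m _.
rewrite indicE mem_setE in_itv /= -ler_pdivlMr // -ltr_pdivrMr //.
have vt0 : 0 <= v / t by rewrite ltW ?divr_gt0.
rewrite [m == _]eq_sym truncn_eq //.
by case: ifP; rewrite ?mulr1 ?mulr0.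
Qed.

Lemma measurable_step_sum c M t (D : set R) :
  measurable D -> measurable_fun D (step_sum c M t).
Proof.
move=> mD; apply: measurable_sum => m; by apply: measurable_funM.
Qed.

Lemma integral_step_sum c M (t : R) : 0 < t ->
  \int[mu]_(v in `]0, +oo[) step_sum c M t v = t * \sum_(1 <= m < M) c m.
Proof.
move=> t0; rewrite /step_sum.
have mE (m : nat) : (0 < m)%N ->
   mu (`[m%:R * t, m.+1%:R * t[%classic `&` `]0, +oo[%classic) = t%:E.
  move=> m0; rewrite (setIidl _); last first.
    move=> x /=; rewrite !in_itv /= andbT => /andP[+ _]; apply: lt_le_trans.
    by rewrite mulr_gt0 // ltr0n.
  rewrite lebesgue_measure_itv /= lte_fin ltr_pM2r // ltr_nat ltnSn -EFinB.
  by congr (_ %:E); rewrite -natr1; ring.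
have ii (m : nat) : (0 < m)%N -> mu.-integrable `]0, +oo[
    (EFin \o (fun v => \1_(`[m%:R * t, m.+1%:R * t[) v)).
  move=> m0; apply/integrableP; split.
    by apply/measurable_EFinP; exact: measurable_indic.
  under eq_integral do rewrite /= ger0_norm //.
  rewrite integral_indic //.
  by rewrite [X in (X < _)%E](mE m m0) ltry.
under eq_Rintegral do rewrite big_add1.
rewrite Rintegral_sum; last 2 first.
- exact: measurable_itv.
- move=> i; have := @integrableZl _ _ _ mu `]0, +oo[%classic (measurable_itv _) (c i.+1) _ (ii i.+1 isT).
  exact.
rewrite big_add1 mulr_sumr; apply: eq_bigr => i _.
rewrite RintegralZl //; last exact: ii.
rewrite /Rintegral integral_indic //.
by rewrite [X in fine X](mE i.+1 isT) mulrC.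
Qed.

Lemma cvgn_bounded (u : nat -> R) (l : R) : u @ \oo --> l ->
  exists2 B, 0 < B & forall n, `|u n| <= B.
Proof.
move=> /cvgP /cvg_seq_bounded /pinfty_ex_gt0 [B B0 uB].
by exists B => // n; exact: uB.
Qed.

Lemma integrable_mul_powR (sg C : R) (h : R -> R) : 0 < sg -> sg < 1 ->
  (forall x : R, 0 < x -> {for x, continuous h}) ->
  (forall x : R, 0 < x -> `|h x| <= C / (1 + x)) ->
  mu.-integrable `]0, +oo[ (EFin \o (fun x => h x * x `^ (- sg))).
Proof.
move=> sg0 sg1 ch hC.
have C0 : 0 <= C.
  have := le_trans (normr_ge0 _) (hC 1 ltr01).
  by rewrite pmulr_lge0 // invr_gt0 addr_gt0.
have iw := integrable_powR_hyperbola C sg0 sg1.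
apply: le_integrable iw; first exact: measurable_itv.
  apply/measurable_EFinP; apply: open_continuous_measurable_fun; first exact: interval_open.
  move=> x; rewrite inE /= in_itv /= andbT => x0.
  by apply: cvgM; [exact: ch|exact: (@continuous_powR_gt0 R)].
move=> x /=; rewrite in_itv /= andbT => x0; rewrite lee_fin normrM (ger0_norm (powR_ge0 _ _)).
rewrite [leRHS]ger0_norm ?mulr_ge0 ?powR_ge0 ?invr_ge0 ?addr_ge0 ?(ltW x0) //.
rewrite [leRHS](_ : _ = C / (1 + x) * x `^ (- sg)); last by ring.
by apply: ler_wpM2r; rewrite ?powR_ge0 ?hC.
Qed.

Lemma cvg_abelian_sum (sg beta C : R) (q : nat -> R) (h : R -> R)
    (t : nat -> R) (M : nat -> nat) :
  0 < sg -> sg < 1 ->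
  q m * m%:R `^ sg @[m --> \oo] --> beta ->
  (forall x : R, 0 < x -> {for x, continuous h}) ->
  (forall x : R, 0 < x -> `|h x| <= C / (1 + x)) ->
  (\forall n \near \oo, 0 < t n) -> t @ \oo --> (0 : R) ->
  (M n)%:R * t n @[n --> \oo] --> +oo ->
  t n `^ (1 - sg) * \sum_(1 <= m < M n) q m * h (m%:R * t n) @[n --> \oo] -->
    beta * \int[mu]_(x in `]0, +oo[) (h x * x `^ (- sg)).
Proof.
move=> sg0 sg1 qb ch hC t_gt0 t0 Mt.
have [B B0 qB] := cvgn_bounded qb.
have C0 : 0 <= C.
  have := le_trans (normr_ge0 _) (hC 1 ltr01).
  by rewrite pmulr_lge0 // invr_gt0 addr_gt0.
pose c n m := t n `^ (- sg) * (q m * h (m%:R * t n)).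
pose w (x : R) := (B * C * 2 `^ sg * 2) * (x `^ (- sg) / (1 + x)).
have [|||||_ cvgI] := @Rdominated_cvg R `]0, +oo[%classic
  (fun n => step_sum (c n) (M n) (t n)) (fun x => beta * (h x * x `^ (- sg))) w.
- exact: measurable_itv.
- by move=> n; apply: measurable_step_sum; exact: measurable_itv.
- apply: filterS t_gt0 => n tn v; rewrite /= in_itv /= andbT => v0.
  rewrite step_sumE //; set k := Num.truncn (v / t n).
  have w0 : 0 <= w v by rewrite !mulr_ge0 ?powR_ge0 ?invr_ge0 ?addr_ge0 ?(ltW B0) ?(ltW v0).
  case: ifP => [/andP[k1 _]|]; last by rewrite normr0.
  have /andP[kv vk] : k%:R <= v / t n < k.+1%:R by rewrite truncn_itv // divr_ge0 ?ltW.
  have k0 : (0 : R) < k%:R by rewrite ltr0n.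
  have kt0 : 0 < k%:R * t n by rewrite mulr_gt0.
  have vkt : v / 2 <= k%:R * t n.
    rewrite ler_pdivrMr //; move: vk; rewrite ltr_pdivrMr // => /ltW /le_trans; apply.
    rewrite mulrAC ler_pM2r // -natr1 mulrDr mulr1 lerD2l.
    by rewrite ler1n.
  have E : `|c n k| = `|q k * k%:R `^ sg| * (`|h (k%:R * t n)| * (k%:R * t n) `^ (- sg)).
    rewrite /c !normrM !(ger0_norm (powR_ge0 _ _)) powRM ?ltW // [k%:R `^ (- sg)]powRN.
    by field; rewrite powR_neq0.
  rewrite E /w.
  apply: (@le_trans _ _ (B * (C / (1 + k%:R * t n) * (k%:R * t n) `^ (- sg)))).
    by rewrite ler_pM ?mulr_ge0 ?powR_ge0 // ler_wpM2r ?powR_ge0 // hC.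
  rewrite -!mulrA ler_wpM2l ?(ltW B0) // ler_wpM2l //.
  have -> : 2 `^ sg * (2 * (v `^ (- sg) / (1 + v))) = (2 / (1 + v)) * (v / 2) `^ (- sg).
    rewrite powRM ?invr_ge0 // ?ltW // -[2^-1 in RHS]powR_inv1 // -powRrM mulN1r opprK.
    by field; rewrite gt_eqF // addr_gt0.
  apply: ler_pM; rewrite ?invr_ge0 ?addr_ge0 ?powR_ge0 ?(ltW kt0) //.
    by rewrite -[leRHS]invrK lef_pV2 ?posrE ?invf_div ?divr_gt0 ?addr_gt0 //; lra.
  rewrite !powRN lef_pV2 ?posrE ?powR_gt0 ?divr_gt0 //.
  have v2 : 0 <= v / 2 by lra.
  by apply: ge0_ler_powR; rewrite ?nnegrE ?(ltW sg0) ?(ltW kt0).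
- exact: integrable_powR_hyperbola.
- move=> v; rewrite /= in_itv /= andbT => v0.
  pose k n := Num.truncn (v / t n).
  have tV : (t n)^-1 @[n --> \oo] --> +oo.
    by apply/gtr0_cvgV0; [apply: filterS t_gt0 => n; rewrite invr_gt0|
      apply: cvgn_ext; [exact: t0| |by []] => n /=; rewrite invrK].
  have kt : (k n)%:R * t n @[n --> \oo] --> v.
    apply: (@squeeze_cvgr _ _ _ _ (fun n => v - t n) (fun=> v)); last exact: cvg_cst.
      apply: filterS t_gt0 => n tn.
      have /andP[kv vk] : (k n)%:R <= v / t n < (k n).+1%:R by rewrite truncn_itv // divr_ge0 ?ltW.
      move: kv vk; rewrite ler_pdivlMr // ltr_pdivrMr // -natr1 mulrDl mul1r => -> vk.
      by rewrite andbT lerBlDr ltW.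
    by have := cvgnB (cvg_cst v) t0; rewrite subr0; exact.
  have koo : k @ \oo --> \oo.
    apply/cvgnyPge => A.
    have : \forall n \near \oo, A%:R / v <= (t n)^-1 by exact: (cvgry_ge tV).
    apply: filterS2 t_gt0 => n tn Av.
    have vt0 : 0 <= v / t n by rewrite ltW ?divr_gt0.
    rewrite truncn_ge_nat //.
    by move: Av; rewrite ler_pdivrMr // mulrC.
  have qk : q (k n) * (k n)%:R `^ sg @[n --> \oo] --> beta by exact: (cvg_comp _ _ koo qb).
  have ktp : ((k n)%:R * t n) `^ (- sg) @[n --> \oo] --> v `^ (- sg) by exact: cvgn_powR.
  have hk : h ((k n)%:R * t n) @[n --> \oo] --> h v by exact: (cvg_comp _ _ kt (ch v v0)).
  apply: (cvgn_near (cvgnM qk (cvgnM hk ktp))).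
  have kM : \forall n \near \oo, v < (M n)%:R * t n by exact: (cvgry_gt Mt).
  have /cvgnyPge/(_ 1%N) k1 := koo.
  near=> n; have tn : 0 < t n by near: n.
  rewrite step_sumE // ifT; last first.
    rewrite /k; apply/andP; split; first by near: n.
    have vt0 : 0 <= v / t n by rewrite ltW ?divr_gt0.
    by rewrite truncn_lt_nat // ltr_pdivrMr //; near: n.
  have k0 : (0 : R) < (k n)%:R by rewrite ltr0n; near: n.
  rewrite /c -/(k n) powRM ?ltW // [(k n)%:R `^ (- sg)]powRN.
  by field; rewrite powR_neq0.
have ih := integrable_mul_powR sg0 sg1 ch hC.
rewrite RintegralZl // in cvgI.
apply: (cvgn_near cvgI).
apply: filterS t_gt0 => n tn.
rewrite integral_step_sum // /c -mulr_sumr mulrA; congr (_ * _).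
by rewrite powRD_gt0 // powRr1 // ltW.
Unshelve. all: by end_near. Qed.

End AbelianSum.

Section SeriesTools.
Variable R : realType.

Lemma cvgnV (u : nat -> R) (l : R) : l != 0 -> u @ \oo --> l ->
  (u n)^-1 @[n --> \oo] --> l^-1.
Proof. by move=> l0 ul; exact: (cvgV l0 ul). Qed.

Lemma ln_leB1 (x : R) : 0 < x -> ln x <= x - 1.
Proof.
move=> x0; have -> : ln x = ln (1 + (x - 1)) by congr ln; ring.
by apply: le_ln1Dx; lra.
Qed.

Lemma cvg_series_shift (u : nat -> R) (l : R) :
  series u @ \oo --> l -> series (fun m => u m.+1) @ \oo --> l - u 0%N.
Proof.
move=> H; have H' : series u n.+1 @[n --> \oo] --> l by rewrite cvg_shiftS.
apply: cvgn_ext; [exact: (cvgnB H' (cvg_cst (u 0%N)))| |by []] => n.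
by rewrite /series /= big_nat_recl // addrC addKr.
Qed.

Lemma cvg_seriesD (u v : nat -> R) (l k : R) : series u @ \oo --> l ->
  series v @ \oo --> k -> series (fun m => u m + v m) @ \oo --> l + k.
Proof.
move=> ul vk; apply: cvgn_ext; [exact: (cvgnD ul vk)| |by []] => n.
by rewrite /series /= -big_split.
Qed.

Lemma cvg_seriesMl (c : R) (u : nat -> R) (l : R) : series u @ \oo --> l ->
  series (fun m => c * u m) @ \oo --> c * l.
Proof.
move=> ul; apply: cvgn_ext; [exact: (cvgnMl c ul)| |by []] => n.
by rewrite /series /= mulr_sumr.
Qed.

Lemma cvg_series_eq (u v : nat -> R) (l l' : R) : series u @ \oo --> l ->
  (forall n, u n = v n) -> l = l' -> series v @ \oo --> l'.
Proof. by move=> ul uv <-; rewrite (_ : v = u) //; apply/funext => n; rewrite uv. Qed.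

Lemma cvg_series_damped (u : nat -> R) (l T : R) : (forall m, 0 <= u m) ->
  series u @ \oo --> l -> 0 <= T <= 1 -> cvgn (series (fun m => u m * T ^+ m)).
Proof.
move=> u0 ul /andP[T0 T1]; apply: (@series_le_cvg _ _ u) => //.
- by move=> n; rewrite mulr_ge0 ?exprn_ge0.
- by move=> n; rewrite ler_piMr ?exprn_ile1.
- by apply/cvg_ex; exists l.
Qed.

Lemma cvg_series_unshift (u : nat -> R) (l : R) :
  series (fun m => u m.+1) @ \oo --> l -> series u @ \oo --> u 0%N + l.
Proof.
move=> H; suff : series u n.+1 @[n --> \oo] --> u 0%N + l by rewrite cvg_shiftS.
apply: cvgn_ext; [exact: (cvgnD (cvg_cst (u 0%N)) H)| |by []] => n.
by rewrite /series /= big_nat_recl.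
Qed.

Lemma powR_telescope (a : R) (m : nat) : 1 < a ->
  (a - 1) * m.+2%:R `^ (- a) <= m.+1%:R `^ (1 - a) - m.+2%:R `^ (1 - a).
Proof.
move=> a1; have x0 : (0 : R) < m.+2%:R by rewrite ltr0n.
have y0 : (0 : R) < m.+1%:R by rewrite ltr0n.
pose v : R := m.+1%:R / m.+2%:R; have v0 : 0 < v by rewrite divr_gt0.
have -> : m.+1%:R = m.+2%:R * v :> R by rewrite /v mulrCA divff ?mulr1 // gt_eqF.
rewrite powRM ?(ltW x0) ?(ltW v0) //.
have -> : m.+2%:R `^ (- a) = m.+2%:R^-1 * m.+2%:R `^ (1 - a) :> R.
  by rewrite -powR_inv1 ?(ltW x0) // -powRD_gt0 //; congr (_ `^ _); ring.
suff : 1 + (a - 1) / m.+2%:R <= v `^ (1 - a).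
  move=> H; have := ler_wpM2l (powR_ge0 m.+2%:R (1 - a)) H.
  set X := m.+2%:R `^ (1 - a); set W := v `^ _; set Y := m.+2%:R^-1.
  by rewrite mulrDr mulr1 mulrCA (mulrC X); lra.
rewrite /powR gt_eqF //; apply: le_trans _ (expR_ge1Dx _); rewrite lerD2l.
have -> : m.+2%:R^-1 = 1 - v.
  apply: (mulIf (lt0r_neq0 x0)); rewrite mulrBl mulfVK ?gt_eqF // mulVf ?gt_eqF // mul1r.
  by rewrite -[m.+2%:R]natr1 addrAC subrr add0r.
by have := ln_leB1 v0; nra.
Qed.

Lemma cvg_series_riemann (a : R) : 1 < a ->
  cvgn (series (fun m => m%:R `^ (- a) : R)).
Proof.
move=> a1; suff H n : series (fun m => m%:R `^ (- a) : R) n <= 1 + (a - 1)^-1.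
  apply: nondecreasing_is_cvgn; last by exists (1 + (a - 1)^-1) => _ [n _ <-].
  by apply/nondecreasing_seqP => n; rewrite seriesSr /= lerDl powR_ge0.
have a0 : 0 < a - 1 by rewrite subr_gt0.
have {}H k : series (fun m => m%:R `^ (- a) : R) k.+2 + k.+1%:R `^ (1 - a) / (a - 1) <= 1 + (a - 1)^-1.
  elim: k => [|k IHk].
    by rewrite /series /= !big_nat_recr //= big_nil !powR1 powR0 ?oppr_eq0 ?gt_eqF ?(lt_trans ltr01) // !add0r mul1r.
  apply: le_trans IHk; rewrite seriesSr /= -addrA lerD2l.
  rewrite -(ler_pM2r a0) mulrDl !mulfVK ?gt_eqF // mulrC.
  by have := powR_telescope k a1; lra.
apply: le_trans (H n); apply: (@le_trans _ _ (series (fun m => m%:R `^ (- a)) n.+2)).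
  by rewrite !seriesSr /= -addrA lerDl addr_ge0 // powR_ge0.
by rewrite lerDl divr_ge0 ?powR_ge0 // ltW.
Qed.

Lemma cvg_series_tail (u : nat -> R) (a l : R) : 1 < a -> (forall m, 0 <= u m) ->
  u m * m%:R `^ a @[m --> \oo] --> l -> cvgn (series u).
Proof.
move=> a1 u0 ul; have [K K0 uK] := cvgn_bounded ul.
have [k Hk] : exists k : R, series (fun m => K * m.+1%:R `^ (- a)) @ \oo --> k.
  have /cvg_ex [k Hk] := cvg_series_riemann a1.
  by exists (K * (k - 0%:R `^ (- a))); exact: (cvg_seriesMl (c := K) (cvg_series_shift Hk)).
have /cvg_ex [k' Hk'] : cvgn (series (fun m => u m.+1)).
  apply: (@series_le_cvg _ _ (fun m => K * m.+1%:R `^ (- a))) => //.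
  - by move=> n; rewrite mulr_ge0 ?powR_ge0 // ltW.
  - move=> n; have n0 : (0 : R) < n.+1%:R by rewrite ltr0n.
    rewrite powRN ler_pdivlMr ?powR_gt0 //.
    by apply: le_trans (uK n.+1); rewrite ler_norm.
  - by apply/cvg_ex; exists k.
by apply/cvg_ex; exists (u 0%N + k'); exact: cvg_series_unshift.
Qed.

Lemma cvgn0_powR_expR (k c t : R) : 0 < c -> 0 < t ->
  n%:R `^ k * expR (- (n%:R `^ c / t)) @[n --> \oo] --> (0 : R).
Proof.
move=> c0 t0; have [K HK] : exists K : nat, k < c * K%:R.
  have /cvgryPgt/(_ (k / c)) [K _ /(_ K (leqnn K)) HK] := @cvgr_idn R.
  by exists K; rewrite mulrC -ltr_pdivrMr.
have K0 : (0 < K.+1)%N by [].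
have kc : k - c * K.+1%:R < 0.
  by rewrite subr_lt0 (lt_le_trans HK) // ler_wpM2l ?(ltW c0) // ler_nat.
have H := cvgnMr0 ((K.+1%:R * t) ^+ K.+1) (cvgn0_powRy kc (@cvgr_idn R)).
apply: (cvgn0_le _ H); near=> n.
have n0 : (0 : R) < n%:R by rewrite ltr0n; near: n; exact: nbhs_infty_gt.
rewrite ger0_norm ?mulr_ge0 ?powR_ge0 ?expR_ge0 // powRD_gt0 // -mulrA.
rewrite ler_wpM2l ?powR_ge0 // powRN powRrM powR_mulrn ?powR_ge0 //.
have v0 : 0 < n%:R `^ c / t :> R by rewrite divr_gt0 ?powR_gt0.
rewrite -exprVn -exprMn expRN -[leLHS]mul1r.
set v := n%:R `^ c / t.
have E : v = K.+1%:R * (v / K.+1%:R) by rewrite mulrC divfK // pnatr_eq0.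
rewrite mul1r {1}E expRM_natl -exprVn; apply: lerXn2r.
- by rewrite nnegrE invr_ge0 expR_ge0.
- by rewrite nnegrE !mulr_ge0 ?invr_ge0 ?powR_ge0 ?(ltW t0).
have -> : (n%:R `^ c)^-1 * (K.+1%:R * t) = (v / K.+1%:R)^-1.
  by rewrite /v !invfM !invrK; ring.
rewrite lef_pV2 ?posrE ?expR_gt0 ?divr_gt0 ?powR_gt0 //.
by apply: le_trans _ (expR_ge1Dx _); rewrite lerDr ler01.
Unshelve. all: by end_near. Qed.

Lemma cvgn0_powR_geometric (k y : R) : 0 < y -> y < 1 ->
  n%:R `^ k * y ^+ n @[n --> \oo] --> (0 : R).
Proof.
move=> y0 y1; have ly : ln y < 0 by rewrite ln_lt0 // y0.
have t0 : 0 < (- ln y)^-1 by rewrite invr_gt0 oppr_gt0.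
apply: cvgn_ext; [exact: (cvgn0_powR_expR k ltr01 t0)| |by []] => n /=.
congr (_ * _); rewrite powRr1 // invrK mulrN opprK expRM_natl lnK ?posrE //.
Qed.

End SeriesTools.

(** * The stable local limit theorem *)

Section CharacteristicFunctionBounds.
Variable R : realType.
Variable p : nat -> R.
Hypothesis p_ge0 : forall i, 0 <= p i.
Hypothesis p_le1 : forall M, \sum_(i < M) p i <= 1.

Lemma normc_sqr (z : R[i]) : normc z ^+ 2 = complex.Re z ^+ 2 + complex.Im z ^+ 2.
Proof. by case: z => x y; rewrite sqr_sqrtr // addr_ge0 ?sqr_ge0. Qed.

Lemma normc_charf_sqr (M : nat) (t : R) :
  normc (charf (\poly_(i < M) p i) t) ^+ 2 =
  \sum_(i < M) \sum_(j < M) p i * p j * cos ((i%:R - j%:R) * t).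
Proof.
rewrite normc_sqr Re_charf Im_charf !expr2 !big_distrlr /= -big_split /=.
apply: eq_bigr => i _; rewrite -big_split /=; apply: eq_bigr => j _.
by rewrite mulrBl cosB; ring.
Qed.

Lemma normc_charf_le (M j0 a b : nat) (t : R) : (j0 < M)%N -> (b <= M)%N ->
  normc (charf (\poly_(i < M) p i) t) ^+ 2 <=
  1 - p j0 * \sum_(a <= i < b) p i * (1 - cos ((i%:R - j0%:R) * t)).
Proof.
move=> j0M bM; rewrite normc_charf_sqr.
have cos1 (x : R) : 0 <= 1 - cos x by rewrite subr_ge0 cos_le1.
pose g (i j : nat) := p i * p j * (1 - cos ((i%:R - j%:R) * t)).
have g0 i j : 0 <= g i j by rewrite !mulr_ge0.
have -> : \sum_(i < M) \sum_(j < M) p i * p j * cos ((i%:R - j%:R) * t) =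
    (\sum_(i < M) p i) ^+ 2 - \sum_(i < M) \sum_(j < M) g i j.
  rewrite expr2 big_distrlr /= -sumrB; apply: eq_bigr => i _.
  by rewrite -sumrB; apply: eq_bigr => j _; rewrite /g; ring.
rewrite lerB //.
  by rewrite expr_le1 // sumr_ge0.
apply: (@le_trans _ _ (\sum_(i < M) g i j0)); last first.
  apply: ler_sum => i _; rewrite (bigD1 (Ordinal j0M)) //= lerDl.
  by apply: sumr_ge0.
rewrite mulr_sumr -(big_mkord xpredT (g ^~ j0)).
rewrite (big_nat_widenl _ 0) //= (big_nat_widen _ _ M) //= big_mkcond /=.
apply: ler_sum => i _; case: ifP => _ //.
by rewrite /g; nra.
Qed.

Lemma normc_charf_le1 (M : nat) (t : R) : normc (charf (\poly_(i < M) p i) t) <= 1.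
Proof.
case: M => [|M].
  rewrite -(@ler_pXn2r _ 2) ?nnegrE ?normc_ge0 // expr1n normc_charf_sqr big_ord0.
  exact: ler01.
rewrite -(@ler_pXn2r _ 2) ?nnegrE ?normc_ge0 // expr1n.
apply: le_trans (@normc_charf_le M.+1 0 0 0 t _ _) _ => //.
by rewrite big_geq // mulr0 subr0.
Qed.

Lemma charf_decay (M N : nat -> nat) (a : nat -> R) (g k B c0 : R) :
  1 <= g -> 0 < k -> 0 < B -> 0 < c0 ->
  (forall M t, 0 < t -> t <= pi -> c0 <= M%:R -> c0 <= M%:R * t ->
     normc (charf (\poly_(i < M.+1) p i) t) ^+ 2 <= 1 - k * t `^ g) ->
  a @ \oo --> +oo ->
  (\forall n \near \oo, a n `^ g = B * (N n)%:R) ->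
  (\forall n \near \oo, c0 * a n <= (M n)%:R) ->
  exists c D : R, 0 < c /\ \forall n \near \oo, forall u, 0 <= u <= pi * a n ->
     normc (charf (\poly_(i < (M n).+1) p i) (u / a n)) ^+ N n <= D * expR (- (c * u)).
Proof.
move=> g1 k0 B0 c00 H aoo aN aM.
pose c := k / B / 2; exists c, (expR c).
have c_gt0 : 0 < c by rewrite /c !divr_gt0.
split=> //.
have a_ge1 : \forall n \near \oo, 1 <= a n by exact: (cvgry_ge aoo).
near=> n => u /andP[u0 ua].
have an1 : 1 <= a n by near: n.
have an0 : 0 < a n by exact: lt_le_trans an1.
have [u1|u1] := ltP u 1.
  apply: (@le_trans _ _ 1).
    by rewrite exprn_ile1 ?normc_ge0 ?normc_charf_le1.
  by rewrite -expRD -expR0 ler_expR; nra.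
have Ma : c0 * a n <= (M n)%:R by near: n.
have aNn : a n `^ g = B * (N n)%:R by near: n.
pose t := u / a n.
have t0 : 0 < t by rewrite divr_gt0 // (lt_le_trans ltr01).
have tpi : t <= pi by rewrite ler_pdivrMr.
have c0M : c0 <= (M n)%:R by apply: le_trans Ma; rewrite ler_peMr // ltW.
have c0Mt : c0 <= (M n)%:R * t.
  by rewrite /t mulrA ler_pdivlMr //; apply: le_trans Ma _; rewrite ler_peMr.
have := H (M n) t t0 tpi c0M c0Mt; rewrite -/t; set z := normc _ => zt.
have z0 : 0 <= z by exact: normc_ge0.
have ze : z <= expR (- (k * t `^ g / 2)).
  rewrite -(@ler_pXn2r _ 2) ?nnegrE ?expR_ge0 //; apply: le_trans zt _.
  rewrite -expRM_natl; apply: le_trans (expR_ge1Dx _) _.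
  by rewrite ler_expR; lra.
have zN : z ^+ N n <= expR (- (k * t `^ g / 2)) ^+ N n.
  by rewrite lerXn2r // ?nnegrE ?expR_ge0.
apply: le_trans zN _; rewrite -expRM_natl -expRD ler_expR.
have tg : (N n)%:R * t `^ g = u `^ g / B.
  have -> : u `^ g = t `^ g * a n `^ g.
    by rewrite -powRM ?(ltW t0) ?(ltW an0) // /t divfK // gt_eqF.
  by rewrite aNn; field; rewrite gt_eqF.
have ug : u <= u `^ g by rewrite le1r_powR.
have -> : (N n)%:R * - (k * t `^ g / 2) = - (c * u `^ g).
  rewrite (_ : _ * _ = - (k / 2 * ((N n)%:R * t `^ g))); last by ring.
  by rewrite tg /c; field; rewrite gt_eqF.
by nra.
Unshelve. all: by end_near. Qed.

Lemma charf_quadratic (j : nat) : 0 < p j -> 0 < p j.+1 ->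
  exists k c0 : R, [/\ 0 < k, 0 < c0 & forall (M : nat) (t : R), 0 < t -> t <= pi ->
   c0 <= M%:R -> normc (charf (\poly_(i < M.+1) p i) t) ^+ 2 <= 1 - k * t ^+ 2].
Proof.
move=> pj pj1; exists (p j * p j.+1 / 32), j.+1%:R; split.
- by rewrite divr_gt0 // mulr_gt0.
- by rewrite ltr0n.
move=> M t t0 tpi; rewrite ler_nat => jM.
apply: le_trans (@normc_charf_le M.+1 j j.+1 j.+2 t _ _) _; rewrite ?ltnS ?(ltnW jM) //.
have E : (j.+1%:R - j%:R) * t = t :> R by rewrite -natr1; ring.
rewrite big_nat1 E lerB //.
have := @ge_1Bcos_sqr R t; rewrite (ltW t0) tpi => /(_ erefl) ct.
by have := mulr_gt0 pj pj1; nra.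
Qed.

Lemma charf_stable (al be : R) : 1 < al -> al < 2 -> 0 < be ->
  p m * m%:R `^ (1 + al) @[m --> \oo] --> be ->
  exists k c0 : R, [/\ 0 < k, 0 < c0 & forall (M : nat) (t : R), 0 < t -> t <= pi ->
    c0 <= M%:R -> c0 <= M%:R * t ->
    normc (charf (\poly_(i < M.+1) p i) t) ^+ 2 <= 1 - k * t `^ al].
Proof.
move=> al1 al2 be0 pbe.
have [j0 _ Hj0] : \forall m \near \oo, be / 2 <= p m * m%:R `^ (1 + al).
  by apply: (cvgr_ge be) => //; lra.
pose j := maxn 1 j0; have j1 : (0 < j)%N by rewrite leq_max.
have pj (i : nat) : (j <= i)%N -> be / 2 * i%:R `^ (- (1 + al)) <= p i.
  move=> ji; have i0 : (0 : R) < i%:R by rewrite ltr0n (leq_trans j1 ji).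
  rewrite powRN ler_pdivrMr ?powR_gt0 //; apply: Hj0 => /=.
  by rewrite (leq_trans _ ji) // leq_maxr.
have pj0 (i : nat) : (j <= i)%N -> 0 < p i.
  move=> ji; have i0 : (0 : R) < i%:R by rewrite ltr0n (leq_trans j1 ji).
  apply: lt_le_trans (pj i ji); rewrite mulr_gt0 ?powR_gt0 //; lra.
have [k2 [c2 [k20 c20 H2]]] := charf_quadratic (pj0 j (leqnn _)) (pj0 j.+1 (leqnSn _)).
pose J : R := j%:R + 3.
have J0 : 0 < J by rewrite /J ltr_pwDr // ler0n.
pose k1 := p j * (be / 2 * J `^ (- (1 + al)) / 128).
have k10 : 0 < k1.
  by rewrite /k1 mulr_gt0 ?pj0 // divr_gt0 // mulr_gt0 ?powR_gt0 //; lra.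
pose k3 := k2 / 16 / pi `^ al.
have k30 : 0 < k3 by rewrite /k3 !divr_gt0 // powR_gt0 // pi_gt0.
exists (Num.min k1 k3), (Num.max J c2); split.
- by rewrite lt_min k10.
- by rewrite lt_max J0.
move=> M t t0 tpi; rewrite !ge_max => /andP[JM c2M] /andP[JMt _].
have tal : 0 < t `^ al by rewrite powR_gt0.
have [t4|t4] := lerP (1 / 4) t; last first.
  pose A := (Num.truncn t^-1).+1; pose L := Num.truncn ((2 * t)^-1).
  have tV : 0 < t^-1 by rewrite invr_gt0.
  have A1 : t^-1 < A%:R by exact: truncnS_gt.
  have A2 : A%:R <= t^-1 + 1 by rewrite -natr1 lerD2r truncn_le ltW.
  have L1 : (2 * t)^-1 < L.+1%:R by exact: truncnS_gt.
  have L2 : L%:R <= (2 * t)^-1 by rewrite truncn_le invr_ge0; lra.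
  have tVE : (2 * t)^-1 = t^-1 / 2 by rewrite invfM mulrC.
  have tt : t^-1 * t = 1 by rewrite mulVf // gt_eqF.
  have tV4 : 4 <= t^-1.
    by rewrite -[leLHS]invrK lef_pV2 ?posrE ?invr_gt0 //; lra.
  have JALt : (j + A + L)%:R <= J / t :> R.
    rewrite !natrD /J; have j0' : (1 : R) <= j%:R by rewrite ler1n.
    move: L2; rewrite tVE => L2.
    have jt : 0 <= (t^-1 - 1) * j%:R by rewrite mulr_ge0 //; lra.
    move: jt A2 L2 tV4 j0'; move: (t^-1) (j%:R : R) (A%:R : R) (L%:R : R) => y r1 r2 r3 *; lra.
  have jALM : (j + A + L <= M)%N.
    by rewrite -(ler_nat R) (le_trans JALt) // ler_pdivrMr.
  have AL : (j + A <= j + A + L)%N by rewrite leq_addr.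
  have jM : (j < M.+1)%N by rewrite ltnS (leq_trans _ jALM) // -addnA leq_addr.
  apply: le_trans (@normc_charf_le M.+1 j (j + A) (j + A + L) t jM (leqW jALM)) _.
  rewrite lerB //.
  apply: (@le_trans _ _ (k1 * t `^ al)); first by rewrite ler_wpM2r ?ge_min ?lexx // ltW.
  rewrite /k1 -mulrA ler_wpM2l //.
  have term i : (j + A <= i < j + A + L)%N ->
      be / 2 * (J `^ (- (1 + al)) * t `^ (1 + al)) / 32 <= p i * (1 - cos ((i%:R - j%:R) * t)).
    move=> /andP[iA iL].
    have iA' : j%:R + A%:R <= i%:R :> R by rewrite -natrD ler_nat.
    have iL' : i%:R <= j%:R + A%:R + L%:R :> R by rewrite -!natrD ler_nat ltnW.
    have ij : (j <= i)%N by rewrite (leq_trans _ iA) ?leq_addr.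
    have i0 : (0 : R) < i%:R by rewrite ltr0n (leq_trans j1 ij).
    have v1 : 1 <= (i%:R - j%:R) * t by rewrite -[leLHS]tt ler_pM2r //; lra.
    have v2 : (i%:R - j%:R) * t <= 2.
      rewrite -ler_pdivlMr //; move: L2; rewrite tVE => L2.
      by move: A2 L2 tV4; move: (t^-1) => y *; lra.
    have cv : 1 / 32 <= 1 - cos ((i%:R - j%:R) * t).
      have := @ge_1Bcos_sqr R ((i%:R - j%:R) * t).
      rewrite (le_trans ler01 v1) (le_trans v2 (pi_ge2 R)) => /(_ erefl).
      by apply: le_trans; rewrite ler_pM2r ?invr_gt0 // exprn_ege1.
    rewrite -[_ / 32]/(_ * 32^-1) -[32^-1]div1r.
    apply: ler_pM; rewrite ?mulr_ge0 ?powR_ge0 //; try lra.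
    apply: le_trans (pj i ij); rewrite ler_wpM2l //; first lra.
    have iJ : i%:R <= J / t.
      apply: le_trans iL' _; rewrite -!natrD; apply: le_trans JALt.
      by rewrite ler_nat.
    have -> : J `^ (- (1 + al)) * t `^ (1 + al) = (J / t) `^ (- (1 + al)).
      rewrite powRM ?invr_ge0 ?(ltW J0) ?(ltW t0) // -[t^-1]powR_inv1 ?(ltW t0) //.
      by rewrite -powRrM mulN1r opprK.
    rewrite !powRN lef_pV2 ?posrE ?powR_gt0 ?divr_gt0 //.
    by apply: ge0_ler_powR; rewrite ?nnegrE ?(ltW i0) ?divr_ge0 ?(ltW J0) ?(ltW t0) //; lra.
  apply: (@le_trans _ _ (\sum_(j + A <= i < j + A + L) (be / 2 * (J `^ (- (1 + al)) * t `^ (1 + al)) / 32))); last first.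
    by rewrite !big_nat; apply: ler_sum => i; exact: term.
  rewrite sumr_const_nat addKn -[leRHS]mulr_natl.
  have -> : t `^ (1 + al) = t * t `^ al by rewrite powRD_gt0 // powRr1 // ltW.
  have LT : 1 / 4 <= L%:R * t.
    rewrite -ler_pdivrMr //; move: L1; rewrite tVE -[L.+1%:R]natr1 => L1.
    by move: L1 tV4; move: (t^-1) (L%:R : R) => y r1 *; lra.
  set X := J `^ _; have X0 : 0 < X by exact: powR_gt0.
  set Y := t `^ al.
  have -> : L%:R * (be / 2 * (X * (t * Y)) / 32) = (L%:R * t) * (be / 2 * X / 32 * Y) by ring.
  have -> : be / 2 * X / 128 * Y = 1 / 4 * (be / 2 * X / 32 * Y) by field.
  rewrite ler_wpM2r // !mulr_ge0 ?(ltW X0) ?(ltW tal) //; lra.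
apply: le_trans (H2 M t t0 tpi c2M) _; rewrite lerB //.
apply: (@le_trans _ _ (k3 * t `^ al)).
  by rewrite ler_wpM2r ?ge_min ?lexx ?orbT // ltW.
have tp : t `^ al <= pi `^ al.
  by apply: ge0_ler_powR; rewrite ?nnegrE ?(ltW t0) ?pi_ge0 //; lra.
apply: (@le_trans _ _ (k2 / 16)).
  rewrite /k3 mulrAC ler_pdivrMr ?powR_gt0 ?pi_gt0 // ler_wpM2l //.
  by rewrite divr_ge0 // ltW.
by rewrite ler_wpM2l ?(ltW k20) //; nra.
Qed.

End CharacteristicFunctionBounds.

Section LawTruncation.
Variable R : realType.

Lemma cvgnyMl (c : R) (u : nat -> R) : 0 < c -> u @ \oo --> +oo ->
  c * u n @[n --> \oo] --> +oo.
Proof.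
move=> c0 /cvgryPge H; apply/cvgryPge => A; apply: filterS (H (A / c)) => n.
by rewrite ler_pdivrMr // mulrC.
Qed.

Lemma ler_psum_lim (u : nat -> R) (l : R) (n : nat) : (forall i, 0 <= u i) ->
  series u @ \oo --> l -> \sum_(i < n) u i <= l.
Proof.
move=> u0 ul; rewrite -(big_mkord xpredT u).
apply: (cvgr_to_ge ul); near=> m.
have nm : (n <= m)%N by near: m; exact: nbhs_infty_ge.
by rewrite /series /= [leRHS](big_cat_nat _ nm) //= lerDl sumr_ge0.
Unshelve. all: by end_near. Qed.

Lemma cvg_psum (u : nat -> R) (l : R) (M : nat -> nat) :
  series u @ \oo --> l -> M @ \oo --> \oo ->
  \sum_(i < (M n).+1) u i @[n --> \oo] --> l.
Proof.
move=> ul Moo.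
have Moo' : (fun n => (M n).+1) @ \oo --> \oo.
  apply/cvgnyPge => A; move/cvgnyPge : Moo => /(_ A).
  by apply: filterS => n /leqW.
have H := cvg_comp _ _ Moo' ul.
by apply: cvgn_ext; [exact: H| |by []] => n /=; rewrite /series /= big_mkord.
Qed.

Lemma exists_truncation (u v : nat -> R) (lu lv : R) (k A : nat -> R) :
  series u @ \oo --> lu -> series v @ \oo --> lv ->
  exists M : nat -> nat, forall n, [/\ A n <= (M n)%:R,
    k n * `|\sum_(i < (M n).+1) u i - lu| <= n.+1%:R^-1 &
    k n * `|\sum_(i < (M n).+1) v i - lv| <= n.+1%:R^-1].
Proof.
move=> ul vl.
suff H n : exists M : nat, [/\ A n <= M%:R, k n * `|\sum_(i < M.+1) u i - lu| <= n.+1%:R^-1 &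
    k n * `|\sum_(i < M.+1) v i - lv| <= n.+1%:R^-1].
  by have [M HM] := choice H; exists M.
have idoo : (@id nat) @ \oo --> \oo by [].
have key (w : nat -> R) (l : R) : series w @ \oo --> l ->
    \forall M \near \oo, k n * `|\sum_(i < M.+1) w i - l| <= n.+1%:R^-1.
  move=> wl; have wl' := cvg_psum wl idoo.
  have H : k n * `|\sum_(i < M.+1) w i - l| @[M --> \oo] --> (0 : R).
    apply: (cvgnMl0 (k n)); have H := cvg_norm (cvgnB wl' (cvg_cst l)).
    by rewrite subrr normr0 in H; exact: H.
  by apply: (cvgr_le (0 : R)) => //; rewrite invr_gt0.
have HA : \forall M \near \oo, A n <= M%:R.
  have /cvgryPge/(_ (A n)) := @cvgr_idn R; exact.
near \oo => M; exists M; split; near: M => //; exact: key.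
Unshelve. all: by end_near. Qed.

End LawTruncation.

Section StableLocalLimit.
Variable R : realType.
Local Notation mu := (@lebesgue_measure R).

Definition stable_re (al : R) : R :=
  \int[mu]_(v in `]0, +oo[) ((cos v - 1) / v ^+ 2 * v `^ (- (al - 1))).

Definition stable_im (al : R) : R :=
  \int[mu]_(v in `]0, +oo[) ((sin v - v) / v ^+ 2 * v `^ (- (al - 1))).

(* Fourier inversion at 0 for the limiting stable law; the substitution in the two
   integrals above removes the scale of the jumps, so only [al] is left. *)
Definition stable_density0 (al : R) : R :=
  pi^-1 * \int[mu]_(u in `]0, +oo[)
    (expR (u `^ al * stable_re al) * cos (u `^ al * stable_im al)).

Lemma ge_Nsin (x : R) : 0 <= x -> - x <= sin x.
Proof.
move=> x0; rewrite -subr_ge0.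
have D (z : R) : is_derive z (1 : R) (fun x => sin x - - x) ((fun x => cos x + 1) z).
  by apply: is_derive_eq; rewrite /GRing.scale /=; lra.
apply: (ge0_of_derive D _ _ x0) => [|z z0]; first by rewrite sin0; lra.
by have := cos_geN1 z; lra.
Qed.

Variables (p : nat -> R) (al be mean : R).
Hypothesis p_ge0 : forall i, 0 <= p i.
Hypothesis p_sum1 : series p @ \oo --> (1 : R).
Hypothesis p_mean : series (fun m => m%:R * p m) @ \oo --> mean.
Hypotheses (al1 : 1 < al) (al2 : al < 2) (be0 : 0 < be).
Hypothesis p_tail : p m * m%:R `^ (1 + al) @[m --> \oo] --> be.

Lemma cvg_stable_sum (h : R -> R) (C : R) (t : nat -> R) (M : nat -> nat) :
  (forall x : R, 0 < x -> {for x, continuous h}) ->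
  (forall x : R, 0 < x -> `|h x| <= C / (1 + x)) ->
  (\forall n \near \oo, 0 < t n) -> t @ \oo --> (0 : R) ->
  (M n)%:R * t n @[n --> \oo] --> +oo ->
  t n `^ (2 - al) * \sum_(1 <= m < M n) m%:R ^+ 2 * p m * h (m%:R * t n) @[n --> \oo] -->
    be * \int[mu]_(x in `]0, +oo[) (h x * x `^ (- (al - 1))).
Proof.
move=> ch hC t0 tc Mt.
have -> : 2 - al = 1 - (al - 1) by ring.
have H : m%:R ^+ 2 * p m * m%:R `^ (al - 1) @[m --> \oo] --> be.
  apply: (cvgn_near p_tail); near=> m.
  have m0 : (0 : R) < m%:R by rewrite ltr0n; near: m; exact: nbhs_infty_gt.
  have -> : 1 + al = 2%:R + (al - 1) by ring.
  by rewrite [in LHS]powRD_gt0 // powR_mulrn ?(ltW m0) //; ring.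
have s0 : 0 < al - 1 by rewrite subr_gt0.
have s1 : al - 1 < 1 by rewrite ltrBlDr.
exact: (cvg_abelian_sum s0 s1 H ch hC t0 tc Mt).
Unshelve. all: by end_near. Qed.

Lemma stable_local_limit (N m : nat -> nat) (K : R) :
  ((N n)%:R : R) @[n --> \oo] --> +oo ->
  (\forall n \near \oo, `|(m n)%:R - (N n)%:R * mean| <= K) ->
  (be * (N n)%:R) `^ al^-1 * cpow p (N n) (m n) @[n --> \oo] --> stable_density0 al.
Proof.
move=> Noo mN.
pose a n : R := (be * (N n)%:R) `^ al^-1.
have al0 : 0 < al by rewrite (lt_trans ltr01).
have alV : 0 < al^-1 by rewrite invr_gt0.
have bN : be * (N n)%:R @[n --> \oo] --> +oo by exact: cvgnyMl.
have aoo : a @ \oo --> +oo by exact: (cvgny_powR alV bN).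
have a_gt0 : \forall n \near \oo, 0 < a n by exact: (cvgry_gt aoo).
have N_gt0 : \forall n \near \oo, (0 : R) < (N n)%:R by exact: (cvgry_gt Noo).
have [M HM] := exists_truncation (fun n => (N n)%:R) (fun n => Num.max (m n)%:R (n%:R * a n)) p_sum1 p_mean.
have mean0 : 0 <= mean.
  have := @ler_psum_lim R _ _ 0 _ p_mean; rewrite big_ord0; apply => i.
  by rewrite mulr_ge0.
have p_le1 n : \sum_(i < n) p i <= 1 by exact: ler_psum_lim.
have [k [c0 [k0 c00 Hk]]] := charf_stable p_ge0 p_le1 al1 al2 be0 p_tail.
have harm : (n.+1%:R^-1 : R) @[n --> \oo] --> (0 : R) by exact: cvg_harmonic.
have aN : \forall n \near \oo, a n `^ al = be * (N n)%:R.
  apply: filterS N_gt0 => n Nn; rewrite /a -powRrM mulVf ?gt_eqF // powRr1 //.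
  by rewrite mulr_ge0 // ltW.
have naM n : n%:R * a n <= (M n)%:R.
  by have [+ _ _] := HM n; rewrite ge_max => /andP[].
have mM n : (m n <= M n)%N.
  by have [+ _ _] := HM n; rewrite ge_max ler_nat => /andP[].
have caM : \forall n \near \oo, c0 * a n <= (M n)%:R.
  have : \forall n \near \oo, c0 <= n%:R by exact: (cvgry_ge (@cvgr_idn R)).
  apply: filterS2 a_gt0 => n an c0n; apply: le_trans (naM n).
  by rewrite ler_wpM2r // ltW.
have [c [D [c_gt0 dec]]] := charf_decay p_ge0 p_le1 (ltW al1) k0 be0 c00 Hk aoo aN caM.
pose f n := \poly_(i < (M n).+1) p i.
suff : a n * (f n ^+ N n)`_(m n) @[n --> \oo] -->
  pi^-1 * \int[mu]_(u in `]0, +oo[)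
      (expR (u `^ al * stable_re al + mean ^+ 2 * 0 / 2) * cos (u `^ al * stable_im al)).
  move=> H; apply: cvgn_ext; [exact: H|by move=> n; rewrite /f -(cpow_poly _ _ (mM n))|].
  rewrite /stable_density0; congr (_ * _); apply: eq_Rintegral => u _.
  by rewrite mulr0 mul0r addr0.
have tE u n : 0 < u -> 0 < a n -> 0 < (N n)%:R :> R -> a n `^ al = be * (N n)%:R ->
    (N n)%:R * (u / a n) `^ al = u `^ al / be.
  move=> u0 an Nn anE; rewrite powRM ?invr_ge0 ?(ltW u0) ?(ltW an) //.
  rewrite -[(a n)^-1]powR_inv1 ?(ltW an) // powRAC anE powR_inv1 ?mulr_ge0 ?(ltW be0) //.
  by field; rewrite !gt_eqF.
have t_cvg u : 0 < u -> u / a n @[n --> \oo] --> (0 : R).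
  by move=> u0; apply: (cvgnMl0 u); apply/gtr0_cvgV0.
have t_gt0 u : 0 < u -> \forall n \near \oo, 0 < u / a n.
  by move=> u0; apply: filterS a_gt0 => n an; rewrite divr_gt0.
have t_oo u : 0 < u -> (M n).+1%:R * (u / a n) @[n --> \oo] --> +oo.
  move=> u0; have un : u * n%:R @[n --> \oo] --> +oo by apply: cvgnyMl => //; exact: cvgr_idn.
  apply/cvgryPge => B.
  have uB : \forall n \near \oo, B <= u * n%:R by exact: (cvgry_ge un).
  apply: filterS2 a_gt0 uB => n an /le_trans; apply.
  rewrite mulrA ler_pdivlMr // mulrC mulrCA [leRHS]mulrC ler_wpM2l ?(ltW u0) //.
  by rewrite mulrC (le_trans (naM n)) // ler_nat.
have Nt u : 0 < u -> \forall n \near \oo, (N n)%:R * (u / a n) ^+ 2 = u `^ al / be * (u / a n) `^ (2 - al).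
  move=> u0; near=> n; have tn : 0 < u / a n by near: n; exact: t_gt0.
  rewrite -(tE u n) //; try by near: n.
  by rewrite -mulrA -powRD_gt0 // addrC subrK powR_mulrn // ltW.
have expand u (g h : R -> R) C : 0 < u -> g 0 = 0 -> (forall v, 0 < v -> g v = v ^+ 2 * h v) ->
    (forall x : R, 0 < x -> {for x, continuous h}) ->
    (forall x : R, 0 < x -> `|h x| <= C / (1 + x)) ->
    (N n)%:R * \sum_(i < (M n).+1) p i * g (i%:R * (u / a n)) @[n --> \oo] -->
    u `^ al * \int[mu]_(x in `]0, +oo[) (h x * x `^ (- (al - 1))).
  move=> u0 g0 gh ch hC.
  have H := cvgnMl (u `^ al / be) (cvg_stable_sum ch hC (t_gt0 u u0) (t_cvg u u0) (t_oo u u0)).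
  have -> : u `^ al * \int[mu]_(x in `]0, +oo[) (h x * x `^ (- (al - 1))) =
     u `^ al / be * (be * \int[mu]_(x in `]0, +oo[) (h x * x `^ (- (al - 1)))).
    by field; rewrite gt_eqF.
  apply: (cvgn_near H); near=> n.
  have tn : 0 < u / a n by near: n; exact: t_gt0.
  have Ntn : (N n)%:R * (u / a n) ^+ 2 = u `^ al / be * (u / a n) `^ (2 - al).
    by near: n; exact: Nt.
  rewrite mulrA -Ntn -mulrA; congr (_ * _).
  rewrite -(big_mkord xpredT (fun i => p i * g (i%:R * (u / a n)))) big_ltn // mul0r g0 mulr0 add0r.
  rewrite mulr_sumr !big_nat; apply: eq_bigr => i /andP[i1 _].
  by rewrite gh; [ring|rewrite mulr_gt0 // ltr0n].
have NP : (N n)%:R * (\sum_(i < (M n).+1) p i - 1) @[n --> \oo] --> (0 : R).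
  apply: (cvgn0_le _ harm); apply: nearW => n; have [_ + _] := HM n.
  by rewrite normrM (ger0_norm (ler0n _ _)).
have NQ : (N n)%:R * (\sum_(i < (M n).+1) i%:R * p i - mean) @[n --> \oo] --> (0 : R).
  apply: (cvgn0_le _ harm); apply: nearW => n; have [_ _] := HM n.
  by rewrite normrM (ger0_norm (ler0n _ _)).
have cV2 (x : R) : 0 < x -> {for x, continuous (fun y : R => (y ^+ 2)^-1)}.
  move=> x0; apply: cvgV; first by rewrite expf_neq0 // gt_eqF.
  exact: exprn_continuous.
apply: (cvg_local_limit mean0 aoo Noo mN _ c_gt0 dec (r1 := fun u => u `^ al * stable_re al)
   (r2 := fun u => u `^ al * stable_im al) (tau := fun=> 0)) => [n t|u u0|u u0|u u0].
- exact: normc_charf_le1.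
- have H := expand u (fun v => cos v - 1) (fun v => (cos v - 1) / v ^+ 2) (3 / 2) u0.
  have H' : (N n)%:R * \sum_(i < (M n).+1) p i * (cos (i%:R * (u / a n)) - 1) @[n --> \oo] -->
      u `^ al * stable_re al.
    apply: H => [|v v0|x x0|x x0].
    + by rewrite cos0 subrr.
    + by field; rewrite gt_eqF.
    + apply: cvgM; last exact: cV2.
      by apply: cvgB; [exact: continuous_cos|exact: cvg_cst].
    + have h1 := le_1Bcos (ltW x0); have h2 := le_1Bcos_sqr (ltW x0); have h3 := cos_le1 x.
      rewrite normrM ler0_norm ?subr_le0 // opprB ger0_norm ?invr_ge0 ?sqr_ge0 //.
      rewrite ler_pdivrMr ?exprn_gt0 // mulrAC ler_pdivlMr ?addr_gt0 //.
      by nra.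
  apply: cvgn_ext; [exact: (cvgnD NP H')| |by rewrite add0r] => n /=.
  rewrite Re_charf -mulrDr; congr (_ * _).
  have -> : \sum_(i < (M n).+1) p i * (cos (i%:R * (u / a n)) - 1) =
      \sum_(i < (M n).+1) p i * cos (i%:R * (u / a n)) - \sum_(i < (M n).+1) p i.
    by rewrite -sumrB; apply: eq_bigr => i _; rewrite mulrBr mulr1.
  by ring.
- have H := expand u (fun v => sin v - v) (fun v => (sin v - v) / v ^+ 2) (5 / 2) u0.
  have H' : (N n)%:R * \sum_(i < (M n).+1) p i * (sin (i%:R * (u / a n)) - i%:R * (u / a n)) @[n --> \oo] -->
      u `^ al * stable_im al.
    apply: H => [|v v0|x x0|x x0].
    + by rewrite sin0 subrr.
    + by field; rewrite gt_eqF.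
    + apply: cvgM; last exact: cV2.
      by apply: cvgB; [exact: continuous_sin|exact: cvg_id].
    + have h1 := ge_sin (ltW x0); have h2 := le_Bsin_sqr (ltW x0); have h3 := ge_Nsin (ltW x0).
      rewrite normrM ler0_norm ?subr_le0 // opprB ger0_norm ?invr_ge0 ?sqr_ge0 //.
      rewrite ler_pdivrMr ?exprn_gt0 // mulrAC ler_pdivlMr ?addr_gt0 //.
      by nra.
  have NQt := cvgnM NQ (t_cvg u u0); rewrite mul0r in NQt.
  apply: cvgn_ext; [exact: (cvgnD NQt H')| |by rewrite add0r] => n /=.
  rewrite Im_charf -mulrA -mulrDr; congr (_ * _).
  have -> : \sum_(i < (M n).+1) p i * (sin (i%:R * (u / a n)) - i%:R * (u / a n)) =
      \sum_(i < (M n).+1) p i * sin (i%:R * (u / a n)) - (\sum_(i < (M n).+1) i%:R * p i) * (u / a n).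
    by rewrite mulr_suml -sumrB; apply: eq_bigr => i _; ring.
  by ring.
- have c2 : 0 < 2 - al by rewrite subr_gt0.
  have H := cvgnMl0 (u `^ al / be) (cvgn0_powR c2 (t_gt0 u u0) (t_cvg u u0)).
  apply: (cvgn_near H); have := Nt u u0; exact: filterS.
Unshelve. all: by end_near. Qed.

End StableLocalLimit.

(** * The Gaussian local limit theorem *)

Section GaussianLocalLimit.
Variable R : realType.
Local Notation mu := (@lebesgue_measure R).

Lemma gauss_density0 (s2 : R) : 0 < s2 ->
  pi^-1 * \int[mu]_(u in `]0, +oo[) expR (- (s2 * u ^+ 2 / 2)) =
  (2 * pi * s2) `^ (- 2^-1).
Proof.
move=> s20; pose s := Num.sqrt s2^-1.
have s0 : 0 < s by rewrite sqrtr_gt0 invr_gt0.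
have sE : s ^+ 2 = s2^-1 by rewrite sqr_sqrtr // invr_ge0 ltW.
have pdfE x : normal_pdf 0 s x = normal_peak s * expR (- (s2 * x ^+ 2 / 2)).
  rewrite normal_pdfE ?gt_eqF // /normal_fun subr0 sE; congr (_ * expR _).
  by rewrite -mulr_natr; field; rewrite gt_eqF.
have cpdf : continuous (normal_pdf 0 s).
  rewrite (_ : normal_pdf 0 s = fun x => normal_peak s * expR (- (s2 * x ^+ 2 / 2))); last exact/funext.
  move=> x; apply: cvgMl_tmp; apply: continuous_comp; last exact: continuous_expR.
  apply/differentiable_continuous/derivable1_diffP.
  apply: (@ex_derive _ _ _ _ _ _ (- (s2 * x))).
  by apply: is_derive_eq; rewrite /GRing.scale /=; field.
have := @ge0_symfun_integralT R (normal_pdf 0 s) (normal_pdf_ge0 0 s) cpdf.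
rewrite integral_normal_pdf => /(_ _)/esym.
have even : normal_pdf 0 s =1 normal_pdf 0 s \o -%R.
  by move=> x /=; rewrite !pdfE sqrrN.
move=> /(_ even); rewrite -set_itvcy.
rewrite -integral_itv_obnd_cbnd; last first.
  by apply/measurable_EFinP; apply: measurable_funTS; exact: continuous_measurable_fun.
have iE : mu.-integrable `]0, +oo[ (EFin \o (fun u => expR (- (s2 * u ^+ 2 / 2)))).
  have i1 := @integrableS _ _ _ mu setT `]0, +oo[%classic _ measurableT (measurable_itv _) (@subsetT _ _) (integrable_normal_pdf 0 s).
  have := @integrableZl _ _ _ mu `]0, +oo[%classic (measurable_itv _) (normal_peak s)^-1 _ i1.
  apply: eq_integrable => //= x _; rewrite pdfE -EFinM mulKf // gt_eqF // normal_peak_gt0 //.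
  by rewrite gt_eqF.
under eq_integral do rewrite pdfE EFinM.
rewrite integralZl //.
rewrite -[X in (_ * (_ * X))%E]fineK; last exact: integrable_fin_num.
rewrite -!EFinM => -[]; rewrite -/(Rintegral _ _ _).
set I := Rintegral _ _ _ => HI.
have -> : I = (2 * normal_peak s)^-1.
  apply: (mulfI (x := 2 * normal_peak s)).
    by rewrite mulf_neq0 // gt_eqF // normal_peak_gt0 // gt_eqF.
  by rewrite -mulrA HI divff // mulf_neq0 // gt_eqF // normal_peak_gt0 // gt_eqF.
rewrite powRN powR12_sqrt ?mulr_ge0 ?pi_ge0 ?(ltW s20) //.
rewrite /normal_peak sE invfM invrK.
have p0 := pi_gt0 R.
set A := Num.sqrt _; set B := Num.sqrt _.
have B0 : 0 < B by rewrite sqrtr_gt0 !mulr_gt0.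
have AB : A * B = 2 * pi.
  rewrite /A /B -sqrtrM; last by rewrite mulrn_wge0 // mulr_ge0 ?invr_ge0 ?(ltW s20) ?(ltW p0).
  have -> : s2^-1 * pi *+ 2 * (2 * pi * s2) = (2 * pi) ^+ 2.
    by rewrite mulr2n; field; rewrite gt_eqF.
  by rewrite sqrtr_sqr ger0_norm // mulr_ge0 // ltW.
apply: (mulIf (x := B)); first by rewrite gt_eqF.
rewrite mulVf ?gt_eqF // -!mulrA AB.
by clear -p0; move: (pi : R) p0 => q q0; field; exact: lt0r_neq0.
Qed.

Variables (p : nat -> R) (mean m2 m3 s2 : R).
Hypothesis p_ge0 : forall i, 0 <= p i.
Hypothesis p_sum1 : series p @ \oo --> (1 : R).
Hypothesis p_mean : series (fun m => m%:R * p m) @ \oo --> mean.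
Hypothesis p_m2 : series (fun m => m%:R ^+ 2 * p m) @ \oo --> m2.
Hypothesis p_m3 : series (fun m => m%:R ^+ 3 * p m) @ \oo --> m3.

Lemma gaussian_local_limit (N m : nat -> nat) (K : R) (j : nat) :
  0 < m2 - mean ^+ 2 -> 0 < p j -> 0 < p j.+1 ->
  ((N n)%:R : R) @[n --> \oo] --> +oo ->
  (\forall n \near \oo, `|(m n)%:R - (N n)%:R * mean| <= K) ->
  (N n)%:R `^ 2^-1 * cpow p (N n) (m n) @[n --> \oo] -->
    (2 * pi * (m2 - mean ^+ 2)) `^ (- 2^-1).
Proof.
move=> var0 pj pj1 Noo mN.
pose a n : R := (N n)%:R `^ 2^-1.
have h0 : (0 : R) < 2^-1 by rewrite invr_gt0.
have aoo : a @ \oo --> +oo by exact: (cvgny_powR h0 Noo).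
have a_gt0 : \forall n \near \oo, 0 < a n by exact: (cvgry_gt aoo).
have [M HM] := exists_truncation (fun n => (N n)%:R) (fun n => Num.max (m n)%:R (n%:R * a n)) p_sum1 p_mean.
have mean0 : 0 <= mean.
  have := @ler_psum_lim R _ _ 0 _ p_mean; rewrite big_ord0; apply => i.
  by rewrite mulr_ge0.
have p_le1 n : \sum_(i < n) p i <= 1 by exact: ler_psum_lim.
have [k [c0 [k0 c00 Hk]]] := charf_quadratic p_ge0 p_le1 pj pj1.
have Hk' (n : nat) t : 0 < t -> t <= pi -> c0 <= n%:R -> c0 <= n%:R * t ->
     normc (charf (\poly_(i < n.+1) p i) t) ^+ 2 <= 1 - k * t `^ 2.
  by move=> t0 tpi c0n _; rewrite powR_mulrn ?(ltW t0) //; exact: Hk.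
have harm : (n.+1%:R^-1 : R) @[n --> \oo] --> (0 : R) by exact: cvg_harmonic.
have a2 n : a n ^+ 2 = (N n)%:R.
  by rewrite -powR_mulrn ?powR_ge0 // /a -powRrM mulVf // powRr1.
have aN : \forall n \near \oo, a n `^ 2 = 1 * (N n)%:R.
  by apply: nearW => n; rewrite mul1r powR_mulrn ?powR_ge0 ?a2.
have naM n : n%:R * a n <= (M n)%:R.
  by have [+ _ _] := HM n; rewrite ge_max => /andP[].
have mM n : (m n <= M n)%N.
  by have [+ _ _] := HM n; rewrite ge_max ler_nat => /andP[].
have caM : \forall n \near \oo, c0 * a n <= (M n)%:R.
  have : \forall n \near \oo, c0 <= n%:R by exact: (cvgry_ge (@cvgr_idn R)).
  apply: filterS2 a_gt0 => n an c0n; apply: le_trans (naM n).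
  by rewrite ler_wpM2r // ltW.
have Moo : M @ \oo --> \oo.
  apply/cvgnyPge => B.
  have a1 : \forall n \near \oo, 1 <= a n by exact: (cvgry_ge aoo).
  have nB : \forall n \near \oo, (B <= n)%N by exact: nbhs_infty_ge.
  apply: filterS2 a1 nB => n an nB; rewrite -(ler_nat R); apply: le_trans (naM n).
  by rewrite (@le_trans _ _ n%:R) ?ler_nat // ler_peMr.
have two1 : (1 : R) <= 2 by rewrite ler1n.
have [c [D [c_gt0 dec]]] := charf_decay p_ge0 p_le1 two1 k0 ltr01 c00 Hk' aoo aN caM.
pose f n := \poly_(i < (M n).+1) p i.
suff : a n * (f n ^+ N n)`_(m n) @[n --> \oo] -->
  pi^-1 * \int[mu]_(u in `]0, +oo[)
      (expR (- (u ^+ 2 * m2 / 2) + mean ^+ 2 * u ^+ 2 / 2) * cos ((fun=> 0) u)).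
  move=> H; apply: cvgn_ext; [exact: H|by move=> n; rewrite /f -(cpow_poly _ _ (mM n))|].
  rewrite -gauss_density0 //; congr (_ * _); apply: eq_Rintegral => u _.
  by rewrite cos0 mulr1; congr expR; ring.
have t_cvg (u : R) : 0 < u -> u / a n @[n --> \oo] --> (0 : R).
  by move=> u0; apply: (cvgnMl0 u); apply/gtr0_cvgV0.
have Nt (u : R) : \forall n \near \oo, (N n)%:R * (u / a n) ^+ 2 = u ^+ 2.
  by apply: filterS a_gt0 => n an; rewrite -a2; field; rewrite gt_eqF.
have err (u : R) : 0 < u -> (N n)%:R * (u / a n) ^+ 3 * m3 / 6 @[n --> \oo] --> (0 : R).
  move=> u0; have H := cvgnMr0 (m3 / 6) (cvgnMl0 (u ^+ 2) (t_cvg u u0)).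
  apply: (cvgn_near H); apply: filterS (Nt u) => n <-; rewrite exprS; ring.
have sum3 n (t : R) : 0 <= t -> \sum_(i < (M n).+1) p i * ((i%:R * t) ^+ 3 / 6) <= t ^+ 3 * m3 / 6.
  move=> t0.
  have -> : \sum_(i < (M n).+1) p i * ((i%:R * t) ^+ 3 / 6) = t ^+ 3 / 6 * \sum_(i < (M n).+1) i%:R ^+ 3 * p i.
    by rewrite mulr_sumr; apply: eq_bigr => i _; ring.
  rewrite [leRHS]mulrAC ler_wpM2l ?divr_ge0 ?exprn_ge0 //.
  by apply: (@ler_psum_lim R _ _ _ _ p_m3) => i; rewrite mulr_ge0 ?exprn_ge0.
have NP : (N n)%:R * (\sum_(i < (M n).+1) p i - 1) @[n --> \oo] --> (0 : R).
  apply: (cvgn0_le _ harm); apply: nearW => n; have [_ + _] := HM n.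
  by rewrite normrM (ger0_norm (ler0n _ _)).
have NQ : (N n)%:R * (\sum_(i < (M n).+1) i%:R * p i - mean) @[n --> \oo] --> (0 : R).
  apply: (cvgn0_le _ harm); apply: nearW => n; have [_ _] := HM n.
  by rewrite normrM (ger0_norm (ler0n _ _)).
apply: (cvg_local_limit mean0 aoo Noo mN _ c_gt0 dec (r1 := fun u => - (u ^+ 2 * m2 / 2))
   (r2 := fun=> 0) (tau := fun u => u ^+ 2)) => [n t|u u0|u u0|u u0].
- exact: normc_charf_le1.
- have H1 : (N n)%:R * \sum_(i < (M n).+1) p i * (cos (i%:R * (u / a n)) - 1 + (i%:R * (u / a n)) ^+ 2 / 2)
      @[n --> \oo] --> (0 : R).
    apply: (cvgn0_le _ (err u u0)); apply: filterS a_gt0 => n an.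
    have t0 : 0 <= u / a n by rewrite divr_ge0 // ltW.
    rewrite normrM (ger0_norm (ler0n _ _)) [leRHS](_ : _ = (N n)%:R * ((u / a n) ^+ 3 * m3 / 6)); last by ring.
    rewrite ler_wpM2l //.
    rewrite ger0_norm; last first.
      apply: sumr_ge0 => i _; rewrite mulr_ge0 //.
      have := @le_1Bcos_sqr R (i%:R * (u / a n)); rewrite mulr_ge0 // => /(_ erefl); lra.
    apply: le_trans (sum3 n _ t0); apply: ler_sum => i _; rewrite ler_wpM2l //.
    by apply: le_cos_cube; rewrite mulr_ge0.
  have H2 : (N n)%:R * (u / a n) ^+ 2 * (\sum_(i < (M n).+1) i%:R ^+ 2 * p i) / 2 @[n --> \oo] --> u ^+ 2 * m2 / 2.
    apply: cvgnMr; have H := cvgnMl (u ^+ 2) (cvg_psum p_m2 Moo).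
    by apply: (cvgn_near H); apply: filterS (Nt u) => n <-.
  apply: cvgn_ext; [exact: (cvgnD NP (cvgnB H1 H2))| |by rewrite sub0r add0r] => n /=.
  rewrite Re_charf.
  have -> : \sum_(i < (M n).+1) p i * (cos (i%:R * (u / a n)) - 1 + (i%:R * (u / a n)) ^+ 2 / 2) =
      \sum_(i < (M n).+1) p i * cos (i%:R * (u / a n)) - \sum_(i < (M n).+1) p i +
      (u / a n) ^+ 2 / 2 * \sum_(i < (M n).+1) i%:R ^+ 2 * p i.
    by rewrite mulr_sumr -sumrB -big_split; apply: eq_bigr => i _ /=; ring.
  by ring.
- have H1 : (N n)%:R * \sum_(i < (M n).+1) p i * (i%:R * (u / a n) - sin (i%:R * (u / a n)))
      @[n --> \oo] --> (0 : R).
    apply: (cvgn0_le _ (err u u0)); apply: filterS a_gt0 => n an.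
    have t0 : 0 <= u / a n by rewrite divr_ge0 // ltW.
    rewrite normrM (ger0_norm (ler0n _ _)) [leRHS](_ : _ = (N n)%:R * ((u / a n) ^+ 3 * m3 / 6)); last by ring.
    rewrite ler_wpM2l //.
    rewrite ger0_norm; last first.
      apply: sumr_ge0 => i _; rewrite mulr_ge0 //.
      by rewrite subr_ge0 ge_sin // mulr_ge0.
    apply: le_trans (sum3 n _ t0); apply: ler_sum => i _; rewrite ler_wpM2l //.
    by apply: le_sin_cube; rewrite mulr_ge0.
  have NQt := cvgnM NQ (t_cvg u u0); rewrite mul0r in NQt.
  apply: cvgn_ext; [exact: (cvgnB NQt H1)| |by rewrite subr0] => n /=.
  rewrite Im_charf.
  have -> : \sum_(i < (M n).+1) p i * (i%:R * (u / a n) - sin (i%:R * (u / a n))) =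
      (\sum_(i < (M n).+1) i%:R * p i) * (u / a n) - \sum_(i < (M n).+1) p i * sin (i%:R * (u / a n)).
    by rewrite mulr_suml -sumrB; apply: eq_bigr => i _ /=; ring.
  by ring.
- by apply: cvg_near_cst; exact: Nt.
Qed.

End GaussianLocalLimit.

(** * The constant of the stable local limit theorem *)

Section MeanOneWalk.
Variable R : realType.
Variable p : nat -> R.
Hypothesis p_ge0 : forall i, 0 <= p i.
Hypothesis p_sum1 : series p @ \oo --> (1 : R).

Lemma cpow_ge0 N n : 0 <= cpow p N n.
Proof.
elim: N n => [|N IHN] n /=; first by rewrite ler0n.
by apply: sumr_ge0 => m _; rewrite mulr_ge0.
Qed.

Lemma cpow_le1 N n : cpow p N n <= 1.
Proof.
elim: N n => [|N IHN] n /=; first by case: eqP.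
apply: le_trans (ler_psum_lim n.+1 p_ge0 p_sum1).
by apply: ler_sum => m _; rewrite ler_piMr.
Qed.

Lemma cpow_deriv N n :
  n%:R * cpow p N.+1 n = N.+1%:R * \sum_(m < n.+1) m%:R * p m * cpow p N (n - m).
Proof.
case: n => [|n].
  by rewrite big_ord_recl big_ord0 /= !mul0r addr0 mulr0.
pose P := \poly_(i < n.+2) p i.
have H : ((P ^+ N.+1)^`())`_n = (N.+1%:R * (P^`() * P ^+ N))`_n.
  by rewrite deriv_exp /= mulr_natl.
rewrite mulr_natl; move: H; rewrite coef_deriv -(cpow_poly _ _ (leqnn n.+1)) => ->.
rewrite -[_%:R in LHS]polyC_natr coefCM; congr (_ * _).
rewrite big_ord_recl mul0r mul0r add0r coefM; apply: eq_bigr => m _.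
rewrite coef_deriv coef_poly !lift0 ltnS ltn_ord subSS mulr_natl.
by rewrite -(cpow_poly _ _ (leq_trans (leq_subr _ _) (leqnSn n))).
Qed.

Lemma cvg_series_exchange (w c : nat -> R) (g : nat -> nat -> R) (S : nat -> R)
    (gam : nat -> R) (W Cs L : R) :
  (forall N, 0 <= w N) -> (forall m, 0 <= c m) ->
  series w @ \oo --> W -> series c @ \oo --> Cs ->
  (forall N m, 0 <= g N m <= 1) ->
  (forall N, exists M0, forall M, (M0 <= M)%N -> S N = \sum_(m < M) c m * g N m) ->
  (forall m, series (fun N => w N * g N m) @ \oo --> gam m) ->
  series (fun N => w N * S N) @ \oo --> L ->
  series (fun m => c m * gam m) @ \oo --> L.
Proof.
move=> w0 c0 wW cC g01 HS Hg HL.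
have g0 N m : 0 <= g N m by have /andP[] := g01 N m.
have cg1 N m : c m * g N m <= c m by have /andP[_ ?] := g01 N m; rewrite ler_piMr.
have bnd N M : 0 <= S N - \sum_(m < M) c m * g N m <= Cs - \sum_(m < M) c m.
  have [M0 HM0] := HS N; rewrite (HM0 (maxn M M0) (leq_maxr _ _)).
  have MM : (M <= maxn M M0)%N by rewrite leq_maxl.
  have -> : \sum_(m < maxn M M0) c m * g N m - \sum_(m < M) c m * g N m =
      \sum_(M <= m < maxn M M0) c m * g N m.
    rewrite -!(big_mkord xpredT (fun m => c m * g N m)).
    apply/eqP; rewrite subr_eq addrC; apply/eqP.
    exact: (big_cat_nat _ MM).
  rewrite sumr_ge0 /=; last by move=> m _; rewrite mulr_ge0.
  rewrite lerBrDr; apply: le_trans (ler_psum_lim (maxn M M0) c0 cC).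
  have -> : \sum_(m < maxn M M0) c m = \sum_(m < M) c m + \sum_(M <= m < maxn M M0) c m.
    by rewrite -!(big_mkord xpredT c); exact: (big_cat_nat _ MM).
  by rewrite addrC lerD2l; apply: ler_sum => m _.
have part M : series (fun N => w N * (S N - \sum_(m < M) c m * g N m)) @ \oo -->
    L - \sum_(m < M) c m * gam m.
  have H : (\sum_(m < M) c m * series (fun N => w N * g N m) k) @[k --> \oo] -->
      \sum_(m < M) c m * gam m.
    by apply: cvg_big => [|m _]; [exact: add_continuous|apply: cvgnMl; exact: Hg].
  apply: cvgn_ext; [exact: (cvgnB HL H)| |by []] => k /=.
  rewrite /series /=.
  under [X in _ - X]eq_bigr do rewrite mulr_sumr.
  rewrite exchange_big /= -sumrB; apply: eq_bigr => N _.
  by rewrite mulrBr mulr_sumr; congr (_ - _); apply: eq_bigr => m _; ring.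
have tail0 : W * (Cs - \sum_(0 <= m < M) c m) @[M --> \oo] --> (0 : R).
  by apply: cvgnMl0; have := cvgnB (cvg_cst Cs) cC; rewrite subrr; exact.
have : \sum_(0 <= m < M) c m * gam m - L @[M --> \oo] --> (0 : R).
  apply: (cvgn0_le _ tail0); apply: nearW => M; rewrite !big_mkord distrC.
  have b0 : 0 <= L - \sum_(m < M) c m * gam m.
    apply: (cvgr_to_ge (part M)); apply: nearW => k; apply: sumr_ge0 => N _.
    by rewrite mulr_ge0 //; have /andP[] := bnd N M.
  rewrite ger0_norm //; apply: (cvgr_to_le (part M)); apply: nearW => k.
  have tM : 0 <= Cs - \sum_(m < M) c m by rewrite subr_ge0 ler_psum_lim.
  apply: (@le_trans _ _ ((\sum_(i < k) w i) * (Cs - \sum_(m < M) c m))).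
    rewrite /series /= big_mkord mulr_suml; apply: ler_sum => N _.
    by rewrite ler_wpM2l //; have /andP[] := bnd N M.
  by rewrite ler_wpM2r // ler_psum_lim.
by move=> /subr_cvg0.
Qed.

Hypothesis p_mean1 : series (fun m => m%:R * p m) @ \oo --> (1 : R).

(* [walk N k] is the probability that the walk with steps X - 1 sits at -k after N steps. *)
Let walk (N k : nat) : R := if (k <= N)%N then cpow p N (N - k) else 0.

Variables (T f f1 z : R).
Hypotheses (T_gt0 : 0 < T) (T_lt1 : T < 1).
Hypothesis p_f : series (fun m => p m * T ^+ m) @ \oo --> f.
Hypothesis p_f1 : series (fun m => m%:R * p m * T ^+ m) @ \oo --> f1.
Hypothesis f_gt : T < f.
Hypothesis zE : z = T / f.

Let f_gt0 : 0 < f. Proof. exact: lt_trans f_gt. Qed.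
Let z_gt0 : 0 < z. Proof. by rewrite zE divr_gt0. Qed.
Let z_lt1 : z < 1. Proof. by rewrite zE ltr_pdivrMr // mul1r. Qed.
Let walk01 N k : 0 <= walk N k <= 1.
Proof. by rewrite /walk; case: ifP => _; rewrite ?cpow_ge0 ?cpow_le1 ?lexx ?ler01. Qed.

Let geo : series (fun N => z ^+ N) @ \oo --> (1 - z)^-1.
Proof.
have z1 : `|z| < 1 by rewrite gtr0_norm.
have := @cvg_geometric_series R 1 z z1; rewrite mul1r; apply: cvg_trans.
by apply: near_eq_cvg; apply: nearW => n; rewrite /series /=; apply: eq_bigr => i _; rewrite mul1r.
Qed.

Let cvg_walk (u : nat -> R) : (forall N, 0 <= u N <= 1) ->
  cvgn (series (fun N => z ^+ N * u N)).
Proof.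
move=> u01; apply: (@series_le_cvg _ _ (fun N => z ^+ N)).
- by move=> N; have /andP[? _] := u01 N; rewrite mulr_ge0 ?exprn_ge0 ?(ltW z_gt0).
- by move=> N; rewrite exprn_ge0 ?(ltW z_gt0).
- by move=> N; have /andP[_ ?] := u01 N; rewrite ler_piMr ?exprn_ge0 ?(ltW z_gt0).
- by apply/cvg_ex; exists (1 - z)^-1; exact: geo.
Qed.

Let gam (k : nat) : R := limn (series (fun N => z ^+ N * walk N k)).

Let gamP k : series (fun N => z ^+ N * walk N k) @ \oo --> gam k.
Proof. exact: (cvg_walk (walk01 ^~ k)). Qed.

Let gam_ge0 k : 0 <= gam k.
Proof.
move: (@gamP k); move: (gam k) => l gl; apply: (cvgr_to_ge gl); apply: nearW => n; apply: sumr_ge0 => N _.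
by have /andP[? _] := walk01 N k; rewrite mulr_ge0 ?exprn_ge0 ?(ltW z_gt0).
Qed.

Let gam_le k : gam k <= (1 - z)^-1.
Proof.
move: (@gamP k); move: (gam k) => l gl; apply: (cvgr_to_le gl); apply: nearW => n.
rewrite /series /= big_mkord.
apply: le_trans (ler_psum_lim n (fun N => exprn_ge0 N (ltW z_gt0)) geo).
by apply: ler_sum => N _; have /andP[_ ?] := walk01 N k; rewrite ler_piMr ?exprn_ge0 ?(ltW z_gt0).
Qed.

Let walk_shift k : series (fun N => z ^+ N * walk N.+1 k) @ \oo --> (gam k - walk 0 k) / z.
Proof.
have H : series (fun N => z ^+ N.+1 * walk N.+1 k) @ \oo --> gam k - walk 0 k.
  have H : series (fun N => z ^+ N * walk N k) n.+1 @[n --> \oo] --> gam k.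
    by rewrite cvg_shiftS; exact: (@gamP k).
  apply: cvgn_ext; [exact: (cvgnB H (cvg_cst (walk 0 k)))| |by []] => n.
  by rewrite /series /= big_nat_recl // expr0 mul1r addrC addKr.
apply: cvgn_ext; [exact: (cvgnMr z^-1 H)| |by []] => n.
rewrite /series /= mulr_suml; apply: eq_bigr => N _.
by rewrite exprS; field; rewrite gt_eqF.
Qed.

Let gam_rec k : series (fun m => p m * gam (k + m)) @ \oo --> gam k.+1 / z.
Proof.
have := @walk_shift k.+1; rewrite {1}/walk /= subr0 => HL.
apply: (@cvg_series_exchange (fun N => z ^+ N) p (fun N m => walk N (k + m)) (fun N => walk N.+1 k.+1)) geo p_sum1 _ _ _ HL => //.
- by move=> N; rewrite exprn_ge0 ?(ltW z_gt0).
- move=> N; exists N.+1 => M NM; rewrite /walk ltnS subSS.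
  case: leqP => kN; last first.
    by rewrite big1 // => m _; rewrite leqNgt (leq_trans kN) ?leq_addr //= mulr0.
  rewrite /= -[RHS](big_mkord xpredT (fun m => p m * (if (k + m <= N)%N then cpow p N (N - (k + m)) else 0))).
  rewrite -(big_mkord xpredT (fun m => p m * cpow p N (N - k - m))).
  have NkM : ((N - k).+1 <= M)%N by rewrite (leq_trans _ NM) // ltnS leq_subr.
  rewrite [RHS](big_cat_nat _ NkM) //= [X in _ + X]big_nat [X in _ + X]big1 ?addr0; last first.
    by move=> m /andP[Nkm _]; rewrite leqNgt -ltn_subLR // Nkm /= mulr0.
  rewrite !big_nat; apply: eq_bigr => m /andP[_ mNk].
  by rewrite -leq_subRL // -ltnS mNk subnDA.
Qed.

Let dev k := gam k - T ^+ k * gam 0.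

Let dev_bound j k : `|dev k| <= (2 / (1 - z)) * z ^+ j.
Proof.
elim: j k => [|j IHj] k.
  rewrite expr0 mulr1 mulrDl mul1r (le_trans (ler_normB _ _)) // lerD //.
    by rewrite ger0_norm ?gam_ge0 ?gam_le.
  rewrite ger0_norm ?mulr_ge0 ?gam_ge0 ?exprn_ge0 ?(ltW T_gt0) //.
  rewrite -[leRHS]mul1r ler_pM ?gam_ge0 ?exprn_ge0 ?(ltW T_gt0) ?gam_le //.
  by rewrite exprn_ile1 ?(ltW T_gt0) ?(ltW T_lt1).
case: k => [|k].
  rewrite /dev expr0 mul1r subrr normr0 !mulr_ge0 ?invr_ge0 ?exprn_ge0 ?subr_ge0 ?(ltW z_gt0) //.
  exact: ltW.
have H : series (fun m => p m * dev (k + m)) @ \oo --> dev k.+1 / z.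
  have H2 := cvgnMr (T ^+ k * gam 0) p_f.
  apply: cvgn_ext; [exact: (cvgnB (@gam_rec k) H2)| |].
    move=> n /=; rewrite /series /= mulr_suml -sumrB; apply: eq_bigr => m _.
    by rewrite /dev exprD; ring.
  by rewrite /dev exprS zE; field; rewrite !gt_eqF.
have : `|dev k.+1 / z| <= 2 / (1 - z) * z ^+ j.
  have Hn : `|series (fun m => p m * dev (k + m)) n| @[n --> \oo] --> `|dev k.+1 / z|.
    exact: cvg_norm H.
  apply: (cvgr_to_le Hn); apply: nearW => n /=.
  rewrite /series /= (le_trans (ler_norm_sum _ _ _)) //.
  apply: (@le_trans _ _ (\sum_(0 <= m < n) p m * (2 / (1 - z) * z ^+ j))).
    by apply: ler_sum => m _; rewrite normrM (ger0_norm (p_ge0 _)) ler_wpM2l.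
  rewrite -mulr_suml big_mkord ler_piMl //; last exact: ler_psum_lim.
  by rewrite !mulr_ge0 ?invr_ge0 ?exprn_ge0 ?subr_ge0 ?(ltW z_gt0) // ltW.
rewrite normrM normfV (gtr0_norm z_gt0) ler_pdivrMr // => /le_trans; apply.
by rewrite exprSr mulrA.
Qed.

Let gamE k : gam k = T ^+ k * gam 0.
Proof.
apply/eqP; rewrite -subr_eq0 -/(dev k) -normr_le0.
have z1 : `|z| < 1 by rewrite gtr0_norm.
have H := cvgnMl0 (2 / (1 - z)) (cvg_expr z1).
by apply: (cvgr_to_ge H); apply: nearW => j; exact: dev_bound.
Qed.

(* With X * (P^N)' = N X P' P^(N-1), the return probabilities are expressed by the Green function [gam] at nonpositive levels. *)
Lemma return_generating_function :
  exists2 G : R, series (fun N => cpow p N N * z ^+ N) @ \oo --> G & G * (f - f1) = f.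
Proof.
exists (gam 0).
  apply: cvgn_ext; [exact: (@gamP 0)| |by []] => n; rewrite /series /=.
  by apply: eq_bigr => N _; rewrite /walk /= subn0 mulrC.
have := @walk_shift 0; rewrite {1}/walk /= => HL.
have Hm : series (fun m => m.+1%:R * p m.+1) @ \oo --> (1 : R).
  have H : series (fun m => m%:R * p m) n.+1 @[n --> \oo] --> (1 : R) by rewrite cvg_shiftS.
  apply: cvgn_ext; [exact: H| |by []] => n.
  by rewrite /series /= big_nat_recl // mul0r add0r.
have H : series (fun m => (m.+1%:R * p m.+1) * gam m) @ \oo --> (gam 0 - 1) / z.
  apply: (@cvg_series_exchange (fun N => z ^+ N) (fun m => m.+1%:R * p m.+1) walk (fun N => walk N.+1 0)) geo Hm _ _ _ HL => //.
  - by move=> N; rewrite exprn_ge0 ?(ltW z_gt0).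
  - by move=> m; rewrite mulr_ge0.
  - move=> N; exists N.+1 => M NM; rewrite {1}/walk subn0.
    have N0 : N.+1%:R != 0 :> R by rewrite pnatr_eq0.
    apply: (mulfI N0); rewrite [LHS]cpow_deriv big_ord_recl !mul0r add0r; congr (_ * _).
    rewrite -[RHS](big_mkord xpredT (fun m => m.+1%:R * p m.+1 * walk N m)).
    rewrite [RHS](big_cat_nat _ NM) //= [X in _ + X]big_nat [X in _ + X]big1 ?addr0; last first.
      by move=> m /andP[Nm _]; rewrite /walk leqNgt Nm /= mulr0.
    rewrite big_mkord; apply: eq_bigr => m _.
    by rewrite /walk -ltnS ltn_ord.
have H' : series (fun m => (m.+1%:R * p m.+1) * gam m) @ \oo --> f1 / T * gam 0.
  have H1 : series (fun m => m%:R * p m * T ^+ m) n.+1 @[n --> \oo] --> f1 by rewrite cvg_shiftS.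
  apply: cvgn_ext; [exact: (cvgnMr (gam 0) (cvgnMr T^-1 H1))| |by []] => n.
  rewrite /series /= big_nat_recl // !mul0r add0r !mulr_suml; apply: eq_bigr => m _.
  by rewrite [gam m]gamE exprS; field; rewrite gt_eqF.
have := cvg_unique _ H H'; rewrite zE => E.
have E' : gam 0 - 1 = T / f * (f1 / T * gam 0).
  by rewrite -E //; field; rewrite !gt_eqF.
have E2 : gam 0 - 1 = f1 / f * gam 0 by rewrite E'; field; rewrite !gt_eqF.
have -> : gam 0 * (f - f1) = f * (gam 0 - f1 / f * gam 0) by field; rewrite gt_eqF.
by rewrite -E2; ring.
Qed.

End MeanOneWalk.

Section AbelianSeries.
Variable R : realType.
Local Notation mu := (@lebesgue_measure R).

Lemma cvg_abelian_series (sg beta C : R) (q : nat -> R) (h : R -> R)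
    (t S : nat -> R) :
  0 < sg -> sg < 1 ->
  q m * m%:R `^ sg @[m --> \oo] --> beta ->
  (forall x : R, 0 < x -> {for x, continuous h}) ->
  (forall x : R, 0 < x -> `|h x| <= C / (1 + x)) ->
  (forall n, 0 < t n) -> t @ \oo --> (0 : R) ->
  (forall n, series (fun m => q m.+1 * h (m.+1%:R * t n)) @ \oo --> S n) ->
  t n `^ (1 - sg) * S n @[n --> \oo] -->
    beta * \int[mu]_(x in `]0, +oo[) (h x * x `^ (- sg)).
Proof.
move=> sg0 sg1 qb ch hC t_gt0 t0 HS.
have H n : exists M : nat, n%:R / t n <= M%:R /\
    t n `^ (1 - sg) * `|\sum_(1 <= m < M.+1) q m * h (m%:R * t n) - S n| <= n.+1%:R^-1.
  have HM : \forall M \near \oo, n%:R / t n <= M%:R.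
    have /cvgryPge/(_ (n%:R / t n)) := @cvgr_idn R; exact.
  have He : \forall M \near \oo, t n `^ (1 - sg) * `|\sum_(1 <= m < M.+1) q m * h (m%:R * t n) - S n| <= n.+1%:R^-1.
    have H1 : `|series (fun m => q m.+1 * h (m.+1%:R * t n)) M - S n| @[M --> \oo] --> `|S n - S n|.
      exact: (cvg_norm (cvgnB (HS n) (cvg_cst (S n)))).
    rewrite subrr normr0 in H1.
    have H2 := cvgnMl0 (t n `^ (1 - sg)) H1.
    have n0 : (0 : R) < n.+1%:R^-1 by rewrite invr_gt0.
    have H3 : \forall M \near \oo, t n `^ (1 - sg) * `|series (fun m => q m.+1 * h (m.+1%:R * t n)) M - S n| <= n.+1%:R^-1.
      exact: (cvgr_le 0 H2).
    by apply: filterS H3 => M; rewrite big_add1.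
  by near \oo => M; exists M; split; near: M.
have [M HM] := choice H.
have Mt : (M n).+1%:R * t n @[n --> \oo] --> +oo.
  apply/cvgryPge => B.
  have nB : \forall n \near \oo, B <= n%:R by exact: (cvgry_ge (@cvgr_idn R)).
  apply: filterS nB => n /le_trans; apply; have [+ _] := HM n.
  rewrite ler_pdivrMr // => /le_trans; apply.
  by rewrite ler_wpM2r ?(ltW (t_gt0 n)) // ler_nat.
have tpos : \forall n \near \oo, 0 < t n by exact: nearW.
have L1 := cvg_abelian_sum sg0 sg1 qb ch hC tpos t0 Mt.
have harm : (n.+1%:R^-1 : R) @[n --> \oo] --> (0 : R) by exact: cvg_harmonic.
have L2 : t n `^ (1 - sg) * (\sum_(1 <= m < (M n).+1) q m * h (m%:R * t n) - S n) @[n --> \oo] --> (0 : R).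
  apply: (cvgn0_le _ harm); apply: nearW => n; have [_] := HM n.
  by rewrite normrM ger0_norm ?powR_ge0.
apply: cvgn_ext; [exact: (cvgnB L1 L2)| |by rewrite subr0] => n.
by rewrite /=; ring.
Unshelve. all: by end_near. Qed.

Lemma integral_FTC_vanish (w F : R -> R) :
  mu.-integrable `]0, +oo[ (EFin \o w) ->
  (forall x : R, 0 < x -> {for x, continuous w}) ->
  (forall x : R, 0 < x -> is_derive x 1 F (w x)) ->
  F n.+1%:R^-1 @[n --> \oo] --> (0 : R) -> F n.+1%:R @[n --> \oo] --> (0 : R) ->
  \int[mu]_(x in `]0, +oo[) w x = 0.
Proof.
move=> iw cw dF F0 Foo.
pose I i : set R := `[i.+1%:R^-1, i.+1%:R]%classic.
have posI i (x : R) : x \in `[i.+1%:R^-1 : R, i.+1%:R] -> 0 < x.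
  by rewrite in_itv /= => /andP[+ _]; apply: lt_le_trans; rewrite invr_gt0 ltr0n.
have mw : measurable_fun (`]0, +oo[%classic : set R) w.
  by case/integrableP : iw => /measurable_EFinP.
have subI i : I i `<=` `]0, +oo[%classic.
  by move=> x /= /posI x0; rewrite in_itv /= andbT.
have [|||||_ cvgI] := @Rdominated_cvg R `]0, +oo[%classic (fun i => w \_ (I i)) w (fun x => `|w x|).
- exact: measurable_itv.
- move=> i; apply/measurable_restrict; [exact: measurable_itv|exact: measurable_itv|].
  by apply: measurable_funS mw; [exact: measurable_itv|exact: subIsetl].
- apply: nearW => i x _; rewrite patchE; case: ifP => // _.
  by rewrite normr0.
- exact: (integrable_abse iw).
- move=> x; rewrite /= in_itv /= andbT => x0.
  apply: cvg_near_cst.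
  have h1 : \forall i \near \oo, x <= i%:R by exact: (cvgry_ge (@cvgr_idn R)).
  have h2 : \forall i \near \oo, x^-1 <= i%:R by exact: (cvgry_ge (@cvgr_idn R)).
  apply: filterS2 h1 h2 => i h1 h2; rewrite patchE ifT // inE /I /= in_itv /=.
  have h1' : x <= i.+1%:R by apply: le_trans h1 _; rewrite ler_nat.
  have h2' : x^-1 <= i.+1%:R by apply: le_trans h2 _; rewrite ler_nat.
  rewrite h1' andbT -[leRHS]invrK lef_pV2 ?posrE ?invr_gt0 ?ltr0n //.
have : \int[mu]_(x in `]0, +oo[) (w \_ (I i)) x @[i --> \oo] --> (0 : R).
  have H := cvgnB Foo F0; rewrite subr0 in H; apply: (cvgn_near H).
  near=> i; have i0 : (0 < i)%N by near: i; exact: nbhs_infty_gt.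
  rewrite -Rintegral_mkcondr (setIidr (subI i)).
  have lti : i.+1%:R^-1 < i.+1%:R :> R.
    have i1 : (1 : R) < i.+1%:R by rewrite ltr1n ltnS.
    by apply: (lt_trans _ i1); rewrite invf_lt1 ?ltr0n.
  have dFc (x : R) : 0 < x -> {for x, continuous F}.
    move=> x0; apply/differentiable_continuous/derivable1_diffP.
    by have := dF x x0 => ?; exact: ex_derive.
  have iV0 : (0 : R) < i.+1%:R^-1 by rewrite invr_gt0.
  rewrite /Rintegral (@continuous_FTC2 _ w F) //.
  - by apply: continuous_in_subspaceT => x; rewrite inE /= => /posI; exact: cw.
  - split.
    + by move=> x /subset_itv_oo_cc /posI x0; have := dF x x0 => ?; exact: ex_derive.
    + by apply: cvg_at_right_filter; exact: dFc.
    + by apply: cvg_at_left_filter; exact: dFc.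
  - by move=> x /subset_itv_oo_cc /posI x0; have := dF x x0 => ?; rewrite derive1E derive_val.
by move=> H; exact: (cvg_unique _ cvgI H).
Unshelve. all: by end_near. Qed.

End AbelianSeries.

Section ExponentialKernels.
Variable R : realType.
Local Notation mu := (@lebesgue_measure R).
Implicit Types v : R.

Lemma expRN_le v : 0 <= v -> expR (- v) <= (1 + v)^-1.
Proof.
move=> v0; rewrite expRN lef_pV2 ?posrE ?expR_gt0 ?expR_ge1Dx //.
by rewrite ltr_pwDl.
Qed.

Lemma expRN_ge v : 1 - v <= expR (- v).
Proof. exact: expR_ge1Dx. Qed.

Lemma expRN_le_sqr v : 0 <= v -> expR (- v) - 1 + v <= v ^+ 2 / (1 + v).
Proof.
move=> v0; have v1 : 0 < 1 + v by rewrite ltr_pwDl.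
have -> : v ^+ 2 / (1 + v) = (1 + v)^-1 - 1 + v by field; rewrite gt_eqF.
by rewrite !lerD2r expRN_le.
Qed.

(* For the generating function F(s) = sum p_m e^(-ms) of a mean-one law,
   F(s) - 1 + s = s^2 sum m^2 p_m kerA(ms) and 1 + F'(s) = s sum m^2 p_m kerB(ms). *)
Definition kerA v := (expR (- v) - 1 + v) / v ^+ 2.
Definition kerB v := (1 - expR (- v)) / v.
Definition kerC v := expR (- v).

Lemma continuous_expRN : continuous (fun v : R => expR (- v)).
Proof.
by move=> v; apply: continuous_comp; [exact: opp_continuous|exact: continuous_expR].
Qed.

Lemma continuous_kerA v : 0 < v -> {for v, continuous kerA}.
Proof.
move=> v0; apply: cvgM.
  by apply: cvgD; [apply: cvgB; [exact: continuous_expRN|exact: cvg_cst]|exact: cvg_id].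
by apply: cvgV; [rewrite expf_neq0 // gt_eqF|exact: exprn_continuous].
Qed.

Lemma continuous_kerB v : 0 < v -> {for v, continuous kerB}.
Proof.
move=> v0; apply: cvgM.
  by apply: cvgB; [exact: cvg_cst|exact: continuous_expRN].
by apply: cvgV; [rewrite gt_eqF|exact: cvg_id].
Qed.

Lemma continuous_kerC v : 0 < v -> {for v, continuous kerC}.
Proof. by move=> _; exact: continuous_expRN. Qed.

Lemma norm_kerA v : 0 < v -> `|kerA v| <= 2 / (1 + v).
Proof.
move=> v0; have v1 : 0 < 1 + v by rewrite addr_gt0.
have h0 := expRN_ge v; have h1 := expRN_le_sqr (ltW v0).
rewrite ger0_norm; last by rewrite divr_ge0 ?sqr_ge0 //; lra.
rewrite ler_pdivrMr ?exprn_gt0 //; apply: le_trans h1 _.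
rewrite mulrC ler_wpM2r ?sqr_ge0 // -[leLHS]mul1r ler_wpM2r ?invr_ge0 ?ltW //.
by rewrite ltr1n.
Qed.

Lemma norm_kerB v : 0 < v -> `|kerB v| <= 2 / (1 + v).
Proof.
move=> v0; have v1 : 0 < 1 + v by rewrite addr_gt0.
have h0 := expRN_ge v; have h1 : 0 < expR (- v) := expR_gt0 _.
have h2 : expR (- v) <= 1 by rewrite -expR0 ler_expR oppr_le0 ltW.
rewrite ger0_norm; last by rewrite divr_ge0 ?(ltW v0) //; lra.
rewrite ler_pdivrMr // mulrAC ler_pdivlMr //.
by nra.
Qed.

Lemma norm_kerC v : 0 < v -> `|kerC v| <= 2 / (1 + v).
Proof.
move=> v0; have v1 : 0 < 1 + v by rewrite addr_gt0.
rewrite ger0_norm ?expR_ge0 //; apply: le_trans (expRN_le (ltW v0)) _.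
by rewrite -[leLHS]mul1r ler_wpM2r ?invr_ge0 ?(ltW v1) // ler1n.
Qed.

Definition ker_integral (h : R -> R) (sg : R) : R :=
  \int[mu]_(x in `]0, +oo[) (h x * x `^ (- sg)).

Lemma euler_integralE (x : R) : euler_integral x = ker_integral kerC (1 - x).
Proof.
by apply: eq_Rintegral => v _; rewrite opprB mulrC.
Qed.

Lemma ker_integralC_gt0 (sg : R) : 0 < sg -> sg < 1 -> 0 < ker_integral kerC sg.
Proof.
move=> sg0 sg1; pose c : R := expR (- 2) * 2 `^ (- sg).
have c0 : 0 < c by rewrite mulr_gt0 ?expR_gt0 // powR_gt0.
have i1 : mu.-integrable `]0, +oo[ (EFin \o (fun x => c * \1_(`[1, 2] : set R) x)).
  have i0 := @integrableS _ _ _ mu setT `]0, +oo[%classic _ measurableT (measurable_itv _) (@subsetT _ _) (integrable_indic_itv 1 2 true false).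
  by have := @integrableZl _ _ _ mu `]0, +oo[%classic (measurable_itv _) c _ i0.
have i2 := integrable_mul_powR sg0 sg1 continuous_kerC norm_kerC.
have := @le_Rintegral _ _ _ mu `]0, +oo[%classic _ _ (measurable_itv _) i1 i2.
have cE : \int[mu]_(x in `]0, +oo[) (c * \1_(`[1, 2] : set R) x) = c.
  rewrite RintegralZl //; last first.
    exact: (@integrableS _ _ _ mu setT `]0, +oo[%classic _ measurableT (measurable_itv _) (@subsetT _ _) (integrable_indic_itv 1 2 true false)).
  rewrite /Rintegral integral_indic // (setIidl _); last first.
    by move=> x /=; rewrite !in_itv /= andbT => /andP[+ _]; apply: lt_le_trans.
  have E : mu `[1, 2]%classic = (2 - 1)%:E.
    by rewrite lebesgue_measure_itv /= lte_fin ltr1n.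
  by rewrite [X in fine X]E /=; ring.
rewrite cE => H; apply: (lt_le_trans c0); apply: H => x.
rewrite /= in_itv /= andbT => x0; rewrite indicE mem_setE in_itv /=.
case: (boolP (1 <= x <= 2)) => [/andP[x1 x2]|_]; last by rewrite mulr0 mulr_ge0 ?expR_ge0 ?powR_ge0.
rewrite mulr1 /c ler_pM ?expR_ge0 ?powR_ge0 //.
  by rewrite ler_expR lerN2.
rewrite !powRN lef_pV2 ?posrE ?powR_gt0 //.
by apply: ge0_ler_powR; rewrite ?nnegrE ?(ltW sg0) ?(ltW x0).
Qed.

Section Relations.
Variable al : R.
Hypotheses (al1 : 1 < al) (al2 : al < 2).
Let s0 : 0 < al - 1. Proof. by rewrite subr_gt0. Qed.
Let s1 : al - 1 < 1. Proof. by rewrite ltrBlDr. Qed.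
Let s2 : 0 < 2 - al. Proof. by rewrite subr_gt0. Qed.

Let harm : (n.+1%:R^-1 : R) @[n --> \oo] --> (0 : R).
Proof. exact: cvg_harmonic. Qed.

Let natS : (n.+1%:R : R) @[n --> \oo] --> +oo.
Proof.
have := @cvgr_idn R => /cvgryPge H; apply/cvgryPge => A.
by apply: filterS (H A) => n /le_trans; apply; rewrite ler_nat.
Qed.

Let F0 : (n.+1%:R^-1 : R) `^ (2 - al) @[n --> \oo] --> (0 : R).
Proof. by apply: cvgn0_powR => //; apply: nearW => n; rewrite invr_gt0. Qed.

Let Foo : (n.+1%:R : R) `^ (- (al - 1)) @[n --> \oo] --> (0 : R).
Proof. by apply: cvgn0_powRy natS; rewrite oppr_lt0. Qed.

Let ib h C := @integrable_mul_powR R (al - 1) C h s0 s1.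

Lemma ker_integral_BC : (al - 1) * ker_integral kerB (al - 1) = ker_integral kerC (al - 1).
Proof.
pose w v := kerC v * v `^ (- (al - 1)) - (al - 1) * (kerB v * v `^ (- (al - 1))).
pose F v := (1 - expR (- v)) * v `^ (- (al - 1)).
have iB := ib continuous_kerB norm_kerB; have iC := ib continuous_kerC norm_kerC.
have iB' := @integrableZl _ _ _ mu `]0, +oo[%classic (measurable_itv _) (al - 1) _ iB.
have iw : mu.-integrable `]0, +oo[ (EFin \o w).
  by have := @integrableB _ _ _ mu `]0, +oo[%classic (measurable_itv _) _ _ iC iB'.
suff : \int[mu]_(x in `]0, +oo[) w x = 0.
  rewrite RintegralB // => /eqP; rewrite subr_eq0 => /eqP.
  by rewrite RintegralZl // => E; rewrite /ker_integral E.
have FB (v : R) : 0 < v -> 0 <= F v /\ F v <= v `^ (2 - al) /\ F v <= v `^ (- (al - 1)).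
  move=> v0; have h0 := expRN_ge v; have h1 : 0 < expR (- v) := expR_gt0 _.
  have h2 : expR (- v) <= 1 by rewrite -expR0 ler_expR oppr_le0 ltW.
  have pv := powR_ge0 v (- (al - 1)); split; [|split]; rewrite /F.
  - by rewrite mulr_ge0 //; lra.
  - have -> : 2 - al = 1 + - (al - 1) by ring.
    by rewrite powRD_gt0 // powRr1 ?(ltW v0) // ler_wpM2r //; lra.
  - by rewrite ler_piMl //; lra.
apply: (@integral_FTC_vanish R w F) => //.
- move=> x x0; apply: cvgB; last apply: cvgMl_tmp.
    by apply: cvgM; [exact: continuous_kerC|exact: (@continuous_powR_gt0 R)].
  by apply: cvgM; [exact: continuous_kerB|exact: (@continuous_powR_gt0 R)].
- move=> x x0; have d1 := is_derive1_powR (- (al - 1)) x0.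
  rewrite /F; apply: is_derive_eq; rewrite /GRing.scale /= /w /kerB /kerC.
  rewrite (_ : x `^ (- (al - 1) - 1) = x `^ (- (al - 1)) / x); last first.
    by rewrite powRD_gt0 // powR_inv1 // ltW.
  by field; rewrite gt_eqF.
- apply: (cvgn0_le _ F0); apply: nearW => n.
  by have [|? [? ?]] := FB n.+1%:R^-1; rewrite ?invr_gt0 // ger0_norm.
- apply: (cvgn0_le _ Foo); apply: nearW => n.
  by have [|? [? ?]] := FB n.+1%:R; rewrite // ger0_norm.
Qed.

Lemma ker_integral_AB : al * ker_integral kerA (al - 1) = ker_integral kerB (al - 1).
Proof.
pose w v := kerB v * v `^ (- (al - 1)) - al * (kerA v * v `^ (- (al - 1))).
pose F v := (expR (- v) - 1 + v) * v `^ (- al).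
have iB := ib continuous_kerB norm_kerB; have iA := ib continuous_kerA norm_kerA.
have iA' := @integrableZl _ _ _ mu `]0, +oo[%classic (measurable_itv _) al _ iA.
have iw : mu.-integrable `]0, +oo[ (EFin \o w).
  by have := @integrableB _ _ _ mu `]0, +oo[%classic (measurable_itv _) _ _ iB iA'.
suff : \int[mu]_(x in `]0, +oo[) w x = 0.
  rewrite RintegralB // => /eqP; rewrite subr_eq0 => /eqP.
  by rewrite RintegralZl // => E; rewrite /ker_integral E.
have FB (v : R) : 0 < v -> 0 <= F v /\ F v <= v `^ (2 - al) /\ F v <= v `^ (- (al - 1)).
  move=> v0; have h0 := expRN_ge v; have h1 := expRN_le_sqr (ltW v0).
  have h2 : expR (- v) <= 1 by rewrite -expR0 ler_expR oppr_le0 ltW.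
  have h3 : v ^+ 2 / (1 + v) <= v ^+ 2.
    by rewrite ler_pdivrMr ?addr_gt0 // ler_peMr ?sqr_ge0 // lerDl ltW.
  have pv := powR_ge0 v (- al); split; [|split]; rewrite /F.
  - by rewrite mulr_ge0 //; lra.
  - rewrite powRD_gt0 // powR_mulrn ?(ltW v0) // ler_wpM2r //; lra.
  - have -> : - (al - 1) = 1 + - al by ring.
    by rewrite powRD_gt0 // powRr1 ?(ltW v0) // ler_wpM2r //; lra.
apply: (@integral_FTC_vanish R w F) => //.
- move=> x x0; apply: cvgB; last apply: cvgMl_tmp.
    by apply: cvgM; [exact: continuous_kerB|exact: (@continuous_powR_gt0 R)].
  by apply: cvgM; [exact: continuous_kerA|exact: (@continuous_powR_gt0 R)].
- move=> x x0; have d1 := is_derive1_powR (- al) x0.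
  rewrite /F; apply: is_derive_eq; rewrite /GRing.scale /= /w /kerB /kerA.
  rewrite (_ : x `^ (- al - 1) = x `^ (- al) / x); last first.
    by rewrite powRD_gt0 // powR_inv1 // ltW.
  rewrite (_ : x `^ (- (al - 1)) = x `^ (- al) * x); last first.
    by rewrite opprB addrC powRD_gt0 // powRr1 // ltW.
  by field; rewrite gt_eqF.
- apply: (cvgn0_le _ F0); apply: nearW => n.
  by have [|? [? ?]] := FB n.+1%:R^-1; rewrite ?invr_gt0 // ger0_norm.
- apply: (cvgn0_le _ Foo); apply: nearW => n.
  by have [|? [? ?]] := FB n.+1%:R; rewrite // ger0_norm.
Qed.

End Relations.
End ExponentialKernels.

Section StableConstant.
Variable R : realType.
Local Notation mu := (@lebesgue_measure R).

Variables (p : nat -> R) (al be : R).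
Hypothesis p_ge0 : forall i, 0 <= p i.
Hypothesis p_sum1 : series p @ \oo --> (1 : R).
Hypothesis p_mean1 : series (fun m => m%:R * p m) @ \oo --> (1 : R).
Hypotheses (al1 : 1 < al) (al2 : al < 2) (be0 : 0 < be).
Hypothesis p_tail : p m * m%:R `^ (1 + al) @[m --> \oo] --> be.

Let F (s : R) : R := limn (series (fun m => p m * expR (- s) ^+ m)).
Let F1 (s : R) : R := limn (series (fun m => m%:R * p m * expR (- s) ^+ m)).

Let T01 (s : R) : 0 < s -> 0 <= expR (- s) <= 1.
Proof. by move=> s0; rewrite expR_ge0 -expR0 ler_expR oppr_le0 ltW. Qed.

Let FP (s : R) : 0 < s -> series (fun m => p m * expR (- s) ^+ m) @ \oo --> F s.
Proof. by move=> s0; exact: (cvg_series_damped p_ge0 p_sum1 (T01 s0)). Qed.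

Let F1P (s : R) : 0 < s -> series (fun m => m%:R * p m * expR (- s) ^+ m) @ \oo --> F1 s.
Proof.
move=> s0; apply: (cvg_series_damped _ p_mean1 (T01 s0)) => m.
by rewrite mulr_ge0.
Qed.

Let expX (s : R) m : expR (- s) ^+ m = expR (- (m%:R * s)).
Proof. by rewrite -expRM_natl mulrN. Qed.

Let sg0 : 0 < al - 1. Proof. by rewrite subr_gt0. Qed.
Let sg1 : al - 1 < 1. Proof. by rewrite ltrBlDr. Qed.
Let al0 : 0 < al. Proof. by rewrite (lt_trans ltr01). Qed.

Let Ia := ker_integral (@kerA R) (al - 1).
Let Ib := ker_integral (@kerB R) (al - 1).

Let qb : m%:R ^+ 2 * p m * m%:R `^ (al - 1) @[m --> \oo] --> be.
Proof.
apply: (cvgn_near p_tail); near=> m.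
have m0 : (0 : R) < m%:R by rewrite ltr0n; near: m; exact: nbhs_infty_gt.
have -> : 1 + al = 2%:R + (al - 1) by ring.
by rewrite [in LHS]powRD_gt0 // powR_mulrn ?(ltW m0) //; ring.
Unshelve. all: by end_near. Qed.

Section AlongSequence.
Variable s : nat -> R.
Hypotheses (s_gt0 : forall n, 0 < s n) (s0 : s @ \oo --> (0 : R)).

Let s_near : \forall n \near \oo, 0 < s n. Proof. exact: nearW. Qed.

Lemma cvg_pgf_asymp : s n `^ (- al) * (F (s n) - 1 + s n) @[n --> \oo] --> be * Ia.
Proof.
have H := cvg_abelian_series sg0 sg1 qb (@continuous_kerA R) (@norm_kerA R) s_gt0 s0
  (S := fun n => (F (s n) - 1 + s n) / s n ^+ 2).
apply: cvgn_ext; [apply: H| |by []] => n.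
  have sn := s_gt0 n.
  have H1 := cvg_series_shift (FP sn).
  have H2 := cvg_series_shift p_sum1.
  have H3 := cvg_series_shift p_mean1.
  have H4 := cvg_seriesD (cvg_seriesD H1 (cvg_seriesMl (c := -1) H2)) (cvg_seriesMl (c := s n) H3).
  apply: (cvg_series_eq (cvg_seriesMl (c := (s n ^+ 2)^-1) H4)) => [m|].
    have m0 : m.+1%:R != 0 :> R by rewrite pnatr_eq0.
    by rewrite expX /kerA; field; rewrite gt_eqF //= addrC natr1.
  by rewrite expr0; field; rewrite gt_eqF.
have sn := s_gt0 n.
have -> : 1 - (al - 1) = 2%:R - al by ring.
by rewrite powRD_gt0 // powR_mulrn ?(ltW sn) //; field; rewrite gt_eqF.
Qed.

Lemma cvg_mean_asymp : s n `^ (1 - al) * (1 - F1 (s n)) @[n --> \oo] --> be * Ib.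
Proof.
have H := cvg_abelian_series sg0 sg1 qb (@continuous_kerB R) (@norm_kerB R) s_gt0 s0
  (S := fun n => (1 - F1 (s n)) / s n).
apply: cvgn_ext; [apply: H| |by []] => n.
  have sn := s_gt0 n.
  have H1 := cvg_series_shift (F1P sn).
  have H3 := cvg_series_shift p_mean1.
  have H4 := cvg_seriesD H3 (cvg_seriesMl (c := -1) H1).
  apply: (cvg_series_eq (cvg_seriesMl (c := (s n)^-1) H4)) => [m|].
    have m0 : m.+1%:R != 0 :> R by rewrite pnatr_eq0.
    by rewrite expX /kerB; field; rewrite gt_eqF //= addrC natr1.
  by field; rewrite gt_eqF.
have sn := s_gt0 n.
have -> : 1 - (al - 1) = 1 + (1 - al) by ring.
by rewrite powRD_gt0 // powRr1 ?(ltW sn) //; field; rewrite gt_eqF.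
Qed.

Let s2al : s n `^ (2 - al) @[n --> \oo] --> (0 : R).
Proof. by apply: cvgn0_powR => //; rewrite subr_gt0. Qed.

Lemma cvg_gap_asymp : s n `^ (- al) * (F (s n) - expR (- s n)) @[n --> \oo] --> be * Ia.
Proof.
have H : s n `^ (- al) * (expR (- s n) - 1 + s n) @[n --> \oo] --> (0 : R).
  apply: (cvgn0_le _ s2al); apply: nearW => n; have sn := s_gt0 n.
  have h0 := expRN_ge (s n); have h1 := expRN_le_sqr (ltW sn).
  rewrite ger0_norm ?mulr_ge0 ?powR_ge0 //; last by lra.
  rewrite powRD_gt0 // powR_mulrn ?(ltW sn) // mulrC ler_wpM2r ?powR_ge0 //.
  apply: le_trans h1 _.
  by rewrite ler_pdivrMr ?addr_gt0 // ler_peMr ?sqr_ge0 // lerDl ltW.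
apply: cvgn_ext; [exact: (cvgnB cvg_pgf_asymp H)| |by rewrite subr0] => n.
by rewrite /=; ring.
Qed.

Hypothesis F_gt : forall n, expR (- s n) < F (s n).

Lemma return_constant (J : R) :
  cpow p N N * N%:R `^ al^-1 @[N --> \oo] --> J ->
  J * ker_integral (@kerC R) al^-1 = (be * Ia) `^ (1 - al^-1) / (be * Ib).
Proof.
move=> qJ; have Ic0 := ker_integralC_gt0 sg0 sg1.
have Ib0 : 0 < Ib by move: Ic0; rewrite -ker_integral_BC // pmulr_rgt0.
have Ia0 : 0 < Ia by move: Ib0; rewrite /Ib -ker_integral_AB // pmulr_rgt0.
have beIa : 0 < be * Ia by rewrite mulr_gt0.
pose z n := expR (- s n) / F (s n); pose t n := - ln (z n).
have F_gt0 n : 0 < F (s n) by apply: lt_trans (F_gt n); exact: expR_gt0.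
have z0 n : 0 < z n by rewrite divr_gt0 ?expR_gt0.
have z1 n : z n < 1 by rewrite ltr_pdivrMr // mul1r.
have t_gt0 n : 0 < t n by rewrite oppr_gt0 ln_lt0 // z0 z1.
have T1 n : expR (- s n) < 1 by rewrite -expR0 ltr_expR oppr_lt0.
have HG n := @return_generating_function R p p_ge0 p_sum1 p_mean1 (expR (- s n)) (F (s n)) (F1 (s n)) (z n)
  (expR_gt0 _) (T1 n) (FP (s_gt0 n)) (F1P (s_gt0 n)) (F_gt n) erefl.
have HG' n : exists G : R, series (fun N => cpow p N N * z n ^+ N) @ \oo --> G /\ G * (F (s n) - F1 (s n)) = F (s n).
  by have [G ? ?] := HG n; exists G.
have [G HGn] := choice HG'.
have Gser n : series (fun N => cpow p N N * z n ^+ N) @ \oo --> G n by have [] := HGn n.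
have GE n : G n * (F (s n) - F1 (s n)) = F (s n) by have [] := HGn n.
have salal : s n `^ al @[n --> \oo] --> (0 : R) by exact: cvgn0_powR.
have pE n : s n `^ al * s n `^ (- al) = 1 by rewrite -powRD_gt0 // subrr powRr0.
have FD0 : F (s n) - 1 + s n @[n --> \oo] --> (0 : R).
  have H := cvgnM salal cvg_pgf_asymp; rewrite mul0r in H.
  by apply: cvgn_ext; [exact: H| |by []] => n /=; rewrite mulrA pE mul1r.
have Fc1 : F (s n) @[n --> \oo] --> (1 : R).
  apply: cvgn_ext; [exact: (cvgnD (cvgnB FD0 s0) (cvg_cst (1 : R)))| |by rewrite subr0 add0r] => n.
  by rewrite /=; ring.
have FF1 : s n `^ (1 - al) * (F (s n) - F1 (s n)) @[n --> \oo] --> be * Ib.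
  have H1 := cvgnM s0 cvg_pgf_asymp; rewrite mul0r in H1.
  apply: cvgn_ext; [exact: (cvgnD (cvgnB H1 s2al) cvg_mean_asymp)| |by rewrite subr0 add0r] => n /=.
  have sn := s_gt0 n.
  have -> : s n `^ (2 - al) = s n * s n `^ (1 - al).
    by rewrite (_ : 2 - al = 1 + (1 - al)) ?powRD_gt0 ?powRr1 ?(ltW sn) //; ring.
  have -> : s n `^ (1 - al) = s n * s n `^ (- al) by rewrite powRD_gt0 // powRr1 // ltW.
  by ring.
have FF1_gt0 n : 0 < F (s n) - F1 (s n).
  have := F_gt0 n; rewrite -{1}(GE n).
  have G0 : 0 <= G n.
    apply: (cvgr_to_ge (Gser n)); apply: nearW => k; apply: sumr_ge0 => N _.
    by rewrite mulr_ge0 ?exprn_ge0 ?(ltW (z0 n)) // cpow_ge0.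
  by move: G0; rewrite le_eqVlt => /predU1P[<-|G0]; rewrite ?mul0r ?ltxx // pmulr_rgt0.
have sG : s n `^ (al - 1) * G n @[n --> \oo] --> (be * Ib)^-1.
  have nz : be * Ib != 0 by rewrite gt_eqF // mulr_gt0.
  have H := cvgnM Fc1 (cvgnV nz FF1); rewrite mul1r in H.
  apply: cvgn_ext; [exact: H| |by []] => n /=.
  have -> : G n = F (s n) / (F (s n) - F1 (s n)) by rewrite -{1}(GE n) mulfK // gt_eqF.
  have -> : al - 1 = - (1 - al) by ring.
  by rewrite powRN; field; rewrite gt_eqF //= gt_eqF // powR_gt0.
have sG1 : s n `^ (al - 1) * (G n - 1) @[n --> \oo] --> (be * Ib)^-1.
  have H := cvgn0_powR sg0 s_near s0.
  by apply: cvgn_ext; [exact: (cvgnB sG H)| |by rewrite subr0] => n /=; ring.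
have z1c : s n `^ (- al) * (1 - z n) @[n --> \oo] --> be * Ia.
  have H := cvgnM cvg_gap_asymp (cvgnV (oner_neq0 R) Fc1); rewrite invr1 mulr1 in H.
  apply: cvgn_ext; [exact: H| |by []] => n /=.
  by rewrite /z; field; rewrite gt_eqF.
have zc1 : z n @[n --> \oo] --> (1 : R).
  have H := cvgnM salal z1c; rewrite mul0r in H.
  apply: cvgn_ext; [exact: (cvgnB (cvg_cst (1 : R)) H)| |by rewrite subr0] => n /=.
  by rewrite mulrA pE; ring.
have tc : s n `^ (- al) * t n @[n --> \oo] --> be * Ia.
  have H := cvgnM z1c (cvgnV (oner_neq0 R) zc1); rewrite invr1 mulr1 in H.
  apply: (squeeze_cvgr _ z1c H).
  apply: nearW => n.
  have zn := z0 n; rewrite -mulrA !ler_wpM2l ?powR_ge0 //= /t.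
    have := ln_leB1 (x := (z n)^-1); rewrite invr_gt0 lnV ?posrE // => /(_ zn) H'.
    by apply: le_trans H' _; rewrite mulrBl mul1r divff // gt_eqF.
  by have := ln_leB1 zn; lra.
have t0 : t @ \oo --> (0 : R).
  have H := cvgnM salal tc; rewrite mul0r in H.
  by apply: cvgn_ext; [exact: H| |by []] => n /=; rewrite mulrA pE mul1r.
have alV0 : 0 < al^-1 by rewrite invr_gt0.
have alV1 : al^-1 < 1 by rewrite invf_lt1.
have Ab : t n `^ (1 - al^-1) * (G n - 1) @[n --> \oo] --> J * ker_integral (@kerC R) al^-1.
  apply: (cvg_abelian_series alV0 alV1 (q := fun N => cpow p N N) qJ (@continuous_kerC R) (@norm_kerC R) t_gt0 t0) => n.
  apply: (cvg_series_eq (cvg_series_shift (Gser n))) => [m|]; last by rewrite /= expr0 mulr1.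
  rewrite /kerC -mulrN opprK expRM_natl ?lnK ?posrE //.
have E : t n `^ (1 - al^-1) * (G n - 1) @[n --> \oo] --> (be * Ia) `^ (1 - al^-1) * (be * Ib)^-1.
  have H : (s n `^ (- al) * t n) `^ (1 - al^-1) @[n --> \oo] --> (be * Ia) `^ (1 - al^-1).
    exact: cvgn_powR.
  apply: cvgn_ext; [exact: (cvgnM H sG1)| |by []] => n /=.
  have sn := s_gt0 n; have tn := t_gt0 n.
  rewrite powRM ?powR_ge0 ?(ltW tn) // -powRrM.
  have -> : - al * (1 - al^-1) = 1 - al by field; rewrite gt_eqF.
  rewrite mulrACA -powRD_gt0 //.
  by rewrite (_ : 1 - al + (al - 1) = 0) ?powRr0 ?mul1r //; ring.
by rewrite (cvg_unique _ Ab E).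
Qed.


End AlongSequence.
Lemma stable_density0_law :
  stable_density0 al * (al * euler_integral (1 - al^-1)) = Ia `^ (- al^-1).
Proof.
have Ic0 := ker_integralC_gt0 sg0 sg1.
have Ib0 : 0 < Ib by move: Ic0; rewrite -ker_integral_BC // pmulr_rgt0.
have Ia0 : 0 < Ia by move: Ib0; rewrite /Ib -ker_integral_AB // pmulr_rgt0.
have beIa : 0 < be * Ia by rewrite mulr_gt0.
have alV0 : 0 < al^-1 by rewrite invr_gt0.
have noo : (n%:R : R) @[n --> \oo] --> +oo by exact: cvgr_idn.
have mN : \forall n \near \oo, `|n%:R - n%:R * 1| <= (0 : R).
  by apply: nearW => n; rewrite mulr1 subrr normr0.
have L := stable_local_limit p_ge0 p_sum1 p_mean1 al1 al2 be0 p_tail noo mN.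
have qJ : cpow p n n * n%:R `^ al^-1 @[n --> \oo] --> be `^ (- al^-1) * stable_density0 al.
  apply: cvgn_ext; [exact: (cvgnMl (be `^ (- al^-1)) L)| |by []] => n /=.
  rewrite powRM ?(ltW be0) // !mulrA -powRD_gt0 // addNr powRr0 mul1r mulrC //.
pose t n : R := n.+1%:R^-1.
have t_gt0 n : 0 < t n by rewrite invr_gt0 ltr0n.
have t0 : t @ \oo --> (0 : R) by exact: cvg_harmonic.
have [n0 _ Hn0] : \forall n \near \oo, 0 < t n `^ (- al) * (F (t n) - expR (- t n)).
  exact: (cvgr_gt _ (cvg_gap_asymp t_gt0 t0)).
pose s n := t (n + n0)%N.
have s0 : s @ \oo --> (0 : R) by rewrite cvg_shiftn.
have F_gt n : expR (- s n) < F (s n).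
  have := Hn0 (n + n0)%N (leq_addl _ _).
  by rewrite pmulr_rgt0 ?powR_gt0 // subr_gt0.
have := return_constant (fun n => t_gt0 (n + n0)%N) s0 F_gt qJ.
rewrite euler_integralE (_ : 1 - (1 - al^-1) = al^-1); last by ring.
have -> : Ib = al * Ia by rewrite /Ib -ker_integral_AB.
have -> : (be * Ia) `^ (1 - al^-1) = be * Ia * (be `^ (- al^-1) * Ia `^ (- al^-1)).
  by rewrite powRD_gt0 // powRr1 ?(ltW beIa) // powRM ?(ltW be0) ?(ltW Ia0).
move: (powR_neq0 (- al^-1) be0); move: (be `^ _) (stable_density0 al) (ker_integral _ _) (Ia `^ _).
move=> B D I X B0 H.
apply: (mulfI B0); rewrite -[RHS]mul1r.
have -> : B * (D * (al * I)) = al * (B * D * I) by ring.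
by rewrite H; field; rewrite !gt_eqF.
Qed.

End StableConstant.

Lemma stable_density0E (R : realType) (al : R) : 1 < al -> al < 2 ->
  stable_density0 al * (al * euler_integral (1 - al^-1)) =
  (euler_integral (2 - al) / (al * (al - 1))) `^ (- al^-1).
Proof.
move=> al1 al2; have al0 : 0 < al by rewrite (lt_trans ltr01).
have sg0 : 0 < al - 1 by rewrite subr_gt0.
have sg1 : al - 1 < 1 by rewrite ltrBlDr.
have [S HS] : exists S : R, series (fun m => m%:R `^ (- al)) @ \oo --> S.
  by have /cvg_ex := cvg_series_riemann al1.
have al1' : 1 < 1 + al by rewrite ltrDl.
have [S' HS'] : exists S' : R, series (fun m => m%:R `^ (- (1 + al))) @ \oo --> S'.
  by have /cvg_ex := cvg_series_riemann al1'.
have S1 : 1 <= S.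
  apply: (cvgr_to_ge HS); near=> n.
  have n2 : (2 <= n)%N by near: n; exact: nbhs_infty_ge.
  rewrite /series /= (big_cat_nat (n := 2)) //= !big_nat_recr //= big_nil powR0 ?oppr_eq0 ?gt_eqF //.
  by rewrite powR1 !add0r lerDl sumr_ge0 // => i _; rewrite powR_ge0.
have SS : S' <= S.
  rewrite -subr_ge0; apply: (cvgr_to_ge (cvgnB HS HS')); apply: nearW => n.
  rewrite subr_ge0; apply: ler_sum => -[|m] _ /=.
    by rewrite !powR0 // oppr_eq0 gt_eqF // addr_gt0.
  by apply: ler_powR; rewrite ?ler1n // lerN2 lerDr.
have S0 : 0 < S by rewrite (lt_le_trans ltr01).
pose p m : R := S^-1 * m%:R `^ (- (1 + al)) + (m == 0%N)%:R * (1 - S' / S).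
have p_ge0 m : 0 <= p m.
  by rewrite addr_ge0 // mulr_ge0 ?invr_ge0 ?(ltW S0) ?powR_ge0 // subr_ge0 ler_pdivrMr // mul1r.
have delta : series (fun m => (m == 0%N)%:R * (1 - S' / S)) @ \oo --> 1 - S' / S.
  have Z : series (fun m => (m.+1 == 0%N)%:R * (1 - S' / S)) @ \oo --> (0 : R).
    apply: cvgn_ext; [exact: (cvg_cst (0 : R))| |by []] => n.
    by rewrite /series /= big1 // => i _; rewrite mul0r.
  have := @cvg_series_unshift R (fun m => (m == 0%N)%:R * (1 - S' / S)) 0 Z.
  by rewrite eqxx mul1r addr0.
have p_sum1 : series p @ \oo --> (1 : R).
  apply: (cvg_series_eq (cvg_seriesD (cvg_seriesMl (c := S^-1) HS') delta)) => //.
  by field; rewrite gt_eqF.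
have p_mean1 : series (fun m => m%:R * p m) @ \oo --> (1 : R).
  apply: (cvg_series_eq (cvg_seriesMl (c := S^-1) HS)) => [[|m]|]; last by rewrite mulVf ?gt_eqF.
    by rewrite mul0r powR0 ?mulr0 // oppr_eq0 gt_eqF.
  have m0 : (0 : R) < m.+1%:R by rewrite ltr0n.
  rewrite /p /= mul0r addr0 mulrCA; congr (_ * _).
  rewrite (_ : - al = 1 + - (1 + al)); last by ring.
  by rewrite powRD_gt0 // powRr1 // ltW.
have p_tail : p m * m%:R `^ (1 + al) @[m --> \oo] --> S^-1.
  apply: (cvgn_near (cvg_cst S^-1)); near=> m.
  have m0 : (0 < m)%N by near: m; exact: nbhs_infty_gt.
  have m0' : (0 : R) < m%:R by rewrite ltr0n.
  by rewrite /p gtn_eqF // mul0r addr0 -mulrA -powRD_gt0 // addNr powRr0 mulr1.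
have SV0 : 0 < S^-1 by rewrite invr_gt0.
rewrite (stable_density0_law p_ge0 p_sum1 p_mean1 al1 al2 SV0 p_tail); congr (_ `^ _).
rewrite euler_integralE (_ : 1 - (2 - al) = al - 1); last by ring.
rewrite -ker_integral_BC // -ker_integral_AB //.
by field; rewrite !gt_eqF.
Unshelve. all: by end_near. Qed.

(** * One big jump *)

Lemma one_jump_step (A : comNzRingType) (g h Q : A) N :
  (g + h) * (g ^+ N + (h * g ^+ N.-1) *+ N + h * Q) =
  g ^+ N.+1 + (h * g ^+ N) *+ N.+1 + h * ((g + h) * Q + (h * g ^+ N.-1) *+ N).
Proof.
case: N => [|N]; first by rewrite !expr0 expr1 !mulr0n mulr1n; ring.
by rewrite -!(mulr_natr (h * _)) /= !exprS -[N.+2%:R]natr1; ring.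
Qed.

Section NonnegativePolynomials.
Variable R : realType.
Implicit Types q h f g : {poly R}.

Definition nneg_poly q := forall i, 0 <= q`_i.

Lemma nneg_polyD q h : nneg_poly q -> nneg_poly h -> nneg_poly (q + h).
Proof. by move=> q0 h0 i; rewrite coefD addr_ge0. Qed.

Lemma nneg_polyM q h : nneg_poly q -> nneg_poly h -> nneg_poly (q * h).
Proof. by move=> q0 h0 i; rewrite coefM sumr_ge0 // => j _; rewrite mulr_ge0. Qed.

Lemma nneg_polyX q n : nneg_poly q -> nneg_poly (q ^+ n).
Proof.
move=> q0; elim: n => [|n IHn]; first by rewrite expr0 => i; rewrite coef1 ler0n.
by rewrite exprS; exact: nneg_polyM.
Qed.

Lemma nneg_polyMn q n : nneg_poly q -> nneg_poly (q *+ n).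
Proof. by move=> q0 i; rewrite coefMn mulrn_wge0. Qed.

Lemma nneg_horner_ge0 q x : nneg_poly q -> 0 <= x -> 0 <= q.[x].
Proof.
move=> q0 x0; rewrite horner_coef sumr_ge0 // => i _.
by rewrite mulr_ge0 // exprn_ge0.
Qed.

Lemma nneg_horner_psum q x (P : pred nat) K : nneg_poly q -> 0 <= x ->
  \sum_(j < K | P j) q`_j * x ^+ j <= q.[x].
Proof.
move=> q0 x0; rewrite (@horner_coef_wide _ (K + size q)) ?leq_addl //.
have t0 j : 0 <= q`_j * x ^+ j by rewrite mulr_ge0 // exprn_ge0.
rewrite big_split_ord /= -[leLHS]addr0 lerD ?sumr_ge0 //.
by rewrite big_mkcond ler_sum // => i _; case: ifP.
Qed.

Lemma coefM_le_horner1 q h n (S : R) : nneg_poly q -> 0 <= S ->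
  (forall i, h`_i <= S) -> (h * q)`_n <= S * q.[1].
Proof.
move=> q0 S0 hS; rewrite coefMr.
apply: le_trans (_ : S * \sum_(j < n.+1 | xpredT j) q`_j * 1 ^+ j <= _); last first.
  by rewrite ler_wpM2l //; exact: (nneg_horner_psum xpredT).
rewrite mulr_sumr ler_sum // => i _.
by rewrite expr1n mulr1 ler_wpM2r.
Qed.

Lemma chernoff q (P : pred nat) (K : nat) (s t : R) : nneg_poly q ->
  (forall j, P j -> 0 <= s * (j%:R - t)) ->
  \sum_(j < K | P j) q`_j <= expR (- (s * t)) * q.[expR s].
Proof.
move=> q0 Pj.
apply: le_trans (ler_wpM2l (expR_ge0 _) (nneg_horner_psum P K q0 (expR_ge0 s))).
rewrite mulr_sumr ler_sum // => j /Pj H.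
rewrite mulrCA ler_peMr // -expRM_natl -expRD -[leLHS]expR0 ler_expR.
by apply: le_trans H _; rewrite le_eqVlt; apply/orP; left; apply/eqP; ring.
Qed.

Lemma one_jump_expansion g h N : nneg_poly g -> nneg_poly h -> (g + h).[1] <= 1 ->
  exists Q, [/\ nneg_poly Q, Q.[1] <= N%:R ^+ 2 * h.[1] &
    (g + h) ^+ N = g ^+ N + (h * g ^+ N.-1) *+ N + h * Q].
Proof.
move=> g0 h0 f1; have h10 := nneg_horner_ge0 h0 ler01.
have g10 := nneg_horner_ge0 g0 ler01.
have g11 : g.[1] <= 1 by move: f1; rewrite hornerD; lra.
elim: N => [|N [Q [Q0 Q1 QE]]].
  exists 0; split; first by move=> i; rewrite coef0.
    by rewrite horner0 expr0n mul0r.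
  by rewrite !expr0 mulr0n mulr0 !addr0.
exists ((g + h) * Q + (h * g ^+ N.-1) *+ N); split.
- apply: nneg_polyD; first by apply: nneg_polyM => //; exact: nneg_polyD.
  by apply: nneg_polyMn; apply: nneg_polyM => //; exact: nneg_polyX.
- rewrite hornerD hornerMn !hornerM horner_exp.
  have Q10 := nneg_horner_ge0 Q0 ler01.
  have H1 : (g + h).[1] * Q.[1] <= N%:R ^+ 2 * h.[1].
    by apply: le_trans _ Q1; rewrite ler_piMl.
  have H2 : h.[1] * g.[1] ^+ N.-1 *+ N <= N%:R * h.[1].
    rewrite -[leLHS]mulr_natl ler_wpM2l // ler_piMr //.
    by rewrite exprn_ile1.
  have N0 : (0 : R) <= N%:R by [].
  by rewrite -natr1; nra.
- by rewrite exprS QE one_jump_step.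
Qed.

End NonnegativePolynomials.

Section TruncatedLaw.
Variable R : realType.
Variables (p : nat -> R) (mean th M : R).
Hypothesis p_ge0 : forall i, 0 <= p i.
Hypothesis p_sum1 : series p @ \oo --> (1 : R).
Hypothesis p_mean : series (fun m => m%:R * p m) @ \oo --> mean.
Hypotheses (th1 : 1 <= th) (th2 : th <= 2).
Hypothesis p_moment : series (fun m => m%:R `^ th * p m) @ \oo --> M.

Variables (n : nat) (L : R).
Hypotheses (L0 : 0 < L) (Ln : L <= n%:R).

Definition small_part := \poly_(m < n.+1) (if m%:R <= L then p m else 0).
Definition large_part := \poly_(m < n.+1) (if m%:R <= L then 0 else p m).

Lemma small_part_ge0 : nneg_poly small_part.
Proof. by move=> i; rewrite coef_poly; case: ifP => // _; case: ifP. Qed.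

Lemma large_part_ge0 : nneg_poly large_part.
Proof. by move=> i; rewrite coef_poly; case: ifP => // _; case: ifP. Qed.

Lemma small_large_part : small_part + large_part = \poly_(m < n.+1) p m.
Proof.
apply/polyP => i; rewrite coefD !coef_poly.
by case: ifP => _; [case: ifP => _|]; rewrite ?addr0 ?add0r.
Qed.

Lemma law_part_le1 : (small_part + large_part).[1] <= 1.
Proof.
rewrite small_large_part horner_poly; apply: le_trans (ler_psum_lim n.+1 p_ge0 p_sum1).
by apply: ler_sum => i _; rewrite expr1n mulr1.
Qed.

Let M0 : 0 <= M.
Proof.
apply: (cvgr_to_ge p_moment); apply: nearW => k; apply: sumr_ge0 => i _.
by rewrite mulr_ge0 ?powR_ge0.
Qed.

Let tail_le m : L < m%:R -> 1 <= L `^ (- th) * m%:R `^ th.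
Proof.
move=> Lm; rewrite powRN mulrC ler_pdivlMr ?powR_gt0 // mul1r.
have th0 : 0 <= th by rewrite (le_trans ler01).
by apply: (ge0_ler_powR th0 _ _ (ltW Lm)); rewrite nnegrE ?ler0n // ltW.
Qed.

Lemma large_part_le : large_part.[1] <= L `^ (- th) * M.
Proof.
rewrite horner_poly; apply: (@le_trans _ _ (L `^ (- th) * \sum_(i < n.+1) (i%:R `^ th * p i))).
  rewrite mulr_sumr ler_sum // => i _; rewrite expr1n mulr1.
  case: (leP i%:R L) => [_|Li]; first by rewrite !mulr_ge0 ?powR_ge0.
  by rewrite mulrA ler_peMl //; exact: tail_le.
rewrite ler_wpM2l ?powR_ge0 //; apply: (ler_psum_lim _ _ p_moment) => i.
by rewrite mulr_ge0 ?powR_ge0.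
Qed.

Lemma small_part_ge : 1 - L `^ (- th) * M <= small_part.[1].
Proof.
have H := cvgnB p_sum1 (cvgnMl (L `^ (- th)) p_moment).
apply: (cvgr_to_le H); near=> k.
have nk : (n < k)%N by near: k; exact: nbhs_infty_gt.
rewrite lerBlDr horner_poly -(big_mkord xpredT (fun i => (if i%:R <= L then p i else 0) * 1 ^+ i)).
rewrite /series /= !(big_cat_nat (leq0n n.+1) nk) /= mulrDr addrA lerD //.
  rewrite mulr_sumr -big_split /= ler_sum_nat // => i _; rewrite expr1n mulr1.
  case: (leP i%:R L) => Li; first by rewrite lerDl !mulr_ge0 ?powR_ge0.
  by rewrite add0r mulrA ler_peMl //; exact: tail_le.
rewrite mulr_sumr ler_sum_nat // => i /andP[ni _].
rewrite mulrA ler_peMl //; apply: tail_le; apply: le_lt_trans Ln _.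
by rewrite ltr_nat.
Unshelve. all: by end_near. Qed.

Let powth (v : R) : 0 <= v -> v <= 1 -> v ^+ 2 <= v `^ th.
Proof.
rewrite le_eqVlt => /predU1P[<- _|v0 v1].
  by rewrite expr0n powR_ge0.
by rewrite -powR_mulrn ?(ltW v0) // ger_powR ?v0.
Qed.

Lemma expR_le_powR (v : R) : 0 <= v <= 2^-1 -> expR v <= 1 + v + 2 * v `^ th.
Proof.
move=> /andP[v0 v1]; have v1' : v <= 1 by lra.
have H := powth v0 v1'; apply: le_trans (_ : 1 + v + 2 * v ^+ 2 <= _); last by lra.
have H1 := expRN_ge v.
have : expR v * (1 - v) <= 1.
  by apply: le_trans (ler_wpM2l (expR_ge0 v) H1) _; rewrite -expRD subrr expR0.
have e0 := expR_gt0 v; have H2 : 0 <= v ^+ 2 * (1 - 2 * v) by rewrite mulr_ge0 ?sqr_ge0 //; lra.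
have H3 : 0 < 1 - v by lra.
by move=> H4; rewrite -(ler_pM2r H3); apply: le_trans H4 _; nra.
Qed.

Lemma expRN_le_powR (v : R) : 0 <= v -> expR (- v) <= 1 - v + v `^ th.
Proof.
move=> v0; have [v1|v1] := leP v 1.
  have := powth v0 v1; have := expRN_le_sqr v0.
  suff : v ^+ 2 / (1 + v) <= v ^+ 2 by lra.
  by rewrite ler_pdivrMr ?ltr_pwDl // ler_peMr ?sqr_ge0 // lerDl.
have : v <= v `^ th by rewrite -[leLHS]powRr1 // ler_powR // ltW.
have : expR (- v) <= 1 by rewrite -expR0 ler_expR oppr_le0.
by lra.
Qed.

Let s := (2 * L)^-1.
Let s0 : 0 < s. Proof. by rewrite invr_gt0 mulr_gt0. Qed.

Lemma small_part_exp_le :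
  small_part.[expR s] <= expR (s * mean + 2 * (s `^ th * M)).
Proof.
apply: le_trans (expR_ge1Dx _); rewrite addrA.
have H := cvg_seriesD (cvg_seriesD p_sum1 (cvg_seriesMl (c := s) p_mean))
  (cvg_seriesMl (c := 2 * s `^ th) p_moment).
rewrite mulrA; apply: le_trans (ler_psum_lim n.+1 _ H); last first.
  by move=> i; rewrite !addr_ge0 // !mulr_ge0 ?powR_ge0 ?(ltW s0).
rewrite horner_poly ler_sum // => i _; case: ifP => iL; last first.
  by rewrite mul0r !addr_ge0 // !mulr_ge0 ?powR_ge0 ?(ltW s0).
have si : 0 <= i%:R * s <= 2^-1.
  rewrite mulr_ge0 ?(ltW s0) //= /s invfM mulrCA ler_piMr ?invr_ge0 //.
  by rewrite ler_pdivrMr // mul1r.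
rewrite -expRM_natl; apply: le_trans (ler_wpM2l (p_ge0 i) (expR_le_powR si)) _.
by rewrite powRM ?(ltW s0) //; move: (s `^ th) (i%:R `^ th) => a c; lra.
Qed.

Lemma small_part_expN_le :
  small_part.[expR (- s)] <= expR (- (s * mean) + s `^ th * M).
Proof.
apply: le_trans (expR_ge1Dx _); rewrite addrA.
have H := cvg_seriesD (cvg_seriesD p_sum1 (cvg_seriesMl (c := - s) p_mean))
  (cvg_seriesMl (c := s `^ th) p_moment).
have E i : p i * expR (- s) ^+ i <= p i + - s * (i%:R * p i) + s `^ th * (i%:R `^ th * p i).
  have si : 0 <= i%:R * s by rewrite mulr_ge0 ?(ltW s0).
  rewrite -expRM_natl mulrN; apply: le_trans (ler_wpM2l (p_ge0 i) (expRN_le_powR si)) _.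
  by rewrite powRM ?(ltW s0) //; move: (s `^ th) (i%:R `^ th) => a c; lra.
rewrite -mulNr; apply: le_trans (ler_psum_lim n.+1 _ H); last first.
  by move=> i; apply: le_trans (E i); rewrite mulr_ge0 ?exprn_ge0 ?expR_ge0.
rewrite horner_poly ler_sum // => i _; apply: le_trans (E i).
by case: ifP => _ //; rewrite mul0r mulr_ge0 ?exprn_ge0 ?expR_ge0.
Qed.

Let tau (N : nat) (d : R) := expR (- (s * d) + s * mean + 2 * N%:R * (s `^ th * M)).

Lemma small_part_tails (N K : nat) (d : R) :
  \sum_(j < K | d < `|j%:R - N%:R * mean|) (small_part ^+ N.-1)`_j <= 2 * tau N d.
Proof.
have q0 := nneg_polyX N.-1 small_part_ge0.
have mean0 : 0 <= mean.
  apply: (cvgr_to_ge p_mean); apply: nearW => k; apply: sumr_ge0 => i _.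
  by rewrite mulr_ge0.
have NN : (N.-1%:R : R) <= N%:R by rewrite ler_nat leq_pred.
have NN' : (N%:R : R) <= N.-1%:R + 1 by rewrite natr1 ler_nat leqSpred.
have sM : 0 <= s `^ th * M by rewrite mulr_ge0 ?powR_ge0.
have up : \sum_(j < K | N%:R * mean + d < j%:R) (small_part ^+ N.-1)`_j <= tau N d.
  apply: le_trans (@chernoff R _ (fun j => N%:R * mean + d < j%:R) K s (N%:R * mean + d) q0 _) _.
    by move=> j Hj; rewrite mulr_ge0 ?(ltW s0) // subr_ge0 ltW.
  rewrite horner_exp.
  have := lerXn2r N.-1 _ _ small_part_exp_le; rewrite !nnegrE => /(_ (nneg_horner_ge0 small_part_ge0 (expR_ge0 _)) (expR_ge0 _)) H.
  apply: le_trans (ler_wpM2l (expR_ge0 _) H) _.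
  rewrite -expRM_natl -expRD ler_expR.
  have Y0 : 0 <= s * mean by rewrite mulr_ge0 ?(ltW s0).
  move: (s `^ th * M) sM => X X0.
  have := ler_wpM2r X0 NN; have := ler_wpM2r Y0 NN; lra.
have dn : \sum_(j < K | j%:R < N%:R * mean - d) (small_part ^+ N.-1)`_j <= tau N d.
  apply: le_trans (@chernoff R _ (fun j => j%:R < N%:R * mean - d) K (- s) (N%:R * mean - d) q0 _) _.
    by move=> j Hj; rewrite mulNr -mulrN mulr_ge0 ?(ltW s0) // oppr_ge0 subr_le0 ltW.
  rewrite horner_exp.
  have := lerXn2r N.-1 _ _ small_part_expN_le; rewrite !nnegrE => /(_ (nneg_horner_ge0 small_part_ge0 (expR_ge0 _)) (expR_ge0 _)) H.
  apply: le_trans (ler_wpM2l (expR_ge0 _) H) _.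
  rewrite -expRM_natl -expRD ler_expR.
  have Y0 : 0 <= s * mean by rewrite mulr_ge0 ?(ltW s0).
  move: (s `^ th * M) sM => X X0.
  have := ler_wpM2r X0 NN; have := ler_wpM2r Y0 NN'; have := ler_wpM2r X0 (ler0n R N); lra.
have -> : 2 * tau N d = tau N d + tau N d by ring.
apply: le_trans (lerD up dn).
rewrite [leLHS]big_mkcond [X in _ <= X + _]big_mkcond [X in _ <= _ + X]big_mkcond -big_split /=.
apply: ler_sum => j _; have qj := q0 j.
have -> : (d < `|j%:R - N%:R * mean|) = (N%:R * mean + d < j%:R) || (j%:R < N%:R * mean - d).
  by rewrite lter_normr; congr (_ || _); lra.
by case: (_ < j%:R); case: (j%:R < _) => //=; rewrite ?addr0 ?add0r ?lerDl.
Qed.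

End TruncatedLaw.

Section BigJump.
Variable R : realType.

(* Uniformity over the indices satisfying [P n] only has to be tested along sequences:
   select a worst index whenever there is one. *)
Lemma cvg_uniform_selection (P : nat -> nat -> Prop) (F : nat -> nat -> R) (v : R) :
  (\forall n \near \oo, exists m, P n m) ->
  (forall m : nat -> nat, (\forall n \near \oo, P n (m n)) ->
     F n (m n) @[n --> \oo] --> v) ->
  forall e : R, 0 < e -> \forall n \near \oo, forall m, P n m -> `|F n m - v| <= e.
Proof.
move=> Pex Fv e e0.
have H n : exists k, ((exists m', P n m') -> P n k) /\
    ((exists m', P n m' /\ e < `|F n m' - v|) -> e < `|F n k - v|).
  have [[k [Pk ek]]|nb] := pselect (exists m', P n m' /\ e < `|F n m' - v|).
    by exists k.
  have [[k Pk]|np] := pselect (exists m', P n m'); first by exists k.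
  by exists 0%N.
have [m Hm] := choice H.
have /Fv/cvgrPdist_le/(_ e e0) H' : \forall n \near \oo, P n (m n).
  by apply: filterS Pex => n; have [] := Hm n.
apply: filterS H' => n Hn k Pk; rewrite leNgt; apply/negP => ek.
have [_ /(_ (ex_intro _ k (conj Pk ek)))] := Hm n.
by rewrite ltNge distrC Hn.
Qed.

Lemma bernoulli_le (a : R) (k : nat) : 0 <= a -> a <= 1 -> 1 - k%:R * (1 - a) <= a ^+ k.
Proof.
move=> a0 a1; elim: k => [|k IHk]; first by rewrite expr0 mul0r subr0.
rewrite exprS -natr1; have := ler_wpM2l a0 IHk.
have : 0 <= k%:R * (1 - a) ^+ 2 by rewrite mulr_ge0 ?sqr_ge0.
by move: (k%:R) (a ^+ k) => K X; nra.
Qed.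

Variables (p : nat -> R) (al be mean lam : R) (N : nat -> nat).
Hypothesis p_ge0 : forall i, 0 <= p i.
Hypothesis p_sum1 : series p @ \oo --> (1 : R).
Hypothesis p_mean : series (fun m => m%:R * p m) @ \oo --> mean.
Hypotheses (al1 : 1 < al) (al2 : al < 2) (be0 : 0 < be).
Hypothesis p_tail : p m * m%:R `^ (1 + al) @[m --> \oo] --> be.
Hypotheses (lam0 : 0 < lam) (mean0 : 0 < mean) (lam_mean : lam * mean < 1).
Hypothesis Nlam : (N n)%:R / n%:R @[n --> \oo] --> lam.

(* A moment exponent th with 1 < th < al, and ep so small that the law cut at n^(1-ep)
   has negligible Chernoff corrections ((1 - ep) th > 1) and that two jumps above the
   cut cost o(n^-al). *)
Let th := (1 + al) / 2.
Let ep := (th - 1) / (2 * (1 + al + th)).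
Let r := 1 - lam * mean.
Let v := lam * be * r `^ (- (1 + al)).

Let th1 : 1 < th. Proof. by rewrite /th; have := al1; lra. Qed.
Let th2 : th <= 2. Proof. by rewrite /th; have := al2; lra. Qed.
Let r0 : 0 < r. Proof. by rewrite subr_gt0. Qed.
Let D0 : 0 < 2 * (1 + al + th). Proof. by have := th1; have := al1; lra. Qed.
Let ep0 : 0 < ep. Proof. by rewrite divr_gt0 // subr_gt0. Qed.
Let epE : ep * (2 * (1 + al + th)) = th - 1. Proof. by rewrite divfK // gt_eqF. Qed.
Let ep1 : ep < 1. Proof. by rewrite ltr_pdivrMr // mul1r; have := th1; have := al1; lra. Qed.
Let epth : 1 - (1 - ep) * th < 0. Proof. by have := epE; have := ep0; have := th1; have := al1; nra. Qed.
Let epal : al + 2 - (1 - ep) * (1 + al + th) < 0.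
Proof. by have := epE; have := ep0; have := th1; have := al1; nra. Qed.
Let v0 : 0 <= v. Proof. by rewrite !mulr_ge0 ?powR_ge0 ?(ltW lam0) ?(ltW be0). Qed.

Let x (n : nat) : R := n%:R.
Let L n := x n `^ (1 - ep).
Let s n := (2 * L n)^-1.
Let d n := x n `^ (1 - ep / 2).

Let xoo : x @ \oo --> +oo. Proof. exact: cvgr_idn. Qed.
Let x_gt0 : \forall n \near \oo, 0 < x n.
Proof. by near=> n; rewrite ltr0n; near: n; exact: nbhs_infty_gt.
Unshelve. all: by end_near. Qed.

Let Mex : exists M : R, series (fun m => m%:R `^ th * p m) @ \oo --> M.
Proof.
suff /cvg_ex : cvgn (series (fun m => m%:R `^ th * p m)) by [].
have a1 : 1 < 1 + al - th by rewrite /th; have := al1; lra.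
apply: (cvg_series_tail a1) => [m|]; first by rewrite mulr_ge0 ?powR_ge0.
apply: (cvgn_near p_tail); near=> m.
have m0 : (0 : R) < m%:R by rewrite ltr0n; near: m; exact: nbhs_infty_gt.
have -> : m%:R `^ (1 + al) = m%:R `^ th * m%:R `^ (1 + al - th) :> R.
  by rewrite -powRD_gt0 //; congr (_ `^ _); ring.
by ring.
Unshelve. all: by end_near. Qed.

Let sE n : 0 < x n -> s n = 2^-1 * x n `^ (ep - 1).
Proof. by move=> xn; rewrite /s /L invfM -powRN opprB. Qed.

Let s_cvg0 : s @ \oo --> (0 : R).
Proof.
have e1 : ep - 1 < 0 by rewrite subr_lt0.
apply: (cvgn_near (cvgnMl0 2^-1 (cvgn0_powRy e1 xoo))).
by apply: filterS x_gt0 => n xn; rewrite sE.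
Qed.

Let Ns_cvg0 (N' : nat -> nat) : (N' n)%:R / x n @[n --> \oo] --> lam ->
  (N' n)%:R * s n `^ th @[n --> \oo] --> (0 : R).
Proof.
move=> N'lam; have H := cvgnM N'lam (cvgnMl0 (2^-1 `^ th) (cvgn0_powRy epth xoo)).
rewrite mulr0 in H; apply: (cvgn_near H); apply: filterS x_gt0 => n xn.
rewrite sE // powRM ?powR_ge0 // -powRrM.
have -> : 1 - (1 - ep) * th = 1 + (ep - 1) * th by ring.
by rewrite [x n `^ (1 + _)]powRD_gt0 // powRr1 ?(ltW xn) //; field; rewrite gt_eqF.
Qed.

Let tail_cvg0 (N' : nat -> nat) (M k : R) : (N' n)%:R / x n @[n --> \oo] --> lam ->
  x n `^ k * expR (- (s n * d n) + s n * mean + 2 * (N' n)%:R * (s n `^ th * M))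
    @[n --> \oo] --> (0 : R).
Proof.
move=> N'lam.
have e20 : 0 < ep / 2 by rewrite divr_gt0.
have H := cvgnMr0 (expR 1) (cvgn0_powR_expR (t := 2) k e20 (ltr0Sn R 1)).
have H1 := cvgnD (cvgnMr0 mean s_cvg0) (cvgnMr0 (2 * M) (Ns_cvg0 N'lam)).
rewrite addr0 in H1.
apply: (cvgn0_le _ H); near=> n.
have xn : 0 < x n by near: n; exact: x_gt0.
have En : s n * mean + (N' n)%:R * s n `^ th * (2 * M) <= 1.
  by near: n; apply: (cvgr_le (0 : R)) => //; exact: H1.
rewrite ger0_norm ?mulr_ge0 ?powR_ge0 ?expR_ge0 // -[leRHS]mulrA ler_wpM2l ?powR_ge0 //.
rewrite -expRD ler_expR -addrA.
have -> : s n * d n = x n `^ (ep / 2) / 2.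
  rewrite sE // /d -mulrA -powRD_gt0 // mulrC; congr (_ `^ _ * _).
  by field.
by rewrite lerD2l; apply: le_trans En; rewrite lerD2l le_eqVlt; apply/orP; left; apply/eqP; ring.
Unshelve. all: by end_near. Qed.

Let g n := small_part p n (L n).
Let h n := large_part p n (L n).
Let q n := g n ^+ (N n).-1.
Let Phi n m := x n `^ al * (N n)%:R * (h n)`_m.
Let good n m := `|m%:R - (x n - (N n)%:R * mean)| <= d n.

Let dx0 : d n / x n @[n --> \oo] --> (0 : R).
Proof.
have e1 : - (ep / 2) < 0 by rewrite oppr_lt0 divr_gt0.
apply: (cvgn_near (cvgn0_powRy e1 xoo)); apply: filterS x_gt0 => n xn.
by rewrite /d powRD_gt0 // powRr1 ?(ltW xn) // [RHS]mulrC mulKf // gt_eqF.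
Qed.

Let Lx0 : L n / x n @[n --> \oo] --> (0 : R).
Proof.
have e1 : - ep < 0 by rewrite oppr_lt0.
apply: (cvgn_near (cvgn0_powRy e1 xoo)); apply: filterS x_gt0 => n xn.
by rewrite /L powRD_gt0 // powRr1 ?(ltW xn) // [RHS]mulrC mulKf // gt_eqF.
Qed.

Lemma good_cvg (m : nat -> nat) : (\forall n \near \oo, good n (m n)) ->
  (m n)%:R / x n @[n --> \oo] --> r.
Proof.
move=> Hm.
have H : (m n)%:R / x n - (1 - (N n)%:R / x n * mean) @[n --> \oo] --> (0 : R).
  apply: (cvgn0_le _ dx0); near=> n.
  have xn : 0 < x n by near: n; exact: x_gt0.
  have gn : good n (m n) by near: n; exact: Hm.
  have -> : (m n)%:R / x n - (1 - (N n)%:R / x n * mean) =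
     ((m n)%:R - (x n - (N n)%:R * mean)) / x n by field; rewrite gt_eqF.
  by rewrite normrM [X in _ * X]ger0_norm ?invr_ge0 ?(ltW xn) // ler_wpM2r ?invr_ge0 ?(ltW xn).
apply: cvgn_ext; [exact: (cvgnD H (cvgnB (cvg_cst (1 : R)) (cvgnMr mean Nlam)))| |by rewrite add0r] => n /=.
by rewrite subrK.
Unshelve. all: by end_near. Qed.

Lemma good_Phi (m : nat -> nat) : (\forall n \near \oo, good n (m n)) ->
  Phi n (m n) @[n --> \oo] --> v.
Proof.
move=> Hm; have mr := good_cvg Hm.
have moo : ((m n)%:R : R) @[n --> \oo] --> +oo.
  have r2 : 0 < r / 2 by rewrite divr_gt0.
  have := cvgnyMl r2 xoo; apply: ger_cvgy; near=> n.
  have xn : 0 < x n by near: n; exact: x_gt0.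
  rewrite -ler_pdivlMr //; near: n; apply: (cvgr_ge r) => //.
  by rewrite ltr_pdivrMr // ltr_pMr // ltr1n.
have moo' : m @ \oo --> \oo.
  apply/cvgnyPge => A; have /cvgryPge/(_ A%:R) := moo.
  by apply: filterS => n; rewrite ler_nat.
have pm : p (m n) * (m n)%:R `^ (1 + al) @[n --> \oo] --> be.
  exact: (cvg_comp _ _ moo' p_tail).
have r1 : r < 1 by rewrite ltrBlDr ltrDl mulr_gt0.
have mr' := cvgn_powR (a := - (1 + al)) r0 mr.
have H := cvgnM (cvgnM Nlam pm) mr'.
apply: (cvgn_near H); near=> n.
have xn : 0 < x n by near: n; exact: x_gt0.
have mn : (m n <= n)%N.
  have : (m n)%:R / x n <= 1 by near: n; apply: (cvgr_le r) => //; exact: r1.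
  by rewrite ler_pdivrMr // mul1r ler_nat.
have mL : L n < (m n)%:R.
  rewrite -(ltr_pM2r (x := (x n)^-1)) ?invr_gt0 // -subr_gt0.
  by near: n; apply: (cvgr_gt (r - 0)); [exact: (cvgnB mr Lx0)|rewrite subr0].
have m0 : 0 < ((m n)%:R : R) by apply: le_lt_trans mL; rewrite powR_ge0.
rewrite /Phi /h coef_poly ltnS mn leNgt mL /=.
rewrite powRM ?(ltW m0) ?invr_ge0 ?(ltW xn) // -[(x n)^-1]powR_inv1 ?(ltW xn) // -[in X in _ * (_ * X)]powRrM.
rewrite (_ : -1 * - (1 + al) = 1 + al); last by ring.
rewrite [x n `^ (1 + al)]powRD_gt0 // powRr1 ?(ltW xn) // powR_inv1 ?(ltW xn) // powRN.
by field; rewrite !gt_eqF ?powR_gt0.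
Unshelve. all: by end_near. Qed.

Lemma big_jump_limit :
  n%:R `^ al * cpow p (N n) n @[n --> \oo] --> v.
Proof.
have [M HM] := Mex; have th1' := ltW th1.
have M0 : 0 <= M.
  apply: (cvgr_to_ge HM); apply: nearW => k; apply: sumr_ge0 => i _.
  by rewrite mulr_ge0 ?powR_ge0.
have p_le1 m : p m <= 1.
  apply: le_trans (ler_psum_lim m.+1 p_ge0 p_sum1).
  by rewrite big_ord_recr /= lerDr sumr_ge0.
pose tau (N' : nat) n := expR (- (s n * d n) + s n * mean + 2 * N'%:R * (s n `^ th * M)).
have NSlam : (N n).+1%:R / x n @[n --> \oo] --> lam.
  have e1 : - 1 < 0 :> R by rewrite oppr_lt0.
  apply: (@cvgn_near _ (fun n => (N n)%:R / n%:R + x n `^ (-1)) _ lam).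
    by apply: cvgn_ext; [exact: (cvgnD Nlam (cvgn0_powRy e1 xoo))| |by rewrite addr0].
  apply: filterS x_gt0 => n xn; by rewrite -natr1 mulrDl mul1r powR_inv1 ?(ltW xn).
have L_gt0 n : 0 < x n -> 0 < L n by exact: powR_gt0.
have L_le : \forall n \near \oo, L n <= n%:R.
  near=> n; have n1 : (0 < n)%N by near: n; exact: nbhs_infty_gt.
  rewrite -[leRHS]powRr1 // ler_powR ?ler1n // gerBl; exact: ltW.
have d_lt N' : (N' n)%:R / x n @[n --> \oo] --> lam ->
    \forall n \near \oo, d n < x n - (N' n)%:R * mean.
  move=> N'lam; near=> n; have xn : 0 < x n by near: n; exact: x_gt0.
  rewrite -subr_gt0 -(pmulr_lgt0 _ (x := (x n)^-1)) ?invr_gt0 //.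
  have -> : (x n - (N' n)%:R * mean - d n) / x n = 1 - (N' n)%:R / x n * mean - d n / x n.
    by field; rewrite gt_eqF.
  near: n; apply: (cvgr_gt (r - 0)); last by rewrite subr0.
  exact: (cvgnB (cvgnB (cvg_cst (1 : R)) (cvgnMr mean N'lam)) dx0).
have goodW : \forall n \near \oo, exists m, good n m.
  near=> n; have dn : d n < x n - (N n)%:R * mean by near: n; exact: (d_lt N).
  have d0 : 0 <= d n by exact: powR_ge0.
  have d1 : 1 <= d n.
    have n1 : (0 < n)%N by near: n; exact: nbhs_infty_gt.
    rewrite -[leLHS](powRr0 (x n)) ler_powR ?ler1n // subr_ge0.
    by have := ep1; lra.
  exists (Num.truncn (x n - (N n)%:R * mean)).
  have y0 : 0 <= x n - (N n)%:R * mean by apply: le_trans d0 (ltW dn).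
  have /andP[t1 t2] := truncn_itv y0.
  rewrite /good ler_norml; rewrite -natr1 in t2; move: t1 t2; set t := (Num.truncn _)%:R => t1 t2.
  by apply/andP; split; lra.
have U := cvg_uniform_selection goodW good_Phi.
have tails N' n K : 0 < x n ->
    \sum_(j < K | d n < `|j%:R - N'%:R * mean|) (g n ^+ N'.-1)`_j <= 2 * tau N' n.
  move=> xn.
  exact: (@small_part_tails R p mean th M p_ge0 p_sum1 p_mean th1' th2 HM n (L n) (L_gt0 n xn)).
have C1 : x n `^ al * (g n ^+ N n)`_n @[n --> \oo] --> (0 : R).
  have H := cvgnMl0 2 (tail_cvg0 M al NSlam).
  apply: (cvgn0_le _ H); near=> n.
  have xn : 0 < x n by near: n; exact: x_gt0.
  have Ln : L n <= n%:R by near: n; exact: L_le.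
  have gn0 := small_part_ge0 p_ge0 n (L n).
  rewrite ger0_norm ?mulr_ge0 ?powR_ge0 //; last exact: nneg_polyX.
  rewrite mulrCA ler_wpM2l ?powR_ge0 //; apply: le_trans (tails (N n).+1 n n.+1 xn).
  have dn : d n < x n - (N n).+1%:R * mean by near: n; exact: (d_lt (fun n => (N n).+1)).
  rewrite (bigD1 ord_max) /=; last by rewrite (lt_le_trans dn) // ler_norm.
  by rewrite lerDl sumr_ge0 // => j _; exact: nneg_polyX.
have C2 (Q : nat -> {poly R}) : (forall n, nneg_poly (Q n)) ->
    (forall n, (Q n).[1] <= (N n)%:R ^+ 2 * (h n).[1]) ->
    x n `^ al * (h n * Q n)`_n @[n --> \oo] --> (0 : R).
  move=> Q0 Q1; have [B B0 pB] := cvgn_bounded p_tail.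
  have H := cvgnM (cvgnM Nlam Nlam) (cvgnMr0 (B * M) (cvgn0_powRy epal xoo)).
  rewrite mulr0 in H; apply: (cvgn0_le _ H); near=> n.
  have xn : 0 < x n by near: n; exact: x_gt0.
  have L0 := L_gt0 n xn.
  have hL := large_part_le p_ge0 th1' HM n L0.
  have hQ0 : 0 <= (h n * Q n)`_n.
    by apply: nneg_polyM => //; exact: large_part_ge0.
  rewrite ger0_norm ?mulr_ge0 ?powR_ge0 //.
  have S0 : 0 <= B * L n `^ (- (1 + al)) by rewrite mulr_ge0 ?powR_ge0 // ltW.
  have hS i : (h n)`_i <= B * L n `^ (- (1 + al)).
    rewrite coef_poly; case: ifP => // _; case: (leP i%:R (L n)) => // Li.
    rewrite powRN ler_pdivlMr ?powR_gt0 //.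
    have i0 : 0 < i%:R :> R by exact: lt_trans Li.
    have al0 : 0 <= 1 + al by have := al1; lra.
    apply: le_trans (le_trans (ler_norm _) (pB i)); rewrite ler_wpM2l //.
    by apply: (ge0_ler_powR al0 _ _ (ltW Li)); rewrite nnegrE ?ler0n // ltW.
  have H1 := coefM_le_horner1 n (Q0 n) S0 hS.
  have H2 := le_trans (Q1 n) (ler_wpM2l (sqr_ge0 _) hL).
  have H3 := le_trans H1 (ler_wpM2l S0 H2).
  apply: le_trans (ler_wpM2l (powR_ge0 _ _) H3) _; rewrite le_eqVlt; apply/orP; left; apply/eqP.
  have -> : L n `^ (- (1 + al)) = x n `^ (- ((1 - ep) * (1 + al))) by rewrite /L -powRrM mulrN.
  have -> : L n `^ (- th) = x n `^ (- ((1 - ep) * th)) by rewrite /L -powRrM mulrN.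
  have -> : al + 2 - (1 - ep) * (1 + al + th) =
    al + (2%:R + (- ((1 - ep) * (1 + al)) + - ((1 - ep) * th))) by ring.
  rewrite 4?powRD_gt0 // !powRr1 ?(ltW xn) // /x.
  by field; rewrite gt_eqF.
have q1 : (q n).[1] @[n --> \oo] --> (1 : R).
  have H := cvgnM Nlam (cvgnMr0 M (cvgn0_powRy epth xoo)); rewrite mulr0 in H.
  suff H1 : (q n).[1] - 1 @[n --> \oo] --> (0 : R).
    by apply: cvgn_ext; [exact: (cvgnD H1 (cvg_cst (1 : R)))| |by rewrite add0r] => n /=; rewrite subrK.
  apply: (cvgn0_le _ H); near=> n.
  have xn : 0 < x n by near: n; exact: x_gt0.
  have Ln : L n <= n%:R by near: n; exact: L_le.
  have h10 := nneg_horner_ge0 (large_part_ge0 p_ge0 n (L n)) ler01.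
  have g10 := nneg_horner_ge0 (small_part_ge0 p_ge0 n (L n)) ler01.
  have g11 : (g n).[1] <= 1.
    by have := law_part_le1 p_ge0 p_sum1 n (L n); rewrite hornerD -/(g n); lra.
  have g1L := small_part_ge p_ge0 p_sum1 th1' HM (L_gt0 n xn) Ln.
  rewrite ler0_norm; last by rewrite subr_le0 horner_exp exprn_ile1.
  rewrite opprB horner_exp; have := bernoulli_le (N n).-1 g10 g11.
  have NN : ((N n).-1%:R : R) <= (N n)%:R by rewrite ler_nat leq_pred.
  have gg : 0 <= 1 - (g n).[1] by rewrite subr_ge0.
  have := ler_wpM2r gg NN.
  have E : (N n)%:R / n%:R * (x n `^ (1 - (1 - ep) * th) * M) = (N n)%:R * (L n `^ (- th) * M).
    have -> : L n `^ (- th) = x n `^ (- ((1 - ep) * th)) by rewrite /L -powRrM mulrN.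
    by rewrite powRD_gt0 // powRr1 ?(ltW xn) // /x; field; rewrite gt_eqF.
  rewrite E; have := ler_wpM2l (ler0n R (N n)) (_ : 1 - (g n).[1] <= L n `^ (- th) * M).
  rewrite lerBlDl -lerBlDr => /(_ g1L).
  by lra.
have C3 : x n `^ al * (N n)%:R * (h n * q n)`_n @[n --> \oo] --> v.
  pose T n := 2 * (x n `^ (al + 1) * ((N n)%:R / n%:R + v) * tau (N n) n) + v * `|(q n).[1] - 1|.
  have T0 : T @ \oo --> (0 : R).
    have HN : (N n)%:R / n%:R + v @[n --> \oo] --> lam + v by exact: (cvgnD Nlam (cvg_cst v)).
    have H1 := cvgnM HN (tail_cvg0 M (al + 1) Nlam); rewrite mulr0 in H1.
    have H2 : `|(q n).[1] - 1| @[n --> \oo] --> (0 : R).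
      have H2 := cvg_norm (cvgnB q1 (cvg_cst (1 : R))).
      by rewrite subrr normr0 in H2; exact: H2.
    apply: cvgn_ext; [exact: (cvgnD (cvgnMl0 2 H1) (cvgnMl0 v H2))| |by rewrite addr0] => n.
    by rewrite /T /tau; ring.
  apply/cvgrPdist_le => e e0; have e2 : 0 < e / 2 by rewrite divr_gt0.
  have U2 := U _ e2; near=> n.
  have xn : 0 < x n by near: n; exact: x_gt0.
  have dn : d n < x n - (N n)%:R * mean by near: n; exact: (d_lt N).
  have Un : forall m, good n m -> `|Phi n m - v| <= e / 2 by near: n; exact: U2.
  have Tn : T n <= e / 2 by near: n; apply: (cvgr_le (0 : R)).
  have n1 : 1 <= x n.
    by rewrite ler1n; near: n; exact: nbhs_infty_gt.
  have q0 j : 0 <= (q n)`_j by apply: nneg_polyX; exact: small_part_ge0.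
  have h00 : (h n)`_0 = 0 by rewrite coef_poly /= powR_ge0.
  have h1 m : 0 <= (h n)`_m <= 1.
    by rewrite coef_poly; case: ifP => _; [case: ifP => _|]; rewrite ?lexx ?ler01 ?p_ge0 ?p_le1.
  pose K := (n.+1 + size (q n))%N.
  have qE : (q n).[1] = \sum_(j < K) (q n)`_j.
    rewrite (@horner_coef_wide _ K) ?leq_addl //.
    by apply: eq_bigr => j _; rewrite expr1n mulr1.
  have hqE : x n `^ al * (N n)%:R * (h n * q n)`_n = \sum_(j < K) (q n)`_j * Phi n (n - j).
    rewrite coefMr big_split_ord /= [X in _ = _ + X]big1 => [|j _]; last first.
      by rewrite /Phi (_ : (n - (n.+1 + j) = 0)%N) ?h00 ?mulr0 //; apply/eqP; rewrite subn_eq0 (leq_trans (leqnSn n)) ?leq_addr.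
    rewrite addr0 mulr_sumr; apply: eq_bigr => j _.
    by rewrite /Phi; ring.
  have -> : v - x n `^ al * (N n)%:R * (h n * q n)`_n =
      - (v * ((q n).[1] - 1)) - \sum_(j < K) (q n)`_j * (Phi n (n - j) - v).
    rewrite hqE qE.
    under [X in _ = _ - X]eq_bigr do rewrite mulrBr.
    by rewrite sumrB -mulr_suml; ring.
  apply: le_trans (ler_normB _ _) _; rewrite normrN normrM (ger0_norm v0).
  have q11 : (q n).[1] <= 1.
    have g10 := nneg_horner_ge0 (small_part_ge0 p_ge0 n (L n)) ler01.
    have h10 := nneg_horner_ge0 (large_part_ge0 p_ge0 n (L n)) ler01.
    rewrite horner_exp exprn_ile1 //.
    by have := law_part_le1 p_ge0 p_sum1 n (L n); rewrite hornerD -/(g n); lra.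
  have Phi_le m : `|Phi n m - v| <= x n `^ (al + 1) * ((N n)%:R / n%:R + v).
    have /andP[hm0 hm1] := h1 m; have X1 : 1 <= x n `^ (al + 1).
      by rewrite -[leLHS](powRr0 (x n)) ler_powR //; have := al1; lra.
    have E : x n `^ (al + 1) * ((N n)%:R / n%:R) = x n `^ al * (N n)%:R.
      by rewrite powRD_gt0 // powRr1 ?(ltW xn) // /x; field; rewrite gt_eqF.
    have P0 : 0 <= Phi n m by rewrite !mulr_ge0 ?powR_ge0.
    have P1 : Phi n m <= x n `^ al * (N n)%:R by rewrite ler_piMr // mulr_ge0 ?powR_ge0.
    have V1 : v <= x n `^ (al + 1) * v by rewrite ler_peMl.
    have V0 := v0; rewrite mulrDr E.
    rewrite ler_norml; apply/andP; split; lra.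
  have S1 : `|\sum_(j < K) (q n)`_j * (Phi n (n - j) - v)| <=
     e / 2 + 2 * (x n `^ (al + 1) * ((N n)%:R / n%:R + v) * tau (N n) n).
    apply: le_trans (ler_norm_sum _ _ _) _.
    rewrite (bigID (fun j : 'I_K => d n < `|j%:R - (N n)%:R * mean|)) /= addrC.
    apply: lerD.
      apply: (@le_trans _ _ (e / 2 * (q n).[1])); last by rewrite ler_piMr // ltW.
      rewrite qE mulr_sumr [leLHS]big_mkcond ler_sum // => j _.
      case: ifP => [|_]; last by rewrite mulr_ge0 ?(ltW e2).
      rewrite -leNgt => jd; rewrite normrM (ger0_norm (q0 j)) mulrC ler_wpM2r //.
      apply: Un; have jn : (j <= n)%N.
        rewrite -(ler_nat R); have := ler_norm (j%:R - (N n)%:R * mean).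
        by move: dn jd; rewrite /x; lra.
      rewrite /good natrB // distrC /x.
      by apply: le_trans jd; rewrite le_eqVlt; apply/orP; left; apply/eqP; congr `|_|; ring.
    have -> : 2 * (x n `^ (al + 1) * ((N n)%:R / n%:R + v) * tau (N n) n) =
       x n `^ (al + 1) * ((N n)%:R / n%:R + v) * (2 * tau (N n) n) by ring.
    have NV : 0 <= x n `^ (al + 1) * ((N n)%:R / n%:R + v).
      by rewrite mulr_ge0 ?powR_ge0 // addr_ge0 // divr_ge0.
    apply: le_trans (ler_wpM2l NV (tails (N n) n K xn)).
    rewrite mulr_sumr ler_sum // => j _.
    by rewrite normrM (ger0_norm (q0 j)) mulrC ler_wpM2r.
  by move: Tn S1; rewrite /T; lra.
have HQ n : exists Q, [/\ nneg_poly Q, Q.[1] <= (N n)%:R ^+ 2 * (h n).[1] &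
    (g n + h n) ^+ N n = g n ^+ N n + (h n * g n ^+ (N n).-1) *+ N n + h n * Q].
  apply: one_jump_expansion; [exact: small_part_ge0|exact: large_part_ge0|].
  exact: (law_part_le1 p_ge0 p_sum1).
have [Q HQn] := choice HQ.
have Q0 n : nneg_poly (Q n) by have [] := HQn n.
have Q1 n : (Q n).[1] <= (N n)%:R ^+ 2 * (h n).[1] by have [] := HQn n.
apply: cvgn_ext; [exact: (cvgnD (cvgnD C1 C3) (C2 Q Q0 Q1))| |by rewrite add0r addr0] => n.
rewrite (cpow_poly p (N n) (leqnn n)) -(small_large_part p n (L n)).
have [_ _ ->] := HQn n.
by rewrite !coefD coefMn /x /q; ring.
Unshelve. all: by end_near. Qed.

End BigJump.

(** * Saddle points of power series *)

Section PowerSeries.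
Variable R : realType.

Lemma cvgn_seriesD (u v : nat -> R) : cvgn (series u) -> cvgn (series v) ->
  cvgn (series (fun m => u m + v m)).
Proof.
move=> /cvg_ex[k Hk] /cvg_ex[l Hl]; apply/cvg_ex; exists (k + l).
exact: (cvg_seriesD Hk Hl).
Qed.

Lemma cvgn_seriesMl (c : R) (u : nat -> R) : cvgn (series u) ->
  cvgn (series (fun m => c * u m)).
Proof.
move=> /cvg_ex[k Hk]; apply/cvg_ex; exists (c * k).
exact: (cvg_seriesMl (c := c) Hk).
Qed.

Lemma cvgn_series_eq (u v : nat -> R) : cvgn (series u) -> (forall m, u m = v m) ->
  cvgn (series v).
Proof. by move=> H uv; rewrite (_ : v = u) //; apply/funext => m; rewrite uv. Qed.

Lemma cvg_pseries_diffs (f : nat -> R) (x l : R) : 0 < x ->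
  series (fun m => m%:R * f m * x ^+ m) @ \oo --> l ->
  pseries (pseries_diffs f) x @ \oo --> l / x.
Proof.
move=> x0 H; have H1 := cvg_seriesMl (c := x^-1) (cvg_series_shift H).
apply: (cvg_series_eq H1) => [m|]; last by rewrite /= !mul0r subr0 mulrC.
by rewrite /pseries_diffs exprS /=; field; rewrite gt_eqF.
Qed.

Lemma cvg_pseries_diffs2 (f : nat -> R) (x l : R) : 0 < x ->
  series (fun m => m%:R * (m%:R - 1) * f m * x ^+ m) @ \oo --> l ->
  pseries (pseries_diffs (pseries_diffs f)) x @ \oo --> l / x ^+ 2.
Proof.
move=> x0 H; have H1 := cvg_seriesMl (c := x^-1) (cvg_series_shift H).
have H2 : series (fun m => m%:R * pseries_diffs f m * x ^+ m) @ \oo --> l / x.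
  apply: (cvg_series_eq H1) => [m|]; last by rewrite /= !mul0r subr0 mulrC.
  rewrite /pseries_diffs exprS -natr1 addrK /=; field.
  by rewrite gt_eqF.
have := cvg_pseries_diffs x0 H2; rewrite -mulrA -invfM -expr2; exact.
Qed.

End PowerSeries.

Section CriticalSeries.
Variable R : realType.
Variables (c : nat -> R) (rho al b : R).
Hypothesis c_ge0 : forall m, 0 <= c m.
Hypotheses (rho0 : 0 < rho) (al1 : 1 < al).
Hypothesis c_tail : c m * rho ^+ m * m%:R `^ (1 + al) @[m --> \oo] --> b.

Lemma cvgn_critical : cvgn (series (fun m => c m * rho ^+ m)).
Proof.
have a1 : 1 < 1 + al by have := al1; lra.
by apply: (cvg_series_tail a1 _ c_tail) => m; rewrite mulr_ge0 ?exprn_ge0 // ltW.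
Qed.

Lemma cvgn_critical1 : cvgn (series (fun m => m%:R * c m * rho ^+ m)).
Proof.
apply: (cvg_series_tail (l := b) al1) => [m|].
  by rewrite !mulr_ge0 ?exprn_ge0 // ltW.
apply: (cvgn_near c_tail); near=> m.
have m0 : (0 : R) < m%:R by rewrite ltr0n; near: m; exact: nbhs_infty_gt.
by rewrite powRD_gt0 // powRr1 ?(ltW m0) //; ring.
Unshelve. all: by end_near. Qed.

Lemma cvgn_subcritical (x : R) (k : nat) : 0 <= x -> x < rho ->
  cvgn (series (fun m => m%:R ^+ k * c m * x ^+ m)).
Proof.
rewrite le_eqVlt => /predU1P[<- _|x0 xr].
  apply/cvg_ex; exists (0%:R ^+ k * c 0%N * 0 ^+ 0 + 0); apply: cvg_series_unshift.
  apply: cvgn_ext; [exact: (cvg_cst (0 : R))| |by []] => n.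
  by rewrite /series /= big1 // => i _; rewrite exprS mul0r mulr0.
have y0 : 0 < x / rho by rewrite divr_gt0.
have y1 : x / rho < 1 by rewrite ltr_pdivrMr // mul1r.
have H := cvgnM c_tail (cvgn0_powR_geometric (k%:R + 2 - (1 + al)) y0 y1).
rewrite mulr0 in H.
apply: (cvg_series_tail (a := 2) (l := 0)) => [||]; first by rewrite ltr1n.
  by move=> m; rewrite !mulr_ge0 ?exprn_ge0 // ltW.
apply: (cvgn_near H); near=> m.
have m0 : (0 : R) < m%:R by rewrite ltr0n; near: m; exact: nbhs_infty_gt.
have E : m%:R ^+ k * m%:R `^ 2 = m%:R `^ (1 + al) * m%:R `^ (k%:R + 2 - (1 + al)) :> R.
  by rewrite -powR_mulrn ?(ltW m0) // -!powRD_gt0 //; congr (_ `^ _); ring.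
have E2 : x ^+ m = rho ^+ m * (x / rho) ^+ m.
  by rewrite -exprMn mulrC divfK // gt_eqF.
rewrite E2; transitivity (c m * rho ^+ m * (x / rho) ^+ m * (m%:R ^+ k * m%:R `^ 2)); last by ring.
by rewrite E; ring.
Unshelve. all: by end_near. Qed.

Hypotheses (c00 : c 0%N = 0) (c10 : 0 < c 1%N).

Lemma series_gt0 (x l : R) : 0 < x ->
  series (fun m => c m * x ^+ m) @ \oo --> l -> 0 < l.
Proof.
move=> x0 H; apply: (@lt_le_trans _ _ (\sum_(i < 2) c i * x ^+ i)).
  by rewrite !big_ord_recl big_ord0 /= c00 mul0r add0r addr0 mulr_gt0 // expr1.
by apply: ler_psum_lim H => m; rewrite mulr_ge0 ?exprn_ge0 // ltW.
Qed.

Variable ell : R.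
Hypothesis ell1 : 1 < ell.
Let e m := c m * (m%:R - ell).
Let D (x : R) := limn (pseries e x).

Let e_cvg (k : nat) (x : R) : 0 <= x -> x < rho -> cvgn (series (fun m => m%:R ^+ k * e m * x ^+ m)).
Proof.
move=> x0 xr.
have H := cvgn_seriesD (cvgn_subcritical (k := k.+1) x0 xr)
  (cvgn_seriesMl (c := - ell) (cvgn_subcritical (k := k) x0 xr)).
by apply: (cvgn_series_eq H) => m; rewrite /e exprS; ring.
Qed.

Lemma cvg_D (x : R) : 0 <= x -> x < rho -> series (fun m => e m * x ^+ m) @ \oo --> D x.
Proof.
move=> x0 xr; suff : cvgn (series (fun m => e m * x ^+ m)) by [].
by apply: (cvgn_series_eq (e_cvg (k := 0%N) x0 xr)) => m; rewrite expr0 mul1r.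
Qed.

Lemma continuous_D (x : R) : 0 < x -> x < rho -> {for x, continuous D}.
Proof.
move=> x0 xr; pose K := (x + rho) / 2.
have K0 : 0 < K by rewrite divr_gt0 // addr_gt0.
have Kr : K < rho by rewrite /K; move: xr; lra.
have xK : x < K by rewrite /K; move: xr; lra.
have h0 : cvgn (pseries e K) by apply: cvgP; exact: (cvg_D (ltW K0) Kr).
have h1 : cvgn (pseries (pseries_diffs e) K).
  have /cvg_ex[l Hl] := e_cvg (k := 1%N) (ltW K0) Kr.
  by apply: cvgP; exact: (cvg_pseries_diffs K0 Hl).
have h2 : cvgn (pseries (pseries_diffs (pseries_diffs e)) K).
  have /cvg_ex[l Hl] := cvgn_seriesD (e_cvg (k := 2%N) (ltW K0) Kr) (cvgn_seriesMl (c := -1) (e_cvg (k := 1%N) (ltW K0) Kr)).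
  apply: cvgP; apply: (@cvg_pseries_diffs2 _ e K l K0).
  by apply: (cvg_series_eq Hl) => // m; ring.
have xK' : `|x| < `|K| by rewrite !gtr0_norm.
have d := pseries_snd_diffs h0 h1 h2 xK'.
by apply/differentiable_continuous/derivable1_diffP; apply: ex_derive.
Qed.

Lemma D_scale (x y Dx Dy : R) : 0 < x -> x < y ->
  series (fun m => e m * x ^+ m) @ \oo --> Dx ->
  series (fun m => e m * y ^+ m) @ \oo --> Dy ->
  (y / x) `^ ell * Dx < Dy.
Proof.
move=> x0 xy HX HY; have y0 : 0 < y by exact: lt_trans xy.
pose t := y / x; have t1 : 1 < t by rewrite ltr_pdivlMr // mul1r.
have t0 : 0 < t by rewrite (lt_trans ltr01).
have H := cvg_seriesD HY (cvg_seriesMl (c := - t `^ ell) HX).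
have E m : e m * y ^+ m + - t `^ ell * (e m * x ^+ m) =
    c m * x ^+ m * ((m%:R - ell) * (t `^ m%:R - t `^ ell)).
  rewrite /e powR_mulrn ?(ltW t0) // (_ : y = x * t) ?exprMn; first by ring.
  by rewrite /t mulrC divfK // gt_eqF.
have pos m : 0 <= e m * y ^+ m + - t `^ ell * (e m * x ^+ m).
  rewrite E; apply: mulr_ge0; first by rewrite mulr_ge0 ?exprn_ge0 // ltW.
  have [h|h] := leP ell m%:R.
    by rewrite mulr_ge0 ?subr_ge0 // ler_powR // ltW.
  by rewrite mulr_le0 ?subr_le0 ?(ltW h) // ler_powR // ltW.
rewrite -/t -subr_gt0 -mulNr; apply: lt_le_trans (ler_psum_lim 2 pos H).
rewrite !big_ord_recl big_ord0 /= !E c00 !mul0r add0r addr0 expr1.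
apply: mulr_gt0; first by rewrite mulr_gt0.
rewrite nmulr_rgt0 ?subr_lt0 //.
rewrite /powR gt_eqF // ltr_expR ltr_pM2r // ln_gt0 //.
Qed.

Lemma exists_saddle (Dr : R) : 0 < Dr ->
  series (fun m => e m * rho ^+ m) @ \oo --> Dr ->
  exists x : R, [/\ 0 < x, x < rho & D x = 0].
Proof.
move=> Dr0 HDr.
have /cvg_ex[B HB] := cvgn_critical1.
have B0 : 0 < B.
  apply: (@lt_le_trans _ _ (\sum_(i < 2) i%:R * c i * rho ^+ i)).
    by rewrite !big_ord_recl big_ord0 /= !mul0r add0r addr0 mul1r mulr_gt0 // expr1.
  by apply: ler_psum_lim HB => m; rewrite !mulr_ge0 ?exprn_ge0 // ltW.
have [x1 [x10 x1r D1]] : exists x : R, [/\ 0 < x, x < rho & 0 < D x].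
  have [n [nell Pn]] : exists n : nat, ell < n%:R /\ 0 < \sum_(m < n) e m * rho ^+ m.
    have H1 : \forall n \near \oo, 0 < series (fun m => e m * rho ^+ m) n.
      exact: (cvgr_gt Dr).
    have H2 : \forall n \near \oo, ell < n%:R :> R.
      by have /cvgryPgt/(_ ell) := @cvgr_idn R; exact.
    near \oo => n; exists n; split; first by near: n; exact: H2.
    by rewrite -(big_mkord xpredT (fun m => e m * rho ^+ m)); near: n; exact: H1.
  pose P : {poly R} := \poly_(m < n) e m.
  have PE (x : R) : P.[x] = \sum_(m < n) e m * x ^+ m by rewrite horner_poly.
  have cP : P.[rho * (1 - k.+2%:R^-1)] @[k --> \oo] --> P.[rho].
    have c1 : rho * (1 - k.+2%:R^-1) @[k --> \oo] --> rho.
      have h : (k.+1.+1%:R : R)^-1 @[k --> \oo] --> (0 : R).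
        by have := @cvg_harmonic R; rewrite -cvg_shiftS.
      by apply: cvgn_ext; [exact: (cvgnMl rho (cvgnB (cvg_cst (1 : R)) h))| |by rewrite subr0 mulr1].
    exact: (cvg_comp _ _ c1 (@continuous_horner R P rho)).
  have : \forall k \near \oo, 0 < P.[rho * (1 - k.+2%:R^-1)].
    by apply: (cvgr_gt P.[rho] cP); rewrite PE.
  case=> k _ /(_ k (leqnn k)) /= Pk.
  pose x := rho * (1 - k.+2%:R^-1).
  have k1 : (k.+2%:R^-1 : R) < 1 by rewrite invf_lt1 ?ltr1n ?ltr0n.
  have x0 : 0 < x by rewrite mulr_gt0 // subr_gt0.
  have xr : x < rho by rewrite gtr_pMr // gtrBl invr_gt0 ltr0n.
  exists x; split => //; apply: (lt_le_trans Pk); rewrite PE -/x.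
  apply: (cvgr_to_ge (cvg_D (ltW x0) xr)); near=> N.
  have nN : (n <= N)%N by near: N; exact: nbhs_infty_ge.
  rewrite -(big_mkord xpredT (fun m => e m * x ^+ m)) /series /=.
  rewrite [leRHS](big_cat_nat (leq0n n) nN) /= lerDl.
  rewrite big_nat_cond sumr_ge0 // => i /andP[/andP[ni _] _].
  rewrite mulr_ge0 ?exprn_ge0 ?(ltW x0) // mulr_ge0 // subr_ge0.
  by apply: le_trans (ltW nell) _; rewrite ler_nat.
have [x0 [x00 x01 D0]] : exists x : R, [/\ 0 < x, x < x1 & D x < 0].
  pose t := Num.min (x1 / rho / 2) (c 1%N * (ell - 1) * rho / (2 * B)).
  have ell0 : 0 < ell - 1 by rewrite subr_gt0.
  have t0 : 0 < t by rewrite lt_min !divr_gt0 ?mulr_gt0.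
  have tx : t * rho < x1.
    apply: (@le_lt_trans _ _ (x1 / 2)); last by rewrite ltr_pdivrMr // ltr_pMr // ltr1n.
    rewrite -ler_pdivlMr // mulrAC ge_min; apply/orP; left.
    by rewrite mulrAC.
  have t1 : t < 1.
    by rewrite -(ltr_pM2r rho0) mul1r (lt_trans tx).
  have tB : t * B <= c 1%N * (ell - 1) * rho / 2.
    rewrite -ler_pdivlMr // (_ : _ / 2 / B = c 1%N * (ell - 1) * rho / (2 * B)).
      by rewrite ge_min lexx orbT.
    by field; rewrite gt_eqF.
  exists (t * rho); split; rewrite ?mulr_gt0 //.
  have xr : t * rho < rho by rewrite gtr_pMl.
  have HD := cvg_D (ltW (mulr_gt0 t0 rho0)) xr.
  have HB2 := cvg_seriesMl (c := t ^+ 2) HB.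
  have : D (t * rho) <= t ^+ 2 * B - c 1%N * (ell - 1) * (t * rho).
    apply: (cvgr_to_le HD); near=> N.
    have N2 : (2 <= N)%N by near: N; exact: nbhs_infty_ge.
    have HBN : series (fun m => t ^+ 2 * (m%:R * c m * rho ^+ m)) N <= t ^+ 2 * B.
      rewrite /series /= big_mkord; apply: ler_psum_lim HB2 => m.
      by rewrite !mulr_ge0 ?exprn_ge0 ?(ltW t0) ?(ltW rho0).
    rewrite lerBrDr; apply: le_trans HBN; rewrite /series /=.
    rewrite !(big_cat_nat (leq0n 2) N2) /= !big_nat_recr //= !big_nil.
    rewrite /e c00 !expr1 !mul0r !mulr0 !add0r mul1r addrAC lerD //.
      have : 0 <= t ^+ 2 * (c 1%N * rho) by rewrite !mulr_ge0 ?exprn_ge0 ?(ltW t0) ?(ltW rho0) ?(ltW c10).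
      by apply: le_trans; rewrite le_eqVlt; apply/orP; left; apply/eqP; ring.
    apply: ler_sum_nat => m /andP[m2 _].
    have rm : 0 <= rho ^+ m by rewrite exprn_ge0 // ltW.
    have tm : t ^+ m <= t ^+ 2 by rewrite ler_wiXn2l // ltW.
    have cm : 0 <= c m * rho ^+ m by rewrite mulr_ge0.
    have h1 := ler_wpM2l (mulr_ge0 (ler0n R m) cm) tm.
    have tm0 : 0 <= t ^+ m by rewrite exprn_ge0 // ltW.
    have h2 : 0 <= ell * (c m * rho ^+ m * t ^+ m).
      by rewrite !mulr_ge0 // (le_trans ler01) // ltW.
    by rewrite exprMn; move: h1 h2; move: (rho ^+ m) (t ^+ m) (t ^+ 2) => X Y Z; lra.
  move=> h; apply: (le_lt_trans h); rewrite subr_lt0.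
  have h1 := ler_wpM2l (ltW t0) tB.
  have h2 : 0 < t * (c 1%N * (ell - 1) * rho) by rewrite !mulr_gt0.
  by move: h1 h2; lra.
have cD : {within `[x0, x1], continuous D}.
  apply: continuous_in_subspaceT => y; rewrite inE /= in_itv /= => /andP[y0 y1].
  by apply: continuous_D; [exact: lt_le_trans y0|exact: le_lt_trans x1r].
have [|x xin Dx] := IVT (ltW x01) cD (v := 0).
  by rewrite ge_min le_max (ltW D0) (ltW D1) orbT.
exists x; move: xin; rewrite in_itv /= => /andP[xx0 xx1]; split => //.
  exact: lt_le_trans xx0.
exact: le_lt_trans x1r.
Unshelve. all: by end_near. Qed.

End CriticalSeries.

(** * Tilted laws and block counts *)

Section AsymptoticEquivalence.
Variable R : realType.
Implicit Types f g : nat -> R.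

Lemma equiv_of_cvg f g : (\forall n \near \oo, g n != 0) ->
  f n / g n @[n --> \oo] --> (1 : R) -> f ~_\oo g.
Proof.
move=> g0 /cvgrPdist_le H; apply/eqaddoP => e e0; have He := H e e0.
near=> n; have gn : g n != 0 by near: n; exact: g0.
have Hn : `|1 - f n / g n| <= e by near: n; exact: He.
rewrite (_ : (f - g) n = (f n / g n - 1) * g n); last first.
  by rewrite mulrBl mul1r divfK.
by rewrite normrM distrC ler_wpM2r.
Unshelve. all: by end_near. Qed.

Lemma cvg_of_equiv f g : (\forall n \near \oo, g n != 0) ->
  f ~_\oo g -> f n / g n @[n --> \oo] --> (1 : R).
Proof.
move=> g0 /eqaddoP H; apply/cvgrPdist_le => e e0; have He := H e e0.
near=> n; have gn : g n != 0 by near: n; exact: g0.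
have Hn : `|(f - g) n| <= e * `|g n| by near: n; exact: He.
rewrite distrC -(ler_pM2r (x := `|g n|)) ?normr_gt0 // -normrM mulrBl mul1r divfK //.
Unshelve. all: by end_near. Qed.

End AsymptoticEquivalence.

Section TiltedLaw.
Variable R : realType.
Variables (c : nat -> R) (x A : R).
Hypotheses (c_ge0 : forall m, 0 <= c m) (x0 : 0 < x) (A0 : 0 < A).
Hypothesis cA : series (fun m => c m * x ^+ m) @ \oo --> A.

Definition tilted_law m := c m * x ^+ m * A^-1.

Lemma tilted_law_ge0 m : 0 <= tilted_law m.
Proof. by rewrite !mulr_ge0 ?exprn_ge0 ?invr_ge0 // ltW. Qed.

Lemma tilted_law_sum1 : series tilted_law @ \oo --> (1 : R).
Proof.
apply: (cvg_series_eq (cvg_seriesMl (c := A^-1) cA)) => [m|]; first by rewrite mulrC.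
by rewrite mulVf // gt_eqF.
Qed.

Lemma tilted_law_moment (k : nat) (M : R) :
  series (fun m => m%:R ^+ k * c m * x ^+ m) @ \oo --> M ->
  series (fun m => m%:R ^+ k * tilted_law m) @ \oo --> M / A.
Proof.
move=> H; apply: (cvg_series_eq (cvg_seriesMl (c := A^-1) H)) => [m|]; last by rewrite mulrC.
by rewrite /tilted_law; ring.
Qed.

Lemma tilted_law_mean (M : R) :
  series (fun m => m%:R * c m * x ^+ m) @ \oo --> M ->
  series (fun m => m%:R * tilted_law m) @ \oo --> M / A.
Proof.
move=> H; apply: (cvg_series_eq (cvg_seriesMl (c := A^-1) H)) => [m|]; last by rewrite mulrC.
by rewrite /tilted_law; ring.
Qed.

Lemma equiv_cpow (k K : R) (N : nat -> nat) : 0 < K ->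
  n%:R `^ k * cpow tilted_law (N n) n @[n --> \oo] --> K ->
  (fun n => cpow c (N n) n) ~_\oo (fun n => K * n%:R `^ (- k) * x ^- n * A ^+ N n).
Proof.
move=> K0 H.
have pos : \forall n \near \oo, 0 < K * n%:R `^ (- k) * x ^- n * A ^+ N n.
  near=> n; have n0 : (0 : R) < n%:R by rewrite ltr0n; near: n; exact: nbhs_infty_gt.
  by rewrite !mulr_gt0 ?powR_gt0 ?invr_gt0 ?exprn_gt0.
apply: equiv_of_cvg; first by apply: filterS pos => n; exact: lt0r_neq0.
have H1 := cvgnMr K^-1 H; rewrite divff ?gt_eqF // in H1.
apply: (cvgn_near H1); near=> n.
have n0 : (0 : R) < n%:R by rewrite ltr0n; near: n; exact: nbhs_infty_gt.
rewrite cpow_tilt exprVn powRN; have := powR_neq0 k n0; move: (n%:R `^ k) => Y Y0.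
by field; rewrite Y0 !expf_neq0 ?gt_eqF.
Unshelve. all: by end_near. Qed.

Lemma variance_gt0 (mean m2 : R) (j : nat) :
  series (fun m => m%:R * tilted_law m) @ \oo --> mean ->
  series (fun m => m%:R ^+ 2 * tilted_law m) @ \oo --> m2 ->
  0 < c j -> 0 < c j.+1 -> 0 < m2 - mean ^+ 2.
Proof.
move=> H1 H2 cj cj1.
have H : series (fun m => (m%:R - mean) ^+ 2 * tilted_law m) @ \oo --> m2 - mean ^+ 2.
  apply: (cvg_series_eq (cvg_seriesD (cvg_seriesD H2 (cvg_seriesMl (c := - 2 * mean) H1))
    (cvg_seriesMl (c := mean ^+ 2) tilted_law_sum1))) => [m|]; ring.
have pos m : 0 <= (m%:R - mean) ^+ 2 * tilted_law m.
  by rewrite mulr_ge0 ?sqr_ge0 // tilted_law_ge0.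
apply: lt_le_trans (ler_psum_lim j.+2 pos H).
rewrite !big_ord_recr /= -addrA ltr_wpDl ?sumr_ge0 //.
have tl m : 0 < c m -> 0 < tilted_law m.
  by move=> cm; rewrite !mulr_gt0 ?exprn_gt0 ?invr_gt0.
have [jm|jm] := eqVneq (j%:R : R) mean.
  rewrite ltr_wpDl ?pos // mulr_gt0 ?tl // lt0r sqr_ge0 andbT sqrf_eq0.
  by rewrite -natr1 jm addrC addKr oner_neq0.
rewrite ltr_pwDl ?pos // mulr_gt0 ?tl // lt0r sqr_ge0 andbT sqrf_eq0.
by rewrite subr_eq0.
Qed.

End TiltedLaw.

Section BlockCount.
Variable R : realType.
Variable lam : R.
Hypothesis lam0 : 0 < lam.
Let N (n : nat) : nat := Num.truncn (lam * n%:R).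

Lemma truncn_bounds n : (N n)%:R <= lam * n%:R < (N n)%:R + 1.
Proof. by rewrite natr1; apply: truncn_itv; rewrite mulr_ge0 // ltW. Qed.

Lemma cvg_truncn_ratio : (N n)%:R / n%:R @[n --> \oo] --> lam.
Proof.
suff H : lam - (N n)%:R / n%:R @[n --> \oo] --> (0 : R).
  apply: cvgn_ext; [exact: (cvgnB (cvg_cst lam) H)| |by rewrite subr0] => n /=.
  by rewrite opprB addrC subrK.
have e1 : -1 < 0 :> R by rewrite oppr_lt0.
apply: (cvgn0_le _ (cvgn0_powRy e1 (@cvgr_idn R))); near=> n.
have n0 : (0 : R) < n%:R by rewrite ltr0n; near: n; exact: nbhs_infty_gt.
have /andP[t1 t2] := truncn_bounds n.
rewrite powR_inv1 // (_ : lam - _ = (lam * n%:R - (N n)%:R) / n%:R).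
  rewrite normrM [X in _ * X]ger0_norm ?invr_ge0 // ler_piMl ?invr_ge0 //.
  by rewrite ger0_norm; lra.
by field; rewrite gt_eqF.
Unshelve. all: by end_near. Qed.

Lemma cvg_truncn_oo : ((N n)%:R : R) @[n --> \oo] --> +oo.
Proof.
have H := cvgnyMl lam0 (@cvgr_idn R).
apply/cvgryPge => B; have /cvgryPge/(_ (B + 1)) := H; apply: filterS => n.
by have /andP[_ t2] := truncn_bounds n; move: t2; lra.
Qed.

Lemma truncn_near_mean : \forall n \near \oo, `|n%:R - (N n)%:R * lam^-1| <= lam^-1.
Proof.
apply: nearW => n; have /andP[t1 t2] := truncn_bounds n.
have -> : n%:R - (N n)%:R * lam^-1 = (lam * n%:R - (N n)%:R) * lam^-1.
  by field; rewrite gt_eqF.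
rewrite normrM [X in _ * X]ger0_norm ?invr_ge0 ?(ltW lam0) //.
by rewrite ler_piMl ?invr_ge0 ?(ltW lam0) // ger0_norm; lra.
Qed.

Lemma cvg_truncn_powR (k K : R) (u : nat -> R) :
  (N n)%:R `^ k * u n @[n --> \oo] --> K ->
  n%:R `^ k * u n @[n --> \oo] --> lam `^ (- k) * K.
Proof.
move=> H; have H1 := cvgn_powR (a := - k) lam0 cvg_truncn_ratio.
apply: (cvgn_near (cvgnM H1 H)); near=> n.
have n0 : (0 : R) < n%:R by rewrite ltr0n; near: n; exact: nbhs_infty_gt.
have N0 : 0 < (N n)%:R :> R by near: n; exact: (cvgry_gt cvg_truncn_oo).
rewrite powRM ?(ltW N0) ?invr_ge0 ?(ltW n0) // -[n%:R^-1]powR_inv1 ?(ltW n0) //.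
rewrite -powRrM mulrNN mul1r powRN.
by field; rewrite powR_neq0.
Unshelve. all: by end_near. Qed.

End BlockCount.

Section GammaValues.
Variable R : realType.

Lemma Gamma_Bneg (y : R) : 0 < y -> y < 1 -> Gamma (- y) = - (euler_integral (1 - y) / y).
Proof.
move=> y0 y1; rewrite /Gamma oppr_gt0 ltNge (ltW y0) /= opprK.
have -> : Num.truncn y = 0%N by apply: truncn_def; rewrite ltW.
by rewrite big_ord1 addr0 addrC invrN mulrN.
Qed.

Lemma euler_integral_gt0 (y : R) : 0 < y -> y < 1 -> 0 < euler_integral y.
Proof.
move=> y0 y1; rewrite euler_integralE; apply: ker_integralC_gt0; lra.
Qed.

Lemma stable_density0_Gamma (al : R) : 1 < al -> al < 2 ->
  stable_density0 al = (al / `|Gamma (1 - al)|) `^ al^-1 / `|Gamma (- al^-1)|.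
Proof.
move=> al1 al2; have al0 : 0 < al by rewrite (lt_trans ltr01).
have a0 : 0 < al - 1 by rewrite subr_gt0.
have a1 : al - 1 < 1 by rewrite ltrBlDr.
have v0 : 0 < al^-1 by rewrite invr_gt0.
have v1 : al^-1 < 1 by rewrite invf_lt1.
have H := stable_density0E al1 al2.
have E2 : 0 < euler_integral (2 - al) by apply: euler_integral_gt0; lra.
have E1 : 0 < euler_integral (1 - al^-1) by apply: euler_integral_gt0; lra.
have E : 1 - (al - 1) = 2 - al by ring.
rewrite -(opprB al 1) !Gamma_Bneg // E !normrN !gtr0_norm ?divr_gt0 //.
have -> : al / (euler_integral (2 - al) / (al - 1)) = (euler_integral (2 - al) / (al * (al - 1)))^-1.
  by rewrite !invfM !invrK; ring.
have X0 : 0 <= euler_integral (2 - al) / (al * (al - 1)) by rewrite ltW // divr_gt0 // mulr_gt0.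
rewrite -powR_inv1 // -powRrM mulN1r -H.
by field; rewrite !gt_eqF.
Qed.

End GammaValues.

Theorem theorem2p2 (R : realType) (C : species) (b rho alpha : R)
    (C0_empty : #|C 'I_0| = 0%N) (C1_nonempty : (0 < #|C 'I_1|)%N)
    (b_gt0 : 0 < b) (rho_gt0 : 0 < rho) (alpha_gt1 : 1 < alpha)
    (alpha_lt2 : alpha < 2)
    (C_asymp : (fun n : nat => #|C 'I_n|%:R : R) ~_\oo
       (fun n : nat => b * n%:R `^ (- (1 + alpha)) * rho ^- n * n`!%:R))
    (lambda : R) (lambda_gt0 : 0 < lambda) (lambda_lt1 : lambda < 1) :
  let Cx : R -> R := egf C in
  let Cx' : R -> R := egf' C in
  let Cx'' : R -> R := egf'' C in
  let N (n : nat) : nat := Num.truncn (lambda * n%:R) in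
  let count (n : nat) : R :=
    (N n)`!%:R / n`!%:R * #|set_comp_nk C n (N n)|%:R in
  let lambda_star : R := Cx rho / (rho * Cx' rho) in
  let c_minus : R :=
    b * lambda / (Cx rho * (1 - lambda / lambda_star) `^ (alpha + 1)) in
  let c : R :=
    (alpha * Cx rho / (lambda_star * b * `|Gamma (1 - alpha)|)) `^ alpha^-1
      / `|Gamma (- alpha^-1)| in
  let is_x_lambda (x : R) : Prop :=
    0 < x < rho /\ x * Cx' x / Cx x = lambda^-1 in
  let sigma2 (x : R) : R :=
    x ^+ 2 * Cx'' x / Cx x + lambda^-1 - lambda ^- 2 in
  let c_plus (x : R) : R := (2 * pi * sigma2 x * lambda) `^ (- 2^-1) in
  [/\ lambda < lambda_star ->
        count ~_\oo (fun n : nat =>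
          c_minus * n%:R `^ (- alpha) * rho ^- n * Cx rho ^+ N n),
      lambda = lambda_star ->
        count ~_\oo (fun n : nat =>
          c * n%:R `^ (- alpha^-1) * rho ^- n * Cx rho ^+ N n) &
      lambda_star < lambda ->
        exists x : R, unique is_x_lambda x /\
          count ~_\oo (fun n : nat =>
            c_plus x * n%:R `^ (- 2^-1) * x ^- n * Cx x ^+ N n)].
Proof.
move=> Cx Cx' Cx'' N count lambda_star c_minus c is_x_lambda sigma2 c_plus.
pose a : nat -> R := egf_coef R C.
have a_ge0 m : 0 <= a m by rewrite divr_ge0.
have a0 : a 0%N = 0 by rewrite /a /egf_coef C0_empty mul0r.
have a1 : 0 < a 1%N by rewrite divr_gt0 // ltr0n.
have a_tail : a m * rho ^+ m * m%:R `^ (1 + alpha) @[m --> \oo] --> b.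
  have pos : \forall n \near \oo, 0 < b * n%:R `^ (- (1 + alpha)) * rho ^- n * n`!%:R.
    near=> n; have n0 : (0 : R) < n%:R by rewrite ltr0n; near: n; exact: nbhs_infty_gt.
    by rewrite !mulr_gt0 ?powR_gt0 ?invr_gt0 ?exprn_gt0 // ltr0n fact_gt0.
  have nz : \forall n \near \oo, b * n%:R `^ (- (1 + alpha)) * rho ^- n * n`!%:R != 0.
    by apply: filterS pos => n; exact: lt0r_neq0.
  have H := cvgnMr b (cvg_of_equiv nz C_asymp); rewrite mul1r in H.
  apply: (cvgn_near H); near=> n.
  have n0 : (0 : R) < n%:R by rewrite ltr0n; near: n; exact: nbhs_infty_gt.
  have f0 : (n`!%:R : R) != 0 by rewrite pnatr_eq0 -lt0n fact_gt0.
  rewrite /a /egf_coef powRN; have := powR_neq0 (1 + alpha) n0.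
  move: (n%:R `^ (1 + alpha)) => Y Y0.
  by field; rewrite f0 Y0 !expf_neq0 ?gt_eqF.
have countE n : count n = cpow a (N n) n by rewrite /count count_cpow.
have -> : count = fun n => cpow a (N n) n by apply/funext.
have a_pos : exists j, 0 < a j /\ 0 < a j.+1.
  have H : \forall m \near \oo, 0 < a m * rho ^+ m * m%:R `^ (1 + alpha).
    exact: (cvgr_gt b).
  have [j _ Hj] := H; exists j.
  have pj m : (j <= m)%N -> 0 < a m.
    move=> jm; have := Hj m jm; rewrite /= lt0r => /andP[nz _].
    rewrite lt0r a_ge0 andbT; apply: contraNneq nz => ->.
    by rewrite !mul0r.
  by split; apply: pj.
have Nratio := cvg_truncn_ratio lambda_gt0.
have Noo := cvg_truncn_oo lambda_gt0.
have Nmean := truncn_near_mean lambda_gt0.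
have CxP x : 0 < x -> x <= rho -> series (fun m => a m * x ^+ m) @ \oo --> Cx x.
  move=> x0; rewrite le_eqVlt => /predU1P[->|xr].
    have H : cvgn (series (fun m => a m * rho ^+ m)).
      exact: (cvgn_critical a_ge0 rho_gt0 alpha_gt1 a_tail).
    exact: H.
  have H := cvgn_subcritical a_ge0 rho_gt0 a_tail (k := 0) (ltW x0) xr.
  have H' : cvgn (series (fun m => a m * x ^+ m)).
    by apply: (cvgn_series_eq H) => m; rewrite expr0 mul1r.
  exact: H'.
have Cx'P x : 0 < x -> x <= rho ->
    series (fun m => m%:R * a m * x ^+ m) @ \oo --> x * Cx' x.
  move=> x0 xr.
  have [l Hl] : exists l : R, series (fun m => m%:R * a m * x ^+ m) @ \oo --> l.
    move: xr; rewrite le_eqVlt => /predU1P[->|xr].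
      by have /cvg_ex := cvgn_critical1 a_ge0 rho_gt0 alpha_gt1 a_tail.
    have /cvg_ex[l Hl] := cvgn_subcritical a_ge0 rho_gt0 a_tail (k := 1) (ltW x0) xr.
    by exists l; apply: (cvg_series_eq Hl) => // m; rewrite expr1.
  have <- : l = x * Cx' x; last exact: Hl.
  have -> : Cx' x = l / x by apply: cvg_lim => //; exact: cvg_pseries_diffs.
  by field; rewrite gt_eqF.
have Cx_gt0 x : 0 < x -> x <= rho -> 0 < Cx x.
  by move=> x0 xr; exact: (series_gt0 a_ge0 a0 a1 x0 (CxP x x0 xr)).
have xCx'_gt0 x : 0 < x -> x <= rho -> 0 < x * Cx' x.
  move=> x0 xr; apply: (@series_gt0 R (fun m => m%:R * a m) _ _ _ x _ x0 (Cx'P x x0 xr)).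
  - by move=> m; rewrite mulr_ge0.
  - by rewrite mul0r.
  - by rewrite mul1r.
set A := Cx rho; set B := rho * Cx' rho.
have A0 : 0 < A by exact: Cx_gt0.
have B0 : 0 < B by exact: xCx'_gt0.
have lsE : lambda_star = A / B by [].
have law_tail : tilted_law a rho A m * m%:R `^ (1 + alpha) @[m --> \oo] --> b / A.
  apply: cvgn_ext; [exact: (cvgnMr A^-1 a_tail)| |by []] => m.
  by rewrite /tilted_law; ring.
have be0 : 0 < b / A by rewrite divr_gt0.
have rho_le : rho <= rho by [].
have law_ge0 := tilted_law_ge0 a_ge0 rho_gt0 A0.
have law_sum1 := tilted_law_sum1 A0 (CxP rho rho_gt0 rho_le).
have law_mean := tilted_law_mean (A := A) (Cx'P rho rho_gt0 rho_le).
split.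
- move=> ll; have lm : lambda * (B / A) < 1.
    by rewrite mulrA ltr_pdivrMr // mul1r -ltr_pdivlMr.
  have mean0 : 0 < B / A by rewrite divr_gt0.
  have H := big_jump_limit law_ge0 law_sum1 law_mean alpha_gt1 alpha_lt2 be0 law_tail
    lambda_gt0 mean0 lm Nratio.
  have E : lambda * (b / A) * (1 - lambda * (B / A)) `^ (- (1 + alpha)) = c_minus.
    rewrite /c_minus -/A lsE invf_div powRN [1 + alpha]addrC invfM; ring.
  rewrite E in H; apply: (equiv_cpow rho_gt0 A0 _ H).
  have r0 : 0 < 1 - lambda * (B / A) by rewrite subr_gt0.
  by rewrite -E !mulr_gt0 ?invr_gt0 ?powR_gt0.
- move=> ll; have mE : B / A = lambda^-1 by rewrite ll lsE invf_div.
  rewrite mE in law_mean.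
  have H := stable_local_limit law_ge0 law_sum1 law_mean alpha_gt1 alpha_lt2 be0 law_tail
    Noo Nmean.
  have H1 : (N n)%:R `^ alpha^-1 * cpow (tilted_law a rho A) (N n) n @[n --> \oo] -->
      (b / A) `^ (- alpha^-1) * stable_density0 alpha.
    apply: cvgn_ext; [exact: (cvgnMl ((b / A) `^ (- alpha^-1)) H)| |by []] => n /=.
    rewrite [X in _ * (X * _)]powRM ?(ltW be0) // powRN.
    by field; rewrite powR_neq0.
  have H2 := cvg_truncn_powR lambda_gt0 H1.
  have E : lambda `^ (- alpha^-1) * ((b / A) `^ (- alpha^-1) * stable_density0 alpha) = c.
    rewrite stable_density0_Gamma // /c -ll -/A mulrA -powRM ?(ltW lambda_gt0) ?(ltW be0) //.
    have X0 : 0 < lambda * (b / A) by rewrite mulr_gt0.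
    rewrite -mulN1r powRrM powR_inv1 ?(ltW X0) // mulrA -powRM ?invr_ge0 ?(ltW X0) //.
      congr (_ `^ _ / _); rewrite !invfM invrK; ring.
    by rewrite divr_ge0 // ltW // (lt_trans ltr01).
  rewrite E in H2; apply: (equiv_cpow rho_gt0 A0 _ H2).
  have al0 : 0 < alpha by rewrite (lt_trans ltr01).
  have v0 : 0 < alpha^-1 by rewrite invr_gt0.
  have v1 : alpha^-1 < 1 by rewrite invf_lt1.
  have G1 : 0 < `|Gamma (1 - alpha)|.
    rewrite -(opprB alpha 1) Gamma_Bneg ?subr_gt0 // ?ltrBlDr // normrN.
    by rewrite normr_gt0 lt0r_neq0 // divr_gt0 ?subr_gt0 // euler_integral_gt0 //; lra.
  have G2 : 0 < `|Gamma (- alpha^-1)|.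
    rewrite Gamma_Bneg // normrN.
    by rewrite normr_gt0 lt0r_neq0 // divr_gt0 // euler_integral_gt0 //; lra.
  by rewrite /c -ll -/A divr_gt0 // powR_gt0 // divr_gt0 // !mulr_gt0.
- move=> ll.
  have ell1 : 1 < lambda^-1 by rewrite invf_gt1.
  have Dser x : 0 < x -> x <= rho ->
      series (fun m => a m * (m%:R - lambda^-1) * x ^+ m) @ \oo --> x * Cx' x - lambda^-1 * Cx x.
    move=> x0 xr; apply: (cvg_series_eq (cvg_seriesD (Cx'P x x0 xr)
      (cvg_seriesMl (c := - lambda^-1) (CxP x x0 xr)))) => [m|]; ring.
  have is_xP x : 0 < x -> x < rho -> is_x_lambda x <-> x * Cx' x - lambda^-1 * Cx x = 0.
    move=> x0 xr; have C0 := Cx_gt0 x x0 (ltW xr); rewrite /is_x_lambda x0 xr; split.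
      by case=> _ E; rewrite -E divfK ?subrr // gt_eqF.
    move=> E; split => //; move/eqP : E; rewrite subr_eq0 => /eqP ->.
    by rewrite mulfK // gt_eqF.
  have Dr0 : 0 < B - lambda^-1 * A.
    rewrite subr_gt0 mulrC ltr_pdivrMr // mulrC -ltr_pdivrMr //.
  have [x [x0 xr Dx]] := exists_saddle a_ge0 rho_gt0 alpha_gt1 a_tail a0 a1 ell1 Dr0
    (Dser rho rho_gt0 rho_le).
  have xle := ltW xr.
  have Dx0 : x * Cx' x - lambda^-1 * Cx x = 0.
    rewrite -[RHS]Dx; apply: esym; apply: cvg_lim => //; exact: Dser.
  have xP := (is_xP x x0 xr).2 Dx0.
  exists x; split.
    split => // y [/andP[y0 yr] yE]; have := (is_xP y y0 yr).1 (conj (introT andP (conj y0 yr)) yE).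
    move=> Dy0; have Sx := Dser x x0 xle; have Sy := Dser y y0 (ltW yr).
    rewrite Dx0 in Sx; rewrite Dy0 in Sy.
    case: (ltgtP x y) => [xy|yx|//].
      by have := D_scale a_ge0 a0 a1 ell1 x0 xy Sx Sy; rewrite mulr0 ltxx.
    by have := D_scale a_ge0 a0 a1 ell1 y0 yx Sy Sx; rewrite mulr0 ltxx.
  have Cx0 := Cx_gt0 x x0 xle.
  have [j [aj aj1]] := a_pos.
  have /cvg_ex[M2 HM2] := cvgn_subcritical a_ge0 rho_gt0 a_tail (k := 2) (ltW x0) xr.
  have /cvg_ex[M3 HM3] := cvgn_subcritical a_ge0 rho_gt0 a_tail (k := 3) (ltW x0) xr.
  have lx_ge0 := tilted_law_ge0 a_ge0 x0 Cx0.
  have lx_sum1 := tilted_law_sum1 Cx0 (CxP x x0 xle).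
  have lx_mean := tilted_law_mean (A := Cx x) (Cx'P x x0 xle).
  have lx2 := tilted_law_moment (A := Cx x) HM2.
  have lx3 := tilted_law_moment (A := Cx x) HM3.
  have mE : x * Cx' x / Cx x = lambda^-1 by have [] := xP.
  rewrite mE in lx_mean.
  have var0 := variance_gt0 a_ge0 x0 Cx0 (CxP x x0 xle) lx_mean lx2 aj aj1.
  have lj m : 0 < a m -> 0 < tilted_law a x (Cx x) m.
    move=> am; apply: mulr_gt0; last by rewrite invr_gt0.
    by apply: mulr_gt0 => //; exact: exprn_gt0.
  have H := gaussian_local_limit lx_ge0 lx_sum1 lx_mean lx2 lx3 var0 (lj _ aj) (lj _ aj1) Noo Nmean.
  have H2 := cvg_truncn_powR lambda_gt0 H.
  have sE : M2 / Cx x - lambda^-1 ^+ 2 = sigma2 x.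
    have -> : sigma2 x = x ^+ 2 * Cx'' x / Cx x + x * Cx' x / Cx x - lambda^-1 ^+ 2.
      by rewrite /sigma2 mE exprVn.
    have -> : Cx'' x = (M2 - x * Cx' x) / x ^+ 2.
      apply: cvg_lim => //; apply: cvg_pseries_diffs2 => //.
      apply: (cvg_series_eq (cvg_seriesD HM2 (cvg_seriesMl (c := -1) (Cx'P x x0 xle)))) => [m|]; last by rewrite mulN1r.
      by rewrite /a; ring.
    by field; rewrite !gt_eqF.
  have E : lambda `^ (- 2^-1) * (2 * pi * (M2 / Cx x - lambda^-1 ^+ 2)) `^ (- 2^-1) = c_plus x.
    rewrite /c_plus -sE -powRM ?(ltW lambda_gt0) 1?mulrC //.
    by rewrite mulr_ge0 ?(ltW var0) // mulr_ge0 ?pi_ge0.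
  rewrite E in H2; apply: (equiv_cpow x0 Cx0 _ H2).
  by rewrite -E mulr_gt0 ?powR_gt0 // mulr_gt0 // mulr_gt0 ?pi_gt0.
Unshelve. all: by end_near. Qed.
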